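(* Let $\alpha\in[0,1)$, $k\in\mathbb{Z}$, and let $A_\alpha(k)=A^-_\alpha(k)\oplus A^+_\alpha(k)$ on $L^2(\mathbb{R})\cong L^2(\mathbb{R}^-)\oplus L^2(\mathbb{R}^+)$, where $A^\pm_\alpha(k)$ acts as $S_{\alpha,k}=-\frac{\mathrm{d}^2}{\mathrm{d}x^2}+k^2|x|^{2\alpha}+\frac{\alpha(2+\alpha)}{4x^2}$ on $C^\infty_c(\mathbb{R}^\pm)$. Let $P\in C^\infty_c(\mathbb{R})$ with $P(x)=1$ for $|x|<1$ and $P(x)=0$ for $|x|>2$. Then for every $g\in\mathcal{D}(A_\alpha(k)^* )$ there exist a unique $\varphi=\varphi^-\oplus\varphi^+\in\mathcal{D}(\overline{A_\alpha(k)})$ (hence $\varphi^\pm\in H^2_0(\mathbb{R}^\pm)$ if $k\neq0$) and uniquely determined $g^\pm_0,g^\pm_1\in\mathbb{C}$ such that $g^\pm(x)=\varphi^\pm(x)+g^\pm_0|x|^{-\frac\alpha2}P(x)+g^\pm_1|x|^{1+\frac\alpha2}P(x)$ for all $x\in\mathbb{R}^\pm$. Here $g^\pm_0=\lim_{x\to0^\pm}|x|^{\alpha/2}g^\pm(x)$ and $g^\pm_1=\lim_{x\to0^\pm}|x|^{-(1+\alpha/2)}(g^\pm(x)-g^\pm_0|x|^{-\alpha/2})$.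
   Context: $g^\pm=g|_{\mathbb{R}^\pm}$. $A_\alpha(k)^*$ is the maximal realisation: $\mathcal{D}(A_\alpha(k)^* )=\{g\in L^2(\mathbb{R})\mid S_{\alpha,k}g^\pm\in L^2(\mathbb{R}^\pm)\}$ with weak derivatives. $H^2_0(\mathbb{R}^\pm)$ is the closure of $C^\infty_c(\mathbb{R}^\pm)$ in the $H^2$-norm. *)

(* Defs.v *)
From HB Require Import structures.
From mathcomp Require Import all_boot all_order all_algebra.
From mathcomp Require Import all_classical all_reals all_analysis.
From mathcomp Require Import complex.
Set Implicit Arguments. Unset Strict Implicit. Unset Printing Implicit Defensive.
Import Order.TTheory GRing.Theory Num.Theory.
Import numFieldNormedType.Exports.
Local Open Scope classical_set_scope.
Local Open Scope ring_scope.

Section Defs.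
Context {R : realType}.
Local Notation mu := (@lebesgue_measure R).

Definition cre (z : R[i]) : R := @complex.Re R z.
Definition cim (z : R[i]) : R := @complex.Im R z.

Definition Rneg : set R := [set x | x < 0].
Definition Rpos : set R := [set x | 0 < x].

Definition sqmod (z : R[i]) : R := cre z ^+ 2 + cim z ^+ 2.

Definition L2 (D : set R) (f : R -> R[i]) : Prop :=
  measurable_fun D (fun x => cre (f x)) /\ measurable_fun D (fun x => cim (f x)) /\
  (\int[mu]_(x in D) (sqmod (f x))%:E < +oo)%E.

Definition L2_cvg (D : set R) (u : nat -> R -> R[i]) (f : R -> R[i]) : Prop :=
  (fun n => \int[mu]_(x in D) (sqmod (u n x - f x))%:E)%E @ \oo --> 0%E.

Definition ae_eq_on (D : set R) (f h : R -> R[i]) : Prop :=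
  {ae mu, forall x, D x -> f x = h x}.

Definition smooth (u : R -> R) : Prop :=
  forall (n : nat) (x : R), derivable (derive1n n u) x 1.

Definition compact_support_in (D : set R) {V : zmodType} (f : R -> V) : Prop :=
  exists K : set R, compact K /\ K `<=` D /\ forall x, ~ K x -> f x = 0.

Definition rtest (D : set R) (u : R -> R) : Prop :=
  smooth u /\ compact_support_in D u.

Definition ctest (D : set R) (f : R -> R[i]) : Prop :=
  smooth (fun x => cre (f x)) /\ smooth (fun x => cim (f x)) /\ compact_support_in D f.

Definition cderive (n : nat) (f : R -> R[i]) : R -> R[i] :=
  fun x => Complex (derive1n n (fun y => cre (f y)) x) (derive1n n (fun y => cim (f y)) x).

Definition Vpot (alpha : R) (k : int) (x : R) : R :=
  (k%:~R) ^+ 2 * (`|x| `^ (2 * alpha)) + alpha * (2 + alpha) / (4 * x ^+ 2).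

Definition Sr (alpha : R) (k : int) (u : R -> R) : R -> R :=
  fun x => - derive1n 2 u x + Vpot alpha k x * u x.
Definition Sc (alpha : R) (k : int) (f : R -> R[i]) : R -> R[i] :=
  fun x => Complex (Sr alpha k (fun y => cre (f y)) x) (Sr alpha k (fun y => cim (f y)) x).

Definition weakS (alpha : R) (k : int) (D : set R) (g h : R -> R[i]) : Prop :=
  forall u : R -> R, rtest D u ->
    Rintegral mu D (fun x => cre (g x) * Sr alpha k u x) = Rintegral mu D (fun x => cre (h x) * u x) /\
    Rintegral mu D (fun x => cim (g x) * Sr alpha k u x) = Rintegral mu D (fun x => cim (h x) * u x).

(* domain of the adjoint A_alpha(k)^star : maximal realisation *)
Definition max_dom (alpha : R) (k : int) (g : R -> R[i]) : Prop :=
  L2 setT g /\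
  (exists h, L2 Rneg h /\ weakS alpha k Rneg g h) /\
  (exists h, L2 Rpos h /\ weakS alpha k Rpos g h).

Definition clos_dom_half (alpha : R) (k : int) (D : set R) (phi : R -> R[i]) : Prop :=
  L2 D phi /\
  exists u : nat -> R -> R[i], (forall n, ctest D (u n)) /\ L2_cvg D u phi /\
    exists h, L2 D h /\ L2_cvg D (fun n => Sc alpha k (u n)) h.

Definition clos_dom (alpha : R) (k : int) (phi : R -> R[i]) : Prop :=
  clos_dom_half alpha k Rneg phi /\ clos_dom_half alpha k Rpos phi.

Definition H2_0 (D : set R) (phi : R -> R[i]) : Prop :=
  L2 D phi /\
  exists u : nat -> R -> R[i], (forall n, ctest D (u n)) /\ L2_cvg D u phi /\
    (exists h1, L2 D h1 /\ L2_cvg D (fun n => cderive 1 (u n)) h1) /\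
    (exists h2, L2 D h2 /\ L2_cvg D (fun n => cderive 2 (u n)) h2).

Definition ess_lim0 (D : set R) (f : R -> R[i]) (l : R[i]) : Prop :=
  forall e : R, 0 < e -> exists d : R, 0 < d /\
    {ae mu, forall x, D x -> `|x| < d -> sqmod (f x - l) < e}.

Definition rsc (r : R) (z : R[i]) : R[i] := Complex (r * cre z) (r * cim z).

Definition decomp_rhs (alpha : R) (P : R -> R) (phi : R -> R[i]) (g0 g1 : R[i])
  : R -> R[i] :=
  fun x => phi x + rsc (`|x| `^ (- (alpha / 2)) * P x) g0
                 + rsc (`|x| `^ (1 + alpha / 2) * P x) g1.

End Defs.

(* Main.v *)
(* On the half-line write the operator as [S0 + V1] with [S0 = -d^2/dx^2 + c/x^2],
   [c = alpha (2 + alpha) / 4].  Variation of parameters with the two homogeneous solutions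
   [x^a], [x^b], [a = -alpha/2], [b = 1 + alpha/2], gives a right inverse [T] of [S0] with
   [(T f x)^2 <= C x^3 |f|^2].  A weak solution of [S g = h] satisfies
   [g = T (h - V1 g) + g0 x^a + g1 x^b] by the fundamental lemma of the calculus of
   variations, and [phi = g - (g0 x^a + g1 x^b) P] satisfies [phi = T (h' - V1 phi)] with
   [h'] in [L^2].  Such a [phi] lies in the domain of the closure: approximate
   [h' - V1 phi] by test functions, apply [T], and cut off at infinity, a Caccioppoli
   inequality controlling the first derivatives.  Conversely, every element of the domain
   of the closure has this form, hence is [O(x^(3/2))] at 0; since [alpha < 1] this
   yields the limits and the uniqueness.  A Rellich inequality, strict because [c < 3/4],
   bounds [u'] and [u''] by [u] and [S u] on test functions, whence [H^2_0].  The negative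
   half-line follows by reflection. *)
Require Import Defs.
From HB Require Import structures.
From mathcomp Require Import all_boot all_order all_algebra.
From mathcomp Require Import all_classical all_reals all_analysis.
From mathcomp Require Import complex.
From mathcomp Require Import measurable_realfun.
From mathcomp Require Import ring lra.
Set Implicit Arguments. Unset Strict Implicit. Unset Printing Implicit Defensive.
Import Order.TTheory GRing.Theory Num.Theory.
Import numFieldNormedType.Exports.
Local Open Scope classical_set_scope.
Local Open Scope ring_scope.

(** * Square-integrable functions *)

Section SquareIntegrable.
Context {R : realType}.
Local Notation mu := (@lebesgue_measure R).
Implicit Types (D E : set (measurableTypeR R)) (f g : R -> R).

(** The condition alpha < 1 says that the singular solution x^a is square integrable at 0 as well
    (the limit-circle case). Hence both integrals defining T can start at 0, and since a + b = 1
    Cauchy-Schwarz yields the same power x^3 for both. The remainder is of order x^(3/2) and b <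
    3/2, so it is negligible against both boundary terms. For a test function v, T v vanishes near
    0, so approximants built with T never need a cut-off at the singularity. At infinity T v grows
    in general like x^b, and V1 phi need not be square integrable. Estimates on T are therefore
    local, on ]0, N[, and the cut-off at scale n costs commutator terms of order 1/n. No regularity
    theory is used for weak solutions: T inverts S0 weakly on test functions by Green's formula, and
    on L^2 by density. The only smooth function supplied by the statement is P; bumps, steps and
    cut-offs come from it by translation, squaring, integration or scaling. The coefficients are
    real, so real and imaginary parts are treated separately. *)

Definition sqint D f : Prop :=
  measurable_fun D f /\ (\int[mu]_(x in D) (f x ^+ 2)%:E < +oo)%E.
(** The squared norm. [Rintegral] reads an infinite integral as 0, so upper bounds by [nsq] carry
    [sqint] hypotheses. Squares are kept throughout: (p + q)^2 <= 2 p^2 + 2 q^2 replaces the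
    triangle inequality. *)
Definition nsq D f : R := Rintegral mu D (fun x => f x ^+ 2).

Lemma sqint_integrable D f : measurable D -> sqint D f ->
  mu.-integrable D (EFin \o (fun x => f x ^+ 2)).
Proof.
move=> mD [mf fi]; apply/integrableP; split.
  by apply/measurable_EFinP; apply: measurable_funX.
apply: le_lt_trans fi; apply: ge0_le_integral => //=.
- by apply/measurable_EFinP; apply: measurableT_comp => //; exact: measurable_funX.
- by apply/measurable_EFinP; apply: measurable_funX.
- by move=> x _; rewrite lee_fin ger0_norm // sqr_ge0.
Qed.

Lemma integrable_sqint D f : measurable D -> measurable_fun D f ->
  mu.-integrable D (EFin \o (fun x => f x ^+ 2)) -> sqint D f.
Proof. by move=> mD mf fi; split=> //; exact: integrable_lty fi. Qed.

Lemma nsq_ge0 D f : 0 <= nsq D f.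
Proof. by apply: Rintegral_ge0 => x _; exact: sqr_ge0. Qed.

Lemma nsqE D f : measurable D -> sqint D f ->
  (\int[mu]_(x in D) (f x ^+ 2)%:E)%E = (nsq D f)%:E.
Proof.
move=> mD fi; rewrite /nsq /Rintegral fineK //.
by apply: integrable_fin_num => //; exact: sqint_integrable.
Qed.

Lemma integrable_le D f g : measurable D -> measurable_fun D f ->
  mu.-integrable D (EFin \o g) -> (forall x, D x -> `|f x| <= g x) ->
  mu.-integrable D (EFin \o f).
Proof.
move=> mD mf gi fg; apply: (le_integrable mD _ _ gi).
  exact/measurable_EFinP.
move=> x Dx /=; rewrite lee_fin.
by apply: le_trans (fg _ Dx) _; exact: ler_norm.
Qed.

Lemma sqint_le D f g : measurable D -> measurable_fun D f -> sqint D g ->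
  (forall x, D x -> `|f x| <= `|g x|) -> sqint D f.
Proof.
move=> mD mf gi fg; apply: integrable_sqint => //.
apply: (integrable_le mD _ (sqint_integrable mD gi)).
  exact: measurable_funX.
move=> x Dx; rewrite normrX -[leRHS]real_normK ?num_real //.
by rewrite lerXn2r ?nnegrE // fg.
Qed.

Lemma nsq_le D f g : measurable D -> measurable_fun D f -> sqint D g ->
  (forall x, D x -> `|f x| <= `|g x|) -> nsq D f <= nsq D g.
Proof.
move=> mD mf gi fg.
apply: le_Rintegral => //; last 2 [|exact: sqint_integrable].
  by apply: sqint_integrable => //; exact: sqint_le fg.
move=> x Dx; rewrite -[leLHS]real_normK ?num_real // -[leRHS]real_normK ?num_real //.
by rewrite lerXn2r ?nnegrE // fg.
Qed.

Lemma sqintM D f g : measurable D -> sqint D f -> sqint D g ->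
  mu.-integrable D (EFin \o (fun x => f x * g x)).
Proof.
move=> mD fi gi.
apply: (@integrable_le D _ (fun x => f x ^+ 2 + g x ^+ 2)) => //.
- by apply: measurable_funM; [case: fi|case: gi].
- have := integrableD mD (sqint_integrable mD fi) (sqint_integrable mD gi).
  by [].
- move=> x Dx; rewrite normrM -(real_normK (num_real (f x))) -(real_normK (num_real (g x))).
  have := normr_ge0 (f x); have := normr_ge0 (g x); nra.
Qed.

Lemma sqintZ D r f : measurable D -> sqint D f -> sqint D (fun x => r * f x).
Proof.
move=> mD fi; apply: integrable_sqint => //.
  by apply: measurable_funM => //; case: fi.
have := integrableZl mD (r ^+ 2) (sqint_integrable mD fi).
by apply: eq_integrable => // x _ /=; rewrite exprMn EFinM.
Qed.

Lemma sqintD D f g : measurable D -> sqint D f -> sqint D g ->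
  sqint D (fun x => f x + g x).
Proof.
move=> mD fi gi; have [mf _] := fi; have [mg _] := gi.
apply: integrable_sqint => //; first exact: measurable_funD.
have h : mu.-integrable D (EFin \o (fun x => 2 * f x ^+ 2 + 2 * g x ^+ 2)).
  have := integrableD mD (integrableZl mD 2 (sqint_integrable mD fi))
    (integrableZl mD 2 (sqint_integrable mD gi)).
  by [].
apply: (integrable_le mD _ h); first by apply: measurable_funX; exact: measurable_funD.
move=> x Dx; rewrite ger0_norm ?sqr_ge0 //.
have := sqr_ge0 (f x - g x); nra.
Qed.

Lemma sqintN D f : measurable D -> sqint D f -> sqint D (fun x => - f x).
Proof.
move=> mD fi; have := sqintZ (-1) mD fi.
by under eq_fun do rewrite mulN1r.
Qed.

Lemma sqintB D f g : measurable D -> sqint D f -> sqint D g ->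
  sqint D (fun x => f x - g x).
Proof. by move=> mD fi gi; apply: sqintD => //; exact: sqintN. Qed.

Lemma nsqD D f g : measurable D -> sqint D f -> sqint D g ->
  nsq D (fun x => f x + g x) <= 2 * nsq D f + 2 * nsq D g.
Proof.
move=> mD fi gi.
have ff := sqint_integrable mD fi; have gg := sqint_integrable mD gi.
rewrite /nsq -!RintegralZl // -RintegralD //; last 2 first.
- exact: (integrableZl mD 2 ff).
- exact: (integrableZl mD 2 gg).
apply: le_Rintegral => //.
- by apply: sqint_integrable => //; exact: sqintD.
- exact: (integrableD mD (integrableZl mD 2 ff) (integrableZl mD 2 gg)).
- move=> x _; have := sqr_ge0 (f x - g x); nra.
Qed.

Lemma nsqN D f : nsq D (fun x => - f x) = nsq D f.
Proof. by congr Rintegral; apply/funext => x; rewrite sqrrN. Qed.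

Lemma nsqB D f g : measurable D -> sqint D f -> sqint D g ->
  nsq D (fun x => f x - g x) <= 2 * nsq D f + 2 * nsq D g.
Proof.
move=> mD fi gi; rewrite -(nsqN D g).
by apply: nsqD => //; exact: sqintN.
Qed.

Lemma nsqZ D r f : measurable D -> sqint D f ->
  nsq D (fun x => r * f x) = r ^+ 2 * nsq D f.
Proof.
move=> mD fi; rewrite /nsq -RintegralZl //; last exact: sqint_integrable.
by congr Rintegral; apply/funext => x; rewrite exprMn.
Qed.

Lemma cauchy_schwarz_nsq D f g : measurable D -> sqint D f -> sqint D g ->
  (Rintegral mu D (fun x => f x * g x)) ^+ 2 <= nsq D f * nsq D g.
Proof.
move=> mD fi gi.
have ff := sqint_integrable mD fi; have gg := sqint_integrable mD gi.
have fg := sqintM mD fi gi.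
set I := Rintegral _ _ _.
have key (r s : R) : 0 <= r ^+ 2 * nsq D f - 2 * (r * s) * I + s ^+ 2 * nsq D g.
  rewrite /nsq /I -!RintegralZl // -RintegralB //; last 2 first.
  - exact: (integrableZl mD (r ^+ 2) ff).
  - exact: (integrableZl mD (2 * (r * s)) fg).
  rewrite -RintegralD //; last 2 first.
  - exact: (integrableB mD (integrableZl mD (r ^+ 2) ff) (integrableZl mD (2 * (r * s)) fg)).
  - exact: (integrableZl mD (s ^+ 2) gg).
  apply: Rintegral_ge0 => x _.
  have := sqr_ge0 (r * f x - s * g x); nra.
have f0 := nsq_ge0 D f; have g0 := nsq_ge0 D g.
(* If [nsq D f] is 0, the choice r = [nsq D g + 1], s = [I] leaves [- (nsq D g + 2) * I ^+ 2 >= 0],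
   hence [I = 0]. *)
have [f00|fn0] := eqVneq (nsq D f) 0.
  have k1 := key (nsq D g + 1) I; have k2 := key (- (nsq D g + 1)) I.
  rewrite f00 mul0r; rewrite f00 in k1 k2; have := key (nsq D g + 1) I.
  rewrite f00; move: k1; set G := nsq D g in g0 *; move=> k1 _; nra.
(* This choice turns the form into [nsq D f * (nsq D f * nsq D g - I ^+ 2)]. *)
have := key I (nsq D f).
have fp : 0 < nsq D f by rewrite lt_neqAle eq_sym fn0.
move=> k; have : 0 <= nsq D f * (nsq D f * nsq D g - I ^+ 2) by nra.
by rewrite pmulr_rge0 // subr_ge0.
Qed.

Lemma sqintS D E f : measurable D -> measurable E -> E `<=` D ->
  sqint D f -> sqint E f.
Proof.
move=> mD mE ED fi; apply: integrable_sqint => //.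
  by apply: measurable_funS ED _ => //; case: fi.
exact: (integrableS mD mE ED (sqint_integrable mD fi)).
Qed.

Lemma nsqS D E f : measurable D -> measurable E -> E `<=` D ->
  sqint D f -> nsq E f <= nsq D f.
Proof.
move=> mD mE ED fi; rewrite -lee_fin -!nsqE //; last exact: sqintS fi.
apply: ge0_subset_integral => //.
  by apply/measurable_EFinP; apply: measurable_funX; case: fi.
by move=> x _; rewrite lee_fin sqr_ge0.
Qed.

Lemma eq_nsq D f g : (forall x, D x -> f x = g x) -> nsq D f = nsq D g.
Proof. by move=> fg; apply: eq_Rintegral => x /set_mem Dx; rewrite fg. Qed.

Lemma eq_sqint D f g : measurable D -> (forall x, D x -> f x = g x) ->
  sqint D f -> sqint D g.
Proof.
move=> mD fg fi; apply: (sqint_le mD _ fi) => [|x Dx]; last by rewrite fg.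
by apply: eq_measurable_fun (proj1 fi) => x /set_mem; exact: fg.
Qed.

Lemma sqint_patch D E f : measurable D -> measurable E ->
  sqint (D `&` E) f -> sqint D (f \_ E).
Proof.
move=> mD mE fi.
have mDE : measurable (D `&` E) by exact: measurableI.
apply: integrable_sqint => //.
  have [mf _] := fi.
  by apply/measurable_restrict => //; rewrite setIC.
have h := sqint_integrable mDE fi.
have /= := integrable_restrict mu mE mD (EFin \o (fun x => f x ^+ 2)).
move=> H; move: h; rewrite H.
apply: eq_integrable => // x _ /=; rewrite !patchE /=; case: ifPn => //.
by rewrite expr0n.
Qed.

Lemma nsq_eq0 D f : measurable D -> sqint D f -> nsq D f = 0 ->
  {ae mu, forall x, D x -> f x = 0}.
Proof.
move=> mD fi f0.
have mf2 : measurable_fun D (EFin \o (fun x => f x ^+ 2)).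
  by apply/measurable_EFinP; apply: measurable_funX; case: fi.
have [+ _] := ae_eq_integral_abs mu mD mf2.
have -> : (\int[mu]_(x in D) `|(f x ^+ 2)%:E|)%E = 0%E.
  rewrite -[RHS]/((0 : R)%:E) -f0 -nsqE //; apply: eq_integral => x _ /=.
  by rewrite ger0_norm // sqr_ge0.
move=> /(_ erefl); apply: filterS => x /= h Dx.
by have [/eqP] := h Dx; rewrite sqrf_eq0 => /eqP.
Qed.

End SquareIntegrable.

(** * Smooth functions on the half-line *)

Section Smooth.
Context {R : realType}.
Implicit Types (U : set R) (u v f F : R -> R).

(** The functions are total, but for open [U] only their values in [U] matter ([smooth_on_eq]); real
    powers and integrals from 0 may thus take any value at x <= 0. *)
Definition smooth_on U u : Prop :=
  forall (n : nat) (x : R), U x -> derivable (derive1n n u) x 1.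

Lemma smooth_onT u : smooth u <-> smooth_on setT u.
Proof. by split=> [h n x _|h n x]; exact: h. Qed.

Lemma derive1_eq_on U u v : open U -> (forall x, U x -> u x = v x) ->
  forall x, U x -> (derive1 u) x = (derive1 v) x.
Proof.
move=> oU uv x Ux; rewrite !derive1E; apply: near_eq_derive.
by have := open_nbhs_nbhs (conj oU Ux); apply: filterS => y; exact: uv.
Qed.

Lemma derive1n_eq_on U u v n : open U -> (forall x, U x -> u x = v x) ->
  forall x, U x -> (derive1n n u) x = (derive1n n v) x.
Proof.
move=> oU; elim: n => [//|n IH] uv x Ux; rewrite !derive1nS.
by apply: derive1_eq_on oU _ _ Ux => y; exact: IH.
Qed.

Lemma derivable_eq_on U u v : open U -> (forall x, U x -> u x = v x) ->
  forall x, U x -> derivable u x 1 -> derivable v x 1.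
Proof.
move=> oU uv x Ux; apply: near_eq_derivable.
by have := open_nbhs_nbhs (conj oU Ux); apply: filterS => y Uy; rewrite uv.
Qed.

Lemma is_derive_eq_on U u v x d : open U -> (forall x, U x -> u x = v x) ->
  U x -> is_derive x 1 u d -> is_derive x 1 v d.
Proof.
move=> oU uv Ux; apply: near_eq_is_derive.
by have := open_nbhs_nbhs (conj oU Ux); apply: filterS => y Uy; rewrite uv.
Qed.

Lemma smooth_on_eq U u v : open U -> (forall x, U x -> u x = v x) ->
  smooth_on U u -> smooth_on U v.
Proof.
move=> oU uv su n x Ux; apply: (derivable_eq_on oU _ Ux (su n x Ux)).
by move=> y; exact: derive1n_eq_on.
Qed.

Lemma smooth_onS U V u : V `<=` U -> smooth_on U u -> smooth_on V u.
Proof. by move=> VU su n x /VU; exact: su. Qed.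

Lemma smooth_onU U V u : smooth_on U u -> smooth_on V u -> smooth_on (U `|` V) u.
Proof. by move=> su sv n x [|]; [exact: su|exact: sv]. Qed.

Lemma smooth_on_derive1 U u : smooth_on U u -> smooth_on U (derive1 u).
Proof. by move=> su n x Ux; rewrite -derive1Sn; exact: su. Qed.

Lemma smooth_on_is_derive U u x : smooth_on U u -> U x -> is_derive x 1 u ((derive1 u) x).
Proof. by move=> su Ux; apply: DeriveDef; [exact: (su 0%N)|rewrite derive1E]. Qed.

Lemma smooth_on_continuous U u x : smooth_on U u -> U x -> {for x, continuous u}.
Proof.
move=> su Ux; apply: differentiable_continuous.
by apply/derivable1_diffP; exact: (su 0%N).
Qed.

(** Replaces formulas for higher derivatives: it is enough to exhibit a class stable under
    differentiation, and induction on the order does the rest. *)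
Lemma smooth_on_coind U (Q : (R -> R) -> Prop) : open U ->
  (forall u, Q u -> exists v, Q v /\ forall x, U x -> is_derive x 1 u (v x)) ->
  forall u, Q u -> smooth_on U u.
Proof.
move=> oU HQ u Qu n; elim: n u Qu => [|n IH] u /HQ [v [Qv uv]] x Ux.
  by have [] := uv _ Ux.
rewrite derive1Sn; apply: (derivable_eq_on oU _ Ux (IH _ Qv _ Ux)) => y Uy.
apply: (derive1n_eq_on n oU _ Uy) => z Uz; rewrite derive1E.
by have [_ ->] := uv _ Uz.
Qed.

(** The class fed to [smooth_on_coind] for sums and products: products alone are not stable under
    differentiation, sums of products are, so Leibniz's formula is never written. *)
Inductive smooth_alg U : (R -> R) -> Prop :=
| smooth_alg_base u : smooth_on U u -> smooth_alg U u
| smooth_algD u v : smooth_alg U u -> smooth_alg U v -> smooth_alg U (u \+ v)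
| smooth_algM u v : smooth_alg U u -> smooth_alg U v -> smooth_alg U (u \* v).

Lemma smooth_alg_smooth U u : open U -> smooth_alg U u -> smooth_on U u.
Proof.
move=> oU; apply: smooth_on_coind => // {}u.
elim=> {u} [u su|u v _ [u' [qu du]] _ [v' [qv dv]]|
            u v qu [u' [qu' du]] qv [v' [qv' dv]]].
- exists (derive1 u); split; first by apply: smooth_alg_base; exact: smooth_on_derive1.
  by move=> x; exact: smooth_on_is_derive.
- exists (u' \+ v'); split; first exact: smooth_algD.
  by move=> x Ux; have := du _ Ux; have := dv _ Ux => ? ?; exact: is_deriveD.
- exists (u \* v' \+ v \* u'); split.
    by apply: smooth_algD; apply: smooth_algM.
  by move=> x Ux; have := du _ Ux; have := dv _ Ux => ? ?; exact: is_deriveM.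
Qed.

Lemma smooth_onD U u v : open U -> smooth_on U u -> smooth_on U v ->
  smooth_on U (fun x => u x + v x).
Proof.
move=> oU su sv; apply: (@smooth_alg_smooth _ (u \+ v)) => //.
by apply: smooth_algD; exact: smooth_alg_base.
Qed.

Lemma smooth_onM U u v : open U -> smooth_on U u -> smooth_on U v ->
  smooth_on U (fun x => u x * v x).
Proof.
move=> oU su sv; apply: (@smooth_alg_smooth _ (u \* v)) => //.
by apply: smooth_algM; exact: smooth_alg_base.
Qed.

Lemma smooth_on_cst U (c : R) : open U -> smooth_on U (fun=> c).
Proof.
move=> oU; apply: (@smooth_on_coind _ (fun u => exists c : R, u = fun=> c)) => //.
  move=> _ [d ->]; exists (fun=> 0); split; first by exists 0.
  by move=> x _; exact: is_derive_cst.
by exists c.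
Qed.

Lemma smooth_onZ U (c : R) u : open U -> smooth_on U u -> smooth_on U (fun x => c * u x).
Proof. move=> oU su; exact: (@smooth_onM U (fun=> c) u oU (@smooth_on_cst U c oU) su). Qed.

Lemma smooth_onN U u : open U -> smooth_on U u -> smooth_on U (fun x => - u x).
Proof.
move=> oU su; have := @smooth_onZ _ (-1) _ oU su.
by under eq_fun do rewrite mulN1r.
Qed.

Lemma smooth_onB U u v : open U -> smooth_on U u -> smooth_on U v ->
  smooth_on U (fun x => u x - v x).
Proof. by move=> oU su sv; exact: (smooth_onD oU su (smooth_onN oU sv)). Qed.

Lemma smooth_on_primitive U f F : open U -> smooth_on U f ->
  (forall x, U x -> is_derive x 1 F (f x)) -> smooth_on U F.
Proof.
move=> oU sf dF.
apply: (@smooth_on_coind _ (fun u => smooth_on U u \/ u = F)) => //; last by right.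
move=> u [su|->].
  exists (derive1 u); split; first by left; exact: smooth_on_derive1.
  by move=> x; exact: smooth_on_is_derive.
by exists f; split; [left|].
Qed.

Lemma is_derive_affine V (k m : R) u (x : R) : smooth_on V u -> V (k * x + m) ->
  is_derive x 1 (fun y => u (k * y + m)) (k * (derive1 u) (k * x + m)).
Proof.
move=> su Vx; have dv := smooth_on_is_derive su Vx.
have dk : is_derive x 1 (fun y => k * y + m) k.
  by apply: is_derive_eq; rewrite scaler1 ?scaler0 ?addr0.
have := @is_derive1_comp _ u _ x _ _ dv dk.
by rewrite mulrC.
Qed.

Lemma smooth_on_affine U V (k m : R) u : open U -> (forall x, U x -> V (k * x + m)) ->
  smooth_on V u -> smooth_on U (fun x => u (k * x + m)).
Proof.
move=> oU UV su.
(* The factor [c] absorbs the powers of [k] produced by successive derivatives. *)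
apply: (@smooth_on_coind _ (fun w => exists (c : R) v, smooth_on V v /\ w = fun x => c * v (k * x + m))) => //.
  move=> _ [c [v [sv ->]]].
  exists (fun x => (c * k) * (derive1 v) (k * x + m)); split.
    by exists (c * k), (derive1 v); split; [exact: smooth_on_derive1|by []].
  move=> x Ux; have dv := is_derive_affine sv (UV _ Ux).
  apply: is_derive_eq; rewrite -[_ *: _]/(_ * _).
  exact: mulrA.
by exists 1, u; split=> //; apply/funext => x; rewrite mul1r.
Qed.

Lemma open_Rpos : open (@Rpos R).
Proof. exact: open_gt. Qed.

Lemma RposE : @Rpos R = `]0, +oo[%classic.
Proof. by apply/seteqP; split=> x /=; rewrite in_itv /= andbT. Qed.

Lemma measurable_Rpos : measurable (@Rpos R : set (measurableTypeR R)).
Proof. by rewrite RposE; exact: measurable_itv. Qed.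

Lemma smooth_on_powR (s : R) : smooth_on Rpos (fun x => x `^ s).
Proof.
apply: (@smooth_on_coind _ (fun w => exists c s : R, w = fun x => c * x `^ s)).
- exact: open_Rpos.
- move=> _ [c [r ->]]; exists (fun x => (c * r) * x `^ (r - 1)); split.
    by exists (c * r), (r - 1).
  move=> x x0; have := is_derive1_powR r x0 => h.
  by apply: is_derive_eq; rewrite -[_ *: _]/(_ * _); ring.
- by exists 1, s; apply/funext => x; rewrite mul1r.
Qed.


Lemma is_derive_eq0_on U u (x d : R) : open U -> U x -> (forall y, U y -> u y = 0) ->
  is_derive x 1 u d -> d = 0.
Proof.
move=> oU Ux u0 [_ <-].
rewrite -derive1E (@derive1_eq_on U u (cst 0) oU u0 x Ux) derive1E.
exact: derive_cst.
Qed.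

Lemma is_derive_continuous (u : R -> R) (x d : R) : is_derive x 1 u d -> {for x, continuous u}.
Proof. by move=> [du _]; apply: differentiable_continuous; apply/derivable1_diffP. Qed.

Definition cpos f := forall x : R, 0 < x -> {for x, continuous f}.

Lemma continuous_Rpos_measurable f : cpos f ->
  measurable_fun (Rpos : set (measurableTypeR R)) f.
Proof.
move=> cf; apply: open_continuous_measurable_fun; first exact: open_Rpos.
by move=> x /set_mem; exact: cf.
Qed.

Lemma continuous_within_Rpos a b f : 0 < a -> cpos f ->
  {within `[a, b], continuous f}.
Proof.
move=> a0 cf; apply: continuous_in_subspaceT => x /set_mem /=.
by rewrite in_itv /= => /andP[ax _]; apply: cf; exact: lt_le_trans ax.
Qed.

Lemma continuous_Rpos_bounded a b f : 0 < a -> a <= b ->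
  cpos f ->
  exists M, forall x, a <= x <= b -> `|f x| <= M.
Proof.
move=> a0 ab cf.
have cf' : {within `[a, b], continuous (fun x => `|f x|)}.
  apply: continuous_within_Rpos => // x x0.
  by apply: (@continuous_comp _ _ _ f Num.norm); [exact: cf|exact: norm_continuous].
have [c _ H] := EVT_max ab cf'.
by exists `|f c| => x xab; apply: H; rewrite in_itv.
Qed.

(** No limit at 0 is taken: [G], and hence [g], vanishes on ]0, d[, so the integral is really one
    over [e, x] with e below both d and x. *)
Lemma FTC_Rpos (G g : R -> R) (d x : R) : 0 < d -> 0 < x ->
  (forall y : R, 0 < y -> is_derive y 1 G (g y)) ->
  cpos g ->
  (forall y, 0 < y < d -> G y = 0) ->
  (\int[@lebesgue_measure R]_(y in `]0%R, x[) g y)%R = G x.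
Proof.
move=> d0 x0 dG cg G0.
have oU : open [set y : R | 0 < y < d].
  have -> : [set y : R | 0 < y < d] = [set y | 0 < y] `&` [set y | y < d].
    by apply/seteqP; split => y /= => [/andP//|[-> ->]].
  by apply: openI; [exact: open_gt|exact: open_lt].
have g0 y : 0 < y < d -> g y = 0.
  move=> yd; apply: (is_derive_eq0_on oU (yd : [set y : R | 0 < y < d] y) G0).
  by apply: dG; case/andP: yd.
pose e := Num.min (x / 2) (d / 2).
have e0 : 0 < e by rewrite lt_min !divr_gt0.
have ex : e < x by rewrite gt_min ltr_pdivrMr // ltr_pMr // ltr1n.
have ed : e < d by rewrite gt_min [X in _ || X]ltr_pdivrMr // ltr_pMr // ltr1n orbT.
have cgw : {within `[e, x], continuous g} by exact: continuous_within_Rpos.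
have ig : (@lebesgue_measure R).-integrable `[e, x] (EFin \o g).
  by apply: continuous_compact_integrable => //; exact: segment_compact.
have -> : (\int[@lebesgue_measure R]_(y in `]0%R, x[) g y)%R =
          (\int[@lebesgue_measure R]_(y in `[e, x[) g y)%R.
  rewrite Rintegral_mkcond [RHS]Rintegral_mkcond; congr Rintegral.
  apply/funext => y; rewrite !patchE.
  case: ifPn => [|/negP] /=; rewrite inE /= in_itv /=.
    move=> /andP[y0 yx]; case: ifPn => // /negP; rewrite inE /= in_itv /= yx andbT.
    by move/negP; rewrite -ltNge => ye; apply: g0; rewrite y0 (lt_trans ye).
  move=> /negP; rewrite negb_and -!leNgt => /orP H.
  case: ifPn => //; rewrite inE /= in_itv /= => /andP[ey yx]; exfalso.
  by case: H => [|]; rewrite leNgt ?yx // (lt_le_trans e0 ey).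
rewrite Rintegral_itv_bndo_bndc; last first.
  by apply: integrableS ig => //; exact: subset_itv_co_cc.
rewrite /Rintegral (@continuous_FTC2 _ g G e x ex) //.
- have -> : G e = 0 by apply: G0; rewrite e0 ed.
  by rewrite /= subr0.
- apply: (@derivable_oo_continuousW _ _ (e / 2) (x + 1)) => //.
  + by apply: subset_itv; rewrite bnd_simp; [rewrite ler_pdivrMr // ler_pMr // ler1n|rewrite lerDl].
  + split.
    * by move=> y; rewrite in_itv /= => /andP[ey _]; have [] := dG y (lt_trans (divr_gt0 e0 (ltr0Sn _ _)) ey).
    * apply: cvg_at_right_filter; apply: (is_derive_continuous (dG _ _)); exact: divr_gt0.
    * apply: cvg_at_left_filter; apply: (is_derive_continuous (dG _ _)); exact: addr_gt0.
- move=> y; rewrite in_itv /= => /andP[ey _]; rewrite derive1E.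
  by have [_ ->] := dG y (lt_trans e0 ey).
Qed.


Lemma cposD f g : cpos f -> cpos g -> cpos (fun x => f x + g x).
Proof. by move=> cf cg x x0; apply: continuousD; [exact: cf|exact: cg]. Qed.

Lemma cposM f g : cpos f -> cpos g -> cpos (fun x => f x * g x).
Proof. by move=> cf cg x x0; apply: continuousM; [exact: cf|exact: cg]. Qed.

Lemma cpos_cst (c : R) : cpos (fun=> c).
Proof. by move=> x x0; exact: cst_continuous. Qed.

Lemma cposN f : cpos f -> cpos (fun x => - f x).
Proof. by move=> cf x x0; apply: continuousN; exact: cf. Qed.

Lemma cposB f g : cpos f -> cpos g -> cpos (fun x => f x - g x).
Proof. by move=> cf cg; apply: cposD => //; exact: cposN. Qed.

Lemma cpos_smooth f : smooth_on Rpos f -> cpos f.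
Proof. by move=> sf x x0; exact: smooth_on_continuous sf x0. Qed.

Lemma cpos_powR (s : R) : cpos (fun x => x `^ s).
Proof. by apply: cpos_smooth; exact: smooth_on_powR. Qed.

Definition supp_in (d N : R) f : Prop := forall x : R, 0 < x -> x < d \/ N < x -> f x = 0.

Definition cptpos f : Prop := exists d N : R, [/\ 0 < d, d < N & supp_in d N f].

Lemma cptpos_imp f g : cptpos f -> (forall x : R, 0 < x -> f x = 0 -> g x = 0) -> cptpos g.
Proof.
move=> [d [N [d0 dN sf]]] fg; exists d, N; split=> // x x0 H.
by apply: fg => //; exact: sf.
Qed.

Lemma cptposMl f g : cptpos f -> cptpos (fun x => f x * g x).
Proof. by move=> cf; apply: cptpos_imp cf _ => x _ ->; rewrite mul0r. Qed.

Lemma cptposMr f g : cptpos f -> cptpos (fun x => g x * f x).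
Proof. by move=> cf; apply: cptpos_imp cf _ => x _ ->; rewrite mulr0. Qed.

Lemma cptposD f g : cptpos f -> cptpos g -> cptpos (fun x => f x + g x).
Proof.
move=> [d [N [d0 dN sf]]] [d' [N' [d0' dN' sg]]].
exists (Num.min d d'), (Num.max N N'); split.
- by rewrite lt_min d0 d0'.
- by rewrite gt_min !lt_max dN.
- move=> x x0; rewrite lt_min gt_max => -[/andP[xd xd']|/andP[Nx Nx']].
    by rewrite sf ?sg ?addr0 //; left.
  by rewrite sf ?sg ?addr0 //; right.
Qed.

Lemma cptpos_derive1 f : cptpos f -> cptpos (derive1 f).
Proof.
move=> [d [N [d0 dN sf]]]; exists d, N; split=> // x x0 xdN.
have oU : open ([set x : R | 0 < x] `&` ([set x : R | x < d] `|` [set x : R | N < x])).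
  by apply: openI; [exact: open_gt|apply: openU; [exact: open_lt|exact: open_gt]].
rewrite (@derive1_eq_on _ f (cst 0) oU _ x) //.
  by rewrite derive1E; exact: derive_cst.
by move=> y [y0]; exact: sf.
Qed.

Lemma cptpos_bound f : cpos f -> cptpos f -> exists d N M : R,
  [/\ 0 < d, d < N & forall x, 0 < x -> `|f x| <= M * (\1_`[d, N] x)].
Proof.
move=> cf [d [N [d0 dN sf]]].
have [M HM] := continuous_Rpos_bounded d0 (ltW dN) cf.
exists d, N, M; split=> // x x0; rewrite indicE.
have [xi|xi] := boolP (x \in `[d, N]%classic).
  by rewrite mulr1; apply: HM; move: xi; rewrite inE /= in_itv.
rewrite mulr0 sf ?normr0 //.
move: xi; rewrite notin_setE /= in_itv /= => /negP.
by rewrite negb_and -!ltNge => /orP.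
Qed.

Lemma cptpos_sqint f : cpos f -> cptpos f -> sqint Rpos f.
Proof.
move=> cf sf; have [d [N [M [d0 dN fM]]]] := cptpos_bound cf sf.
have mR := @measurable_Rpos.
apply: (@sqint_le _ _ _ (fun x => M * \1_`[d, N] x)) => //.
- exact: continuous_Rpos_measurable.
- apply: sqintZ => //; apply: integrable_sqint => //.
  have : (@lebesgue_measure R).-integrable Rpos (EFin \o (\1_`[d, N] : R -> R)).
    by apply: (@integrableS _ _ _ _ setT) => //; exact: integrable_indic_itv.
  apply: eq_integrable => // x _ /=; rewrite indicE.
  by case: (_ \in _); rewrite ?expr1n ?expr0n.
- by move=> x x0; apply: le_trans (fM _ x0) _; exact: ler_norm.
Qed.

Lemma cptpos_integrable f : cpos f -> cptpos f ->
  (@lebesgue_measure R).-integrable Rpos (EFin \o f).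
Proof.
move=> cf sf; have [d [N [M [d0 dN fM]]]] := cptpos_bound cf sf.
have mR := @measurable_Rpos.
apply: (@integrable_le _ _ _ (fun x => M * \1_`[d, N] x)) => //.
- exact: continuous_Rpos_measurable.
- have : (@lebesgue_measure R).-integrable Rpos (EFin \o (\1_`[d, N] : R -> R)).
    by apply: (@integrableS _ _ _ _ setT) => //; exact: integrable_indic_itv.
  by move=> /(integrableZl mR M); apply: eq_integrable.
Qed.

Lemma Rintegral_Rpos_itv f (N : R) : 0 < N -> (forall x, N <= x -> f x = 0) ->
  (\int[@lebesgue_measure R]_(y in Rpos) f y)%R =
  (\int[@lebesgue_measure R]_(y in `]0%R, N[) f y)%R.
Proof.
move=> N0 fN; rewrite Rintegral_mkcond [RHS]Rintegral_mkcond; congr Rintegral.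
apply/funext => y; rewrite !patchE.
case: ifPn => [|/negP] /=; rewrite inE /=.
  move=> y0; case: ifPn => // /negP; rewrite inE /= in_itv /= y0 /=.
  by move/negP; rewrite -leNgt; exact: fN.
move=> y0; case: ifPn => //; rewrite inE /= in_itv /= => /andP[] //.
Qed.

(** The form in which integration by parts is used: [G] will be a Wronskian or a product such as
    eta^2 u u', and compact support leaves no boundary term. *)
Lemma Rintegral_derive_eq0 (G g : R -> R) :
  (forall y : R, 0 < y -> is_derive y 1 G (g y)) -> cpos g -> cptpos G ->
  (\int[@lebesgue_measure R]_(y in Rpos) g y)%R = 0.
Proof.
move=> dG cg [d [N [d0 dN sG]]].
have N0 := lt_trans d0 dN.
have sg x : N + 1 <= x -> g x = 0.
  move=> Nx.
  have Nx' : [set x : R | N < x] x by apply: lt_le_trans Nx; rewrite ltrDl.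
  apply: (is_derive_eq0_on (@open_gt _ N) Nx').
    by move=> y Ny; apply: sG; [exact: lt_trans Ny|right].
  by apply: dG; exact: lt_trans Nx'.
have N10 : 0 < N + 1 by exact: addr_gt0.
rewrite (@Rintegral_Rpos_itv _ (N + 1)) //.
rewrite (@FTC_Rpos G g d (N + 1)) //.
  by apply: sG => //; right; rewrite ltrDl.
by move=> y /andP[y0 yd]; apply: sG => //; left.
Qed.

Lemma sposD f g : smooth_on Rpos f -> smooth_on Rpos g -> smooth_on Rpos (fun x => f x + g x).
Proof. exact: (smooth_onD open_Rpos). Qed.

Lemma sposM f g : smooth_on Rpos f -> smooth_on Rpos g -> smooth_on Rpos (fun x => f x * g x).
Proof. exact: (smooth_onM open_Rpos). Qed.

Lemma sposN f : smooth_on Rpos f -> smooth_on Rpos (fun x => - f x).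
Proof. exact: (smooth_onN open_Rpos). Qed.

Lemma sposB f g : smooth_on Rpos f -> smooth_on Rpos g -> smooth_on Rpos (fun x => f x - g x).
Proof. exact: (smooth_onB open_Rpos). Qed.

Lemma spos_cst (r : R) : smooth_on Rpos (fun=> r).
Proof. exact: (@smooth_on_cst Rpos r open_Rpos). Qed.

Lemma sposZ (r : R) f : smooth_on Rpos f -> smooth_on Rpos (fun x => r * f x).
Proof. exact: (@smooth_onZ Rpos r f open_Rpos). Qed.

(** Test functions with no condition off [Rpos]: [rtest] demands smoothness on the whole line, which
    real powers lack. [testpos_rtest] restores it by cutting to zero. *)
Definition testpos f : Prop := smooth_on Rpos f /\ cptpos f.

Lemma rtest_testpos u : rtest Rpos u -> testpos u.
Proof.
move=> [su [K [cK [KR Ku]]]]; split.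
  by apply: smooth_onS (subsetT _) _; exact/smooth_onT.
have clK : closed K by apply: compact_closed => //; exact: Rhausdorff.
have oK : open (~` K) by exact: closed_openC.
have K0 : (~` K) 0 by move=> /KR; rewrite /Rpos /= ltxx.
have /nbhs_ballP [d /= d0 Hd] := open_nbhs_nbhs (conj oK K0).
have [M [_ HM]] := compact_bounded cK.
exists d, (Num.max (`|M| + 1) d + 1); split=> //.
  have : d <= Num.max (`|M| + 1) d by rewrite le_max lexx orbT.
  by move=> h; rewrite (le_lt_trans h) // ltrDl.
move=> x x0 [xd|Nx]; apply: Ku => Kx.
  by apply: (Hd x) => //; rewrite /ball /= sub0r normrN gtr0_norm.
have /= := HM (Num.max (`|M| + 1) d).
have h : M < Num.max (`|M| + 1) d.
  by rewrite lt_max (le_lt_trans (ler_norm M)) // ltrDl.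
move=> /(_ h x Kx); rewrite gtr0_norm // => h2.
have := le_lt_trans h2 (lt_trans (_ : _ < Num.max (`|M| + 1) d + 1) Nx).
by rewrite ltrDl ltr01 ltxx => /(_ isT).
Qed.

(** Smoothness is local: the cut function agrees with [f] on [Rpos] and with 0 on ]-oo, d[, and
    these two open sets cover the line. *)
Lemma testpos_rtest f : testpos f -> rtest Rpos (f \_ Rpos).
Proof.
move=> [sf [d [N [d0 dN suf]]]].
have oU : open [set x : R | x < d] by exact: open_lt.
have e0 x : [set x : R | x < d] x -> (f \_ Rpos) x = 0.
  move=> /= xd; rewrite patchE; case: ifPn => //; rewrite inE => x0.
  by apply: suf => //; left.
split.
  apply/smooth_onT; have -> : setT = (@Rpos R) `|` [set x : R | x < d].
    apply/seteqP; split=> // x _ /=; have [x0|x0] := ltP 0 x; [by left|right].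
    exact: le_lt_trans d0.
  apply: smooth_onU.
    by apply: smooth_on_eq open_Rpos _ sf => x x0; rewrite patchE mem_set.
  apply: (smooth_on_eq oU _ (@smooth_on_cst _ 0 oU)) => x xd.
  by rewrite e0.
exists `[d, N]%classic; split; first exact: segment_compact.
split; first by move=> x /=; rewrite in_itv /= => /andP[dx _]; exact: lt_le_trans dx.
move=> x; rewrite /= in_itv /= => /negP; rewrite negb_and -!ltNge => xdN.
rewrite patchE; case: ifPn => //; rewrite inE => x0.
by apply: suf => //; exact/orP.
Qed.

Lemma testpos_eq f g : (forall x : R, 0 < x -> f x = g x) -> testpos f -> testpos g.
Proof.
move=> fg [sf cf]; split; first exact: smooth_on_eq open_Rpos fg sf.
by apply: cptpos_imp cf _ => x x0; rewrite fg.
Qed.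

Lemma testpos_derive1 f : testpos f -> testpos (derive1 f).
Proof. by move=> [sf cf]; split; [exact: smooth_on_derive1|exact: cptpos_derive1]. Qed.

Lemma testposMl f g : testpos f -> smooth_on Rpos g -> testpos (fun x => f x * g x).
Proof.
by move=> [sf cf] sg; split; [apply: smooth_onM => //; exact: open_Rpos|exact: cptposMl].
Qed.

Lemma testposMr f g : testpos f -> smooth_on Rpos g -> testpos (fun x => g x * f x).
Proof.
by move=> [sf cf] sg; split; [apply: smooth_onM => //; exact: open_Rpos|exact: cptposMr].
Qed.

Lemma testposD f g : testpos f -> testpos g -> testpos (fun x => f x + g x).
Proof.
by move=> [sf cf] [sg cg]; split; [apply: smooth_onD => //; exact: open_Rpos|exact: cptposD].
Qed.

Lemma testposZ c f : testpos f -> testpos (fun x => c * f x).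
Proof. by move=> tf; apply: testposMr => //; apply: smooth_on_cst; exact: open_Rpos. Qed.

Lemma testposN f : testpos f -> testpos (fun x => - f x).
Proof.
by move=> /(@testposZ (-1)); apply: testpos_eq => x _; rewrite mulN1r.
Qed.

Lemma testposB f g : testpos f -> testpos g -> testpos (fun x => f x - g x).
Proof. by move=> tf tg; apply: testposD => //; exact: testposN. Qed.

Lemma testpos_cpos f : testpos f -> cpos f.
Proof. by case=> sf _; exact: cpos_smooth. Qed.

Lemma testpos_sqint f : testpos f -> sqint Rpos f.
Proof. by move=> tf; apply: cptpos_sqint; [exact: testpos_cpos|case: tf]. Qed.

Lemma testpos_is_derive f (x : R) : testpos f -> 0 < x -> is_derive x 1 f (derive1 f x).
Proof. by case=> sf _ x0; exact: smooth_on_is_derive sf x0. Qed.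

End Smooth.

Arguments smooth_on_powR {R} s.
Arguments spos_cst {R} r.
Arguments sposZ {R} r [f].
Arguments cpos_powR {R} s.
Arguments cpos_cst {R} c.
Arguments testposZ {R} c [f].

(** * Variation of parameters *)

Section PowerIntegrals.
Context {R : realType}.
Local Notation mu := (@lebesgue_measure R).

Lemma powRM_pos (x r s : R) : 0 < x -> x `^ r * x `^ s = x `^ (r + s).
Proof. by move=> x0; rewrite powRD // (gt_eqF x0) implybT. Qed.

Lemma is_derive_powR_pos (x s : R) : 0 < x ->
  is_derive x 1 (fun y : R => y `^ s) (s * x `^ s / x).
Proof.
move=> x0; have h := is_derive1_powR s x0.
rewrite -mulrA; have -> : x `^ s / x = x `^ (s - 1); last exact: h.
by rewrite -powR_inv1 ?ltW // powRM_pos.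
Qed.

(** For s < 0 the integrand is unbounded at 0. The intervals [e n, x[ exhaust ]0, x[, monotone
    convergence applies, and -1 < s makes (e n)^(s+1) tend to 0. *)
Lemma integral_powR (s x : R) : -1 < s -> 0 < x ->
  (\int[mu]_(t in `]0%R, x[) (t `^ s)%:E)%E = (x `^ (s + 1) / (s + 1))%:E.
Proof.
move=> s1 x0; have s10 : 0 < s + 1 by rewrite -ltrBlDr sub0r.
(* [n.+2] rather than [n.+1] keeps [e 0] strictly below [x]. *)
pose e n : R := x * (n.+2%:R)^-1.
have e0 n : 0 < e n by rewrite mulr_gt0 // invr_gt0.
have ex n : e n < x.
  by rewrite gtr_pMr // invf_lt1 // ltr1n.
pose F n : set (measurableTypeR R) := `[e n, x[%classic.
have UF : \bigcup_n F n = `]0%R, x[%classic.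
  apply/seteqP; split => [t [n _] /=|t /=]; rewrite /F /= !in_itv /=.
    by move=> /andP[et ->]; rewrite (lt_le_trans (e0 n)).
  move=> /andP[t0 tx].
  have [n Hn] := ltr_add_invr (divr_gt0 t0 x0).
  exists n => //=; rewrite in_itv /= tx andbT /e.
  rewrite mulrC -ler_pdivlMr //; apply: le_trans (ltW Hn).
  by rewrite add0r lef_pV2 ?posrE // ler_nat.
have dG (t : R) : 0 < t -> is_derive t 1 (fun t : R => t `^ (s + 1) / (s + 1)) (t `^ s).
  move=> t0; have h := is_derive1_powR (s + 1) t0.
  have -> : (fun t : R => t `^ (s + 1) / (s + 1)) = (s + 1)^-1 \*: (fun y : R => y `^ (s + 1)).
    by apply/funext => y; rewrite /= -[_ *: _]/(_ * _) mulrC.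
  apply: is_derive_eq; rewrite -[_ *: _]/(_ * _) addrK mulrA mulVf ?mul1r //.
  by rewrite gt_eqF.
have IF n : (\int[mu]_(t in F n) (t `^ s)%:E)%E =
    (x `^ (s + 1) / (s + 1) - (e n) `^ (s + 1) / (s + 1))%:E.
  rewrite /F integral_itv_bndo_bndc; last first.
    apply/measurable_EFinP; apply: measurable_funS (continuous_Rpos_measurable (cpos_powR s)).
    - exact: measurable_Rpos.
    - by move=> t /=; rewrite in_itv /= => /andP[et _]; exact: lt_le_trans et.
  rewrite (@continuous_FTC2 _ _ (fun t : R => t `^ (s + 1) / (s + 1)) _ _ (ex n)) //.
  - by apply: continuous_within_Rpos => //; exact: cpos_powR.
  - apply: (@derivable_oo_continuousW _ _ (e n / 2) (x + 1)) => //.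
    + by apply: subset_itv; rewrite bnd_simp; [rewrite ler_pdivrMr // ler_pMr // ler1n|rewrite lerDl].
    + split.
      * by move=> y; rewrite in_itv /= => /andP[ey _]; have [] := dG y (lt_trans (divr_gt0 (e0 n) (ltr0Sn _ _)) ey).
      * apply: cvg_at_right_filter; apply: (is_derive_continuous (dG _ _)); exact: divr_gt0.
      * apply: cvg_at_left_filter; apply: (is_derive_continuous (dG _ _)); exact: addr_gt0.
  - move=> y; rewrite in_itv /= => /andP[ey _]; rewrite derive1E.
    by have [_ ->] := dG y (lt_trans (e0 n) ey).
have c1 : (\int[mu]_(t in F n) (t `^ s)%:E)%E @[n --> \oo] -->
    (\int[mu]_(t in `]0%R, x[) (t `^ s)%:E)%E.
  rewrite -UF; apply: ge0_nondecreasing_set_cvg_integral.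
  - move=> n m nm; rewrite subsetEset; apply: subset_itvr; rewrite bnd_simp /e.
    by rewrite ler_pM2l // lef_pV2 ?posrE // ler_nat.
  - by move=> n; exact: measurable_itv.
  - move=> n; apply/measurable_EFinP; apply: measurable_funS (continuous_Rpos_measurable (cpos_powR s)).
    - exact: measurable_Rpos.
    - by move=> t; rewrite /F /= in_itv /= => /andP[et _]; exact: lt_le_trans et.
  - by move=> n t _; rewrite lee_fin powR_ge0.
have ecvg : (e n) `^ (s + 1) @[n --> \oo] --> (0 : R).
  have [+ _] := cvg_at_rightP (fun y : R => y `^ (s + 1)) 0 0.
  apply; first exact: powR_cvg0.
  split=> //; rewrite -(mulr0 x); apply: cvgMr.
  by have := @cvg_harmonic R; rewrite -(@cvg_shiftS _ (@harmonic R)).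
have c2 : (\int[mu]_(t in F n) (t `^ s)%:E)%E @[n --> \oo] --> (x `^ (s + 1) / (s + 1))%:E.
  under eq_fun do rewrite IF.
  apply: cvg_EFin; first by near=> n.
  rewrite [X in _ --> X](_ : _ = x `^ (s + 1) / (s + 1) - 0 / (s + 1)); last by rewrite mul0r subr0.
  apply: cvgB; first exact: cvg_cst.
  exact: cvgMl.
exact: (cvg_unique _ c1 c2).
Unshelve. all: by end_near. Qed.


Lemma sqint_powR (s x : R) : -1 < 2 * s -> 0 < x -> sqint `]0, x[ (fun t : R => t `^ s).
Proof.
move=> s1 x0; split.
  apply: measurable_funS (continuous_Rpos_measurable (cpos_powR s)).
    exact: measurable_Rpos.
  by move=> t /=; rewrite in_itv /= => /andP[].
rewrite (_ : (\int[mu]_(t in _) _)%E = (\int[mu]_(t in `]0%R, x[) (t `^ (2 * s))%:E)%E).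
  by rewrite integral_powR // ltry.
apply: eq_integral => t; rewrite inE /= in_itv /= => /andP[t0 _].
by rewrite expr2 powRM_pos // mulr2n mulrDl mul1r.
Qed.

Lemma nsq_powR (s x : R) : -1 < 2 * s -> 0 < x ->
  nsq `]0, x[ (fun t : R => t `^ s) = x `^ (2 * s + 1) / (2 * s + 1).
Proof.
move=> s1 x0; apply: EFin_inj; rewrite -nsqE //; last exact: sqint_powR.
rewrite -integral_powR //; apply: eq_integral => t; rewrite inE /= in_itv /= => /andP[t0 _].
by rewrite expr2 powRM_pos // mulr2n mulrDl mul1r.
Qed.

Lemma subset_itv_Rpos (x : R) : `]0, x[%classic `<=` @Rpos R.
Proof. by move=> t /=; rewrite in_itv /= => /andP[]. Qed.

Lemma integrable_near0 (w : R -> R) (d u : R) : 0 < d -> cpos w ->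
  (forall y : R, 0 < y < d -> w y = 0) -> 0 < u ->
  mu.-integrable [set` `]0, u]] (EFin \o w).
Proof.
move=> d0 cw w0 u0.
have mI : measurable ([set` `]0, u]] : set (measurableTypeR R)) by exact: measurable_itv.
apply: measurable_bounded_integrable => //.
- by rewrite /= lebesgue_measure_itv /=; case: ifP; rewrite ?ltry.
- apply: measurable_funS (continuous_Rpos_measurable cw); first exact: measurable_Rpos.
  by move=> t /=; rewrite in_itv /= => /andP[].
- have [|M' HM'] := continuous_Rpos_bounded d0 (_ : d <= Num.max d u) cw.
    by rewrite le_max lexx.
  exists `|M'|; split; first exact: num_real.
  move=> m Mm x /=; rewrite in_itv /= => /andP[x0 xu].
  have [xd|dx] := ltP x d.
    by rewrite w0 ?x0 // normr0 (le_trans _ (ltW Mm)).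
  apply: le_trans (ltW (le_lt_trans (ler_norm _) Mm)); apply: HM'.
  by rewrite dx le_max xu orbT.
Qed.

Lemma is_derive_integral0 (w : R -> R) (d x : R) : 0 < d -> cpos w ->
  (forall y : R, 0 < y < d -> w y = 0) -> 0 < x ->
  is_derive x 1 (fun y => \int[mu]_(t in `]0%R, y[) w t) (w x).
Proof.
move=> d0 cw w0 x0.
have x1 : x < x + 1 by rewrite ltrDl.
have i1 := @integrable_near0 w d (x + 1) d0 cw w0 (addr_gt0 x0 ltr01).
have [dF F'] := continuous_FTC1 x1 i1 (x0 : (BRight 0 < BRight x)%O) (cw x x0).
have h : is_derive x 1 (fun y => \int[mu]_(t in [set` `]0, y]]) w t) (w x).
  by apply: DeriveDef; [exact: dF|rewrite -F' derive1E].
have oU : open [set y : R | 0 < y < x + 1].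
  have -> : [set y : R | 0 < y < x + 1] = [set y | 0 < y] `&` [set y | y < x + 1].
    by apply/seteqP; split => y /= => [/andP//|[-> ->]].
  by apply: openI; [exact: open_gt|exact: open_lt].
apply: (is_derive_eq_on oU _ _ h); last by rewrite /= x0 x1.
move=> y /= /andP[y0 yx1]; rewrite -Rintegral_itv_bndo_bndc //.
apply: integrableS i1 => //; apply: subset_itvl; rewrite bnd_simp; exact: ltW.
Qed.

End PowerIntegrals.

Section VariationOfParameters.
Context {R : realType} (alpha : R).
Hypothesis ha : 0 <= alpha < 1.
Local Notation mu := (@lebesgue_measure R).
Local Notation a := (- (alpha / 2)).
Local Notation b := (1 + alpha / 2).
Local Notation c := (alpha * (2 + alpha) / 4).

Let a0 : 0 <= alpha. Proof. by case/andP: ha. Qed.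
Let a1 : alpha < 1. Proof. by case/andP: ha. Qed.

Definition bessel_op (f : R -> R) (x : R) : R := - derive1 (derive1 f) x + c / x ^+ 2 * f x.
Local Notation S0 := bessel_op.

#[local] Opaque Rintegral derive1 smooth_on.

(* Variation of parameters for [S0 y = f], based on the solutions
   [x^(-alpha/2)], [x^(1+alpha/2)] of the homogeneous equation, whose Wronskian
   is [1 + alpha]. *)
Definition varpar (f : R -> R) (x : R) : R :=
  (x `^ a * \int[mu]_(t in `]0%R, x[) (t `^ b * f t) -
   x `^ b * \int[mu]_(t in `]0%R, x[) (t `^ a * f t)) / (1 + alpha).

Lemma powab (x : R) : 0 < x -> x `^ a * x `^ b = x.
Proof.
move=> x0; rewrite powRM_pos // (_ : a + b = 1); last by ring.
by rewrite powRr1 // ltW.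
Qed.

(** Here alpha < 1 enters: 2 a = -alpha > -1. *)
Lemma sqint_a (x : R) : 0 < x -> sqint `]0, x[ (fun t : R => t `^ a).
Proof. by move=> x0; apply: sqint_powR => //; move: a1; lra. Qed.

Lemma sqint_b (x : R) : 0 < x -> sqint `]0, x[ (fun t : R => t `^ b).
Proof. by move=> x0; apply: sqint_powR => //; move: a0; lra. Qed.

Lemma varparB f g x : 0 < x -> sqint `]0, x[ f -> sqint `]0, x[ g ->
  varpar (fun t => f t - g t) x = varpar f x - varpar g x.
Proof.
move=> x0 fi gi.
have mI : measurable (`]0, x[%classic : set (measurableTypeR R)) by exact: measurable_itv.
rewrite /varpar.
have E s : sqint `]0, x[ (fun t : R => t `^ s) ->
    \int[mu]_(t in `]0%R, x[) (t `^ s * (f t - g t)) =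
    \int[mu]_(t in `]0%R, x[) (t `^ s * f t) - \int[mu]_(t in `]0%R, x[) (t `^ s * g t).
  move=> si; rewrite -RintegralB //; last 2 first.
  - exact: sqintM.
  - exact: sqintM.
  by congr Rintegral; apply/funext => t; rewrite mulrBr.
rewrite !E; [by ring|exact: sqint_a|exact: sqint_b].
Qed.

Lemma varpar_eq f g x : (forall t, 0 < t < x -> f t = g t) -> varpar f x = varpar g x.
Proof.
move=> fg; rewrite /varpar; congr ((_ * _ - _ * _) / _).
  by apply: eq_Rintegral => t; rewrite inE /= in_itv /= => /fg ->.
by apply: eq_Rintegral => t; rewrite inE /= in_itv /= => /fg ->.
Qed.

Lemma varpar_bound f x : 0 < x -> sqint `]0, x[ f ->
  (varpar f x) ^+ 2 <= 4 / (1 - alpha) * x ^+ 3 * nsq `]0, x[ f.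
Proof.
move=> x0 fi.
have mI : measurable (`]0, x[%classic : set (measurableTypeR R)) by exact: measurable_itv.
have ca := cauchy_schwarz_nsq mI (sqint_a x0) fi.
have cb := cauchy_schwarz_nsq mI (sqint_b x0) fi.
rewrite nsq_powR // in ca; last by move: a1; lra.
rewrite nsq_powR // in cb; last by move: a0; lra.
rewrite /varpar; set I := Rintegral _ _ _ in ca; set J := Rintegral _ _ _ in cb.
rewrite -/I -/J; set n := nsq _ _ in ca cb *.
have n0 : 0 <= n by exact: nsq_ge0.
have xge0 : 0 <= x by exact: ltW.
have x30 : 0 <= x ^+ 3 by rewrite exprn_ge0.
(* Since a + b = 1, both terms end with x^3: x^(2a) x^(2b+1) here, x^(2b) x^(2a+1) in [p2], where 2a
   + 1 = 1 - alpha gives the denominator of the bound. The constant 4 is 2 + 2, from (p - q)^2 <= 2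
   p^2 + 2 q^2. *)
have p1 : (x `^ a * J) ^+ 2 <= x ^+ 3 * n.
  rewrite exprMn; apply: le_trans (ler_wpM2l (sqr_ge0 _) cb) _.
  rewrite mulrA ler_wpM2r // expr2 powRM_pos // mulrA powRM_pos //.
  rewrite (_ : a + a + (2 * b + 1) = 3%:R); last by field.
  rewrite powR_mulrn // ler_pdivrMr; last by move: a0; lra.
  by rewrite ler_peMr //; move: a0; lra.
have p2 : (x `^ b * I) ^+ 2 <= x ^+ 3 / (1 - alpha) * n.
  rewrite exprMn; apply: le_trans (ler_wpM2l (sqr_ge0 _) ca) _.
  rewrite mulrA ler_wpM2r // expr2 powRM_pos // mulrA powRM_pos //.
  rewrite (_ : b + b + (2 * a + 1) = 3%:R); last by field.
  rewrite powR_mulrn // (_ : 2 * a + 1 = 1 - alpha) //; by field.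
have p3 : x ^+ 3 <= x ^+ 3 / (1 - alpha).
  rewrite ler_pdivlMr; last by move: a1; lra.
  by rewrite ler_piMr //; move: a0; lra.
rewrite exprMn; set p := _ * J in p1 *; set q := _ * I in p2 *.
have i1 : (1 + alpha)^-1 ^+ 2 <= 1.
  by rewrite expr_le1 // ?invr_ge0 ?invf_le1 //; move: a0; lra.
apply: le_trans (_ : (p - q) ^+ 2 * 1 <= _).
  by rewrite ler_wpM2l // sqr_ge0.
have p4 := ler_wpM2r n0 p3.
have -> : 4 / (1 - alpha) * x ^+ 3 * n = 4 * (x ^+ 3 / (1 - alpha) * n) by ring.
have := sqr_ge0 (p + q); nra.
Qed.

Lemma integrand_near0 (s : R) f d : (forall y : R, 0 < y < d -> f y = 0) ->
  forall y : R, 0 < y < d -> y `^ s * f y = 0.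
Proof. by move=> f0 y /f0 ->; rewrite mulr0. Qed.

(** The derivative of [varpar f]: the terms x^a x^b f and x^b x^a f coming from the two integrals
    cancel. *)
Definition varpar1 (f : R -> R) (x : R) : R :=
  (a * x `^ a / x * \int[mu]_(t in `]0%R, x[) (t `^ b * f t) -
   b * x `^ b / x * \int[mu]_(t in `]0%R, x[) (t `^ a * f t)) / (1 + alpha).

Section SmoothVarpar.
Context (f : R -> R) (d : R).
Hypotheses (d0 : 0 < d) (cf : cpos f) (f0 : forall y : R, 0 < y < d -> f y = 0).

Let dI (s x : R) : 0 < x -> is_derive x 1 (fun y => \int[mu]_(t in `]0%R, y[) (t `^ s * f t)) (x `^ s * f x).
Proof.
move=> x0; apply: (is_derive_integral0 d0 _ _ x0).
  by apply: cposM => //; exact: cpos_powR.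
exact: integrand_near0.
Qed.

Lemma is_derive_varpar (x : R) : 0 < x -> is_derive x 1 (varpar f) (varpar1 f x).
Proof.
move=> x0; rewrite /varpar.
have dIa := dI a x0; have dIb := dI b x0.
have da := is_derive_powR_pos a x0; have db := is_derive_powR_pos b x0.
apply: is_derive_eq.
rewrite -![_ *: _]/(_ * _) /varpar1 /=.
have := powab x0; set A := x `^ a; set B := x `^ b => AB.
have xn0 : x != 0 by rewrite gt_eqF.
by field; rewrite xn0 /= gt_eqF //; move: a0; lra.
Qed.

(** This time the two integrals contribute (a - b) x^(a+b-1) f / (1 + alpha) = -f; the remaining
    terms recombine because a (a - 1) = b (b - 1) = c. *)
Lemma is_derive_varpar1 (x : R) : 0 < x ->
  is_derive x 1 (varpar1 f) (c / x ^+ 2 * varpar f x - f x).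
Proof.
move=> x0; rewrite /varpar1.
have dIa := dI a x0; have dIb := dI b x0.
have da := is_derive_powR_pos a x0; have db := is_derive_powR_pos b x0.
have xn0 : x != 0 by rewrite gt_eqF.
have dV := @is_deriveV R id x 1 1 xn0 (is_derive_id _ _).
apply: is_derive_eq.
rewrite -![_ *: _]/(_ * _) /varpar /=.
have := powab x0; set A := x `^ a; set B := x `^ b => AB.
have An0 : A != 0 by rewrite gt_eqF // powR_gt0.
have -> : B = x / A by rewrite -AB mulrC mulKf.
move: (Rintegral _ _ _) (Rintegral _ _ _) => I J.
have al : 1 + alpha != 0 by rewrite gt_eqF //; move: a0; lra.
by field; rewrite xn0 An0 al.
Qed.

Lemma S0_varpar (x : R) : 0 < x -> S0 (varpar f) x = f x.
Proof.
move=> x0; rewrite /S0 (_ : derive1 (derive1 (varpar f)) x = c / x ^+ 2 * varpar f x - f x).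
  by move: (c / _ * _) => A; ring.
rewrite (@derive1_eq_on _ Rpos _ (varpar1 f) open_Rpos _ x x0).
  by rewrite derive1E; have [_ ->] := is_derive_varpar1 x0.
by move=> y y0; rewrite derive1E; have [_ ->] := is_derive_varpar y0.
Qed.

Lemma varpar_near0 x : 0 < x <= d -> varpar f x = 0.
Proof.
move=> /andP[x0 xd]; rewrite (@varpar_eq f (fun=> 0)).
  rewrite /varpar; under eq_Rintegral do rewrite mulr0.
  under [in X in _ - _ * X]eq_Rintegral do rewrite mulr0.
  by rewrite Rintegral_cst ?mul0r ?mulr0 ?subr0 ?mul0r //; exact: measurable_itv.
by move=> t /andP[t0 tx]; apply: f0; rewrite t0 (lt_le_trans tx).
Qed.

Lemma smooth_on_varpar : smooth_on Rpos f -> smooth_on Rpos (varpar f).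
Proof.
move=> sf; rewrite /varpar.
have sI s : smooth_on Rpos (fun x => \int[mu]_(t in `]0%R, x[) (t `^ s * f t)).
  apply: (@smooth_on_primitive _ _ (fun x => x `^ s * f x)).
  - exact: open_Rpos.
  - exact: (sposM (smooth_on_powR s) sf).
  - exact: dI.
exact: (sposM (sposB (sposM (smooth_on_powR a) (sI b)) (sposM (smooth_on_powR b) (sI a)))
              (spos_cst _)).
Qed.

(** Beyond the support of [f] both integrals are constant. The resulting combination of powers is
    what [ker_S0] subtracts to obtain compact support. *)
Lemma varpar_far x N : 0 < N <= x -> (forall y, N <= y -> f y = 0) ->
  varpar f x = (\int[mu]_(t in Rpos) (t `^ b * f t)) / (1 + alpha) * x `^ a
    - (\int[mu]_(t in Rpos) (t `^ a * f t)) / (1 + alpha) * x `^ b.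
Proof.
move=> /andP[N0 Nx] fN; have x0 := lt_le_trans N0 Nx.
have fx s y : x <= y -> y `^ s * f y = 0.
  by move=> xy; rewrite fN ?mulr0 // (le_trans Nx).
rewrite (@Rintegral_Rpos_itv _ _ x x0 (fx b)) (@Rintegral_Rpos_itv _ _ x x0 (fx a)).
by rewrite /varpar; ring.
Qed.

End SmoothVarpar.

Lemma continuous_S0 u : smooth_on Rpos u -> cpos (S0 u).
Proof.
move=> su; rewrite /S0; apply: cposD.
  apply: cposN; apply: cpos_smooth.
  by do 2 apply: smooth_on_derive1.
apply: cposM; last exact: cpos_smooth.
move=> x x0; apply: continuousM; first exact: cst_continuous.
apply: continuousV; first by rewrite expf_neq0 // gt_eqF.
exact: exprn_continuous.
Qed.

Lemma S0_eq0 u (U : set R) : open U -> (forall y, U y -> u y = 0) ->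
  forall y, U y -> S0 u y = 0.
Proof.
move=> oU u0 y Uy; rewrite /S0 u0 // mulr0 addr0.
have := derive1n_eq_on 2 oU (v := cst 0) u0 Uy; rewrite !derive1nS !derive1n0 => ->.
rewrite (_ : derive1 (cst 0) = cst 0) ?derive1_cst ?oppr0 //.
by apply/funext => z; rewrite derive1_cst.
Qed.

(** Green's formula on ]0, x[ against x^s with s (s - 1) = c turns each integral of [varpar] into
    the Wronskian of x^s and [u] at x, and the combination of the two returns [u x]. Stated for
    functions vanishing near 0, as [half_line] applies it to powers cut off near 0. *)
Lemma varpar_S0 u (d x : R) : smooth_on Rpos u -> 0 < d ->
  (forall y, 0 < y < d -> u y = 0) -> 0 < x -> varpar (S0 u) x = u x.
Proof.
move=> su d0 u0 x0; rewrite /varpar.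
have su1 := smooth_on_derive1 su.
have key s : s * (s - 1) = c -> \int[mu]_(t in `]0%R, x[) (t `^ s * S0 u t) =
    s * x `^ s / x * u x - x `^ s * (derive1 u x).
  move=> sc; pose G y := s * y `^ s / y * u y - y `^ s * (derive1 u y).
  rewrite -[RHS]/(G x); apply: (@FTC_Rpos _ G _ d) => //.
  - move=> y y0; rewrite /G.
    have ds := is_derive_powR_pos s y0.
    have du := smooth_on_is_derive su y0.
    have du1 := smooth_on_is_derive su1 y0.
    have yn0 : y != 0 by rewrite gt_eqF.
    have dV := @is_deriveV R id y 1 1 yn0 (is_derive_id _ _).
    apply: is_derive_eq.
    rewrite -![_ *: _]/(_ * _) /S0 -sc.
    move: (derive1 (derive1 u) y) (derive1 u y) (y `^ s) (u y) => u2 u1 ys uy.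
    by field.
  - by apply: cposM; [exact: cpos_powR|exact: continuous_S0].
  - move=> y yd; rewrite /G u0 // mulr0 sub0r.
    have oU : open [set y : R | 0 < y < d].
      have -> : [set y : R | 0 < y < d] = [set y | 0 < y] `&` [set y | y < d].
        by apply/seteqP; split => z /= => [/andP//|[-> ->]].
      by apply: openI; [exact: open_gt|exact: open_lt].
    have [y0 _] := andP yd.
    rewrite (is_derive_eq0_on oU (yd : [set y : R | 0 < y < d] y) u0 (smooth_on_is_derive su y0)).
    by rewrite mulr0 oppr0.
rewrite !key; [|by field|by field].
have := powab x0; set A := x `^ a; set B := x `^ b => AB.
have xn0 : x != 0 by rewrite gt_eqF.
have An0 : A != 0 by rewrite gt_eqF // powR_gt0.
have -> : B = x / A by rewrite -AB mulrC mulKf.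
have al : 1 + alpha != 0 by rewrite gt_eqF //; move: a0; lra.
by field; rewrite xn0 An0 al.
Qed.

(** Green's formula. Only [u] has compact support, because [y] will be [varpar v]. *)
Lemma S0_symmetric u y : testpos u -> smooth_on Rpos y ->
  \int[mu]_(t in Rpos) (S0 y t * u t) = \int[mu]_(t in Rpos) (y t * S0 u t).
Proof.
move=> tu sy; have [su cu] := tu.
have tS0 : cptpos (S0 u).
  have [d [N [d0 dN sup]]] := cu; exists d, N; split=> // x x0 H.
  have oU : open ([set x : R | 0 < x] `&` ([set x : R | x < d] `|` [set x : R | N < x])).
    by apply: openI; [exact: open_gt|apply: openU; [exact: open_lt|exact: open_gt]].
  by apply: (S0_eq0 oU) => // z [z0]; exact: sup.
have cyy := cpos_smooth sy; have cuu := cpos_smooth su.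
apply/eqP; rewrite -subr_eq0; apply/eqP; rewrite -RintegralB; last 3 first.
- exact: measurable_Rpos.
- apply: cptpos_integrable; last exact: cptposMr.
  by apply: cposM => //; exact: continuous_S0.
- apply: cptpos_integrable; last exact: cptposMr.
  by apply: cposM => //; exact: continuous_S0.
apply: (@Rintegral_derive_eq0 _ (fun t => y t * derive1 u t - derive1 y t * u t)).
- move=> t t0.
  have dy := smooth_on_is_derive sy t0; have du := smooth_on_is_derive su t0.
  have dy1 := smooth_on_is_derive (smooth_on_derive1 sy) t0.
  have du1 := smooth_on_is_derive (smooth_on_derive1 su) t0.
  apply: is_derive_eq; rewrite -![_ *: _]/(_ * _) /S0.
  move: (derive1 (derive1 u) t) (derive1 u t) (derive1 (derive1 y) t) (derive1 y t).
  by move: (u t) (y t) => *; ring.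
- by apply: cposB; apply: cposM => //; exact: continuous_S0.
- apply: cptposD; first by apply: cptposMr; exact: cptpos_derive1.
  by apply: cptpos_imp cu _ => t t0 ->; rewrite mulr0 oppr0.
Qed.

Lemma testpos_S0 u : testpos u -> testpos (S0 u).
Proof.
move=> [su cu]; split; last first.
  have [d [N [d0 dN sup]]] := cu; exists d, N; split=> // x x0 H.
  have oU : open ([set x : R | 0 < x] `&` ([set x : R | x < d] `|` [set x : R | N < x])).
    by apply: openI; [exact: open_gt|apply: openU; [exact: open_lt|exact: open_gt]].
  by apply: (S0_eq0 oU) => // z [z0]; exact: sup.
(* The coefficient c / x^2 is rewritten with the real power x^(-2), whose smoothness on [Rpos] is
   known. *)
apply: (@smooth_on_eq _ _ (fun x => - derive1 (derive1 u) x + c * x `^ (- 2%:R) * u x)).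
- exact: open_Rpos.
- by move=> x x0; rewrite /S0 powR_invn // ltW.
- exact: (sposD (sposN (smooth_on_derive1 (smooth_on_derive1 su)))
                (sposM (sposZ _ (smooth_on_powR _)) su)).
Qed.

Lemma S0B u v x : smooth_on Rpos u -> smooth_on Rpos v -> 0 < x ->
  S0 (fun t => u t - v t) x = S0 u x - S0 v x.
Proof.
move=> su sv x0; rewrite /S0.
suff -> : derive1 (derive1 (fun t => u t - v t)) x = derive1 (derive1 u) x - derive1 (derive1 v) x.
  by move: (derive1 (derive1 u) x) (derive1 (derive1 v) x) => *; ring.
have E1 (f g : R -> R) y : smooth_on Rpos f -> smooth_on Rpos g -> 0 < y ->
    derive1 (fun t => f t - g t) y = derive1 f y - derive1 g y.
  move=> sf sg y0; have df := smooth_on_is_derive sf y0.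
  have dg := smooth_on_is_derive sg y0.
  by rewrite derive1E; have [_ ->] := is_deriveB df dg.
rewrite (@derive1_eq_on _ Rpos _ (fun t => derive1 u t - derive1 v t) open_Rpos _ x x0).
  exact: (E1 _ _ _ (smooth_on_derive1 su) (smooth_on_derive1 sv) x0).
by move=> y y0; exact: (E1 _ _ _ su sv y0).
Qed.

Lemma S0_eq u v x : (forall y : R, 0 < y -> u y = v y) -> 0 < x -> S0 u x = S0 v x.
Proof.
move=> uv x0; have := derive1n_eq_on 2 open_Rpos uv x0.
by rewrite /S0 (uv _ x0) !derive1nS !derive1n0 => ->.
Qed.

End VariationOfParameters.

(** * Density of test functions *)

Section Density.
Import HBNNSimple.
Context {R : realType}.
Local Notation mu := (@lebesgue_measure R).

Lemma nsq_dominated (D : set (measurableTypeR R)) (f_ : nat -> R -> R) (f g : R -> R) :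
  measurable D -> (forall n, measurable_fun D (f_ n)) -> measurable_fun D f ->
  (forall x, D x -> f_ n x @[n --> \oo] --> f x) ->
  (forall n x, D x -> `|f_ n x| <= g x) -> sqint D g ->
  nsq D (fun x => f_ n x - f x) @[n --> \oo] --> (0 : R).
Proof.
move=> mD mf_ mf cvf fg ig.
have fgl x : D x -> `|f x| <= g x.
  move=> Dx; have h : `|f_ n x| @[n --> \oo] --> `|f x| by exact: cvg_norm (cvf _ Dx).
  apply: (@ler_cvg_to _ _ _ _ (fun n => `|f_ n x|) (fun=> g x) _ _ h (cvg_cst _)).
  by near=> n; exact: fg.
pose F n x := ((f_ n x - f x) ^+ 2)%:E.
have mF n : measurable_fun D (F n).
  by apply/measurable_EFinP; apply: measurable_funX; exact: measurable_funB.
have cF : {ae mu, forall x, D x -> F n x @[n --> \oo] --> 0%E}.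
  apply: aeW => x Dx; apply: cvg_EFin; first by near=> n.
  have -> : (0 : R) = (f x - f x) * (f x - f x) by rewrite subrr mul0r.
  have h : f_ n x - f x @[n --> \oo] --> f x - f x by apply: cvgB; [exact: cvf|exact: cvg_cst].
  exact: (cvgM h h).
have iG : mu.-integrable D (fun x => (4 * g x ^+ 2)%:E).
  have := integrableZl mD 4 (sqint_integrable mD ig).
  by apply: eq_integrable.
have FG : {ae mu, forall x n, D x -> (`|F n x| <= (4 * g x ^+ 2)%:E)%E}.
  apply: aeW => x n Dx /=; rewrite lee_fin ger0_norm ?sqr_ge0 //.
  have h1 := fg n _ Dx; have h2 := fgl _ Dx.
  have h3 : `|f_ n x - f x| <= 2 * g x.
    by apply: le_trans (ler_normB _ _) _; rewrite mulr2n mulrDl mul1r lerD.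
  rewrite -[leLHS]real_normK ?num_real // (_ : 4 * _ = (2 * g x) ^+ 2); last by ring.
  by rewrite lerXn2r // nnegrE // (le_trans _ h3).
have [_ _] := dominated_convergence mD mF (measurable_cst 0%E) cF iG FG.
rewrite integral0 => H; exact: (fine_cvg H).
Unshelve. all: by end_near. Qed.

Definition approximable (f : R -> R) : Prop := forall e : R, 0 < e ->
  exists v, testpos v /\ nsq Rpos (fun x => f x - v x) < e.

Let mR := @measurable_Rpos R.

Lemma approximable_close f : sqint Rpos f ->
  (forall e : R, 0 < e -> exists g, [/\ sqint Rpos g, approximable g &
     nsq Rpos (fun x => f x - g x) < e]) -> approximable f.
Proof.
move=> fi H e e0; have e4 : 0 < e / 4 by rewrite divr_gt0.
have [g [gi ga fg]] := H _ e4; have [v [tv gv]] := ga _ e4.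
exists v; split=> //; have vi := testpos_sqint tv.
rewrite (eq_nsq (g := fun x => (f x - g x) + (g x - v x))); last first.
  by move=> x _; rewrite addrA subrK.
apply: le_lt_trans (nsqD mR (sqintB mR fi gi) (sqintB mR gi vi)) _.
by lra.
Qed.

Lemma approximableD f g : sqint Rpos f -> sqint Rpos g ->
  approximable f -> approximable g -> approximable (fun x => f x + g x).
Proof.
move=> fi gi fa ga e e0; have e4 : 0 < e / 4 by rewrite divr_gt0.
have [u [tu fu]] := fa _ e4; have [v [tv gv]] := ga _ e4.
exists (fun x => u x + v x); split; first exact: testposD.
have ui := testpos_sqint tu; have vi := testpos_sqint tv.
rewrite (eq_nsq (g := fun x => (f x - u x) + (g x - v x))); last by move=> x _; ring.
apply: le_lt_trans (nsqD mR (sqintB mR fi ui) (sqintB mR gi vi)) _.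
by lra.
Qed.

Lemma approximableZ (r : R) f : sqint Rpos f -> approximable f ->
  approximable (fun x => r * f x).
Proof.
move=> fi fa e e0; have r0 : 0 < r ^+ 2 + 1 by rewrite ltr_wpDl // sqr_ge0.
have [u [tu fu]] := fa _ (divr_gt0 e0 r0); have ui := testpos_sqint tu.
exists (fun x => r * u x); split; first exact: testposZ.
rewrite (eq_nsq (g := fun x => r * (f x - u x))); last by move=> x _; ring.
rewrite nsqZ //; last exact: sqintB.
rewrite ltr_pdivlMr // in fu; apply: le_lt_trans fu.
by rewrite mulrC ler_wpM2l ?nsq_ge0 // lerDl.
Qed.

Lemma approximable_cvg (f_ : nat -> R -> R) f : sqint Rpos f ->
  (forall n, sqint Rpos (f_ n)) -> (forall n, approximable (f_ n)) ->
  nsq Rpos (fun x => f_ n x - f x) @[n --> \oo] --> (0 : R) -> approximable f.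
Proof.
move=> fi f_i f_a cv; apply: approximable_close => // e e0.
have /cvgrPdist_lt /(_ e e0) [n _ Hn] := cv.
exists (f_ n); split=> //; have := Hn n (leqnn n).
rewrite sub0r normrN ger0_norm ?nsq_ge0 // -(nsqN _ (fun x => f x - f_ n x)).
by rewrite (eq_nsq (g := fun x => f_ n x - f x)) // => x _; rewrite opprB.
Qed.

Lemma itvooI (x y x' y' : R) : `]x, y[%classic `&` `]x', y'[%classic =
  `](Num.max x x'), (Num.min y y')[%classic.
Proof.
apply/seteqP; split=> z /=; rewrite !in_itv /= gt_max lt_min.
  by move=> [/andP[-> ->] /andP[-> ->]].
by move=> /andP[/andP[-> ->] /andP[-> ->]].
Qed.

Lemma approximable_sum (I : Type) (s : seq I) (F : I -> R -> R) :
  (forall i, sqint Rpos (F i)) -> (forall i, approximable (F i)) ->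
  sqint Rpos (fun x => \sum_(i <- s) F i x) /\ approximable (fun x => \sum_(i <- s) F i x).
Proof.
move=> Fi Fa; have i0 : sqint Rpos (fun=> 0 : R).
  apply: (@cptpos_sqint R (fun=> 0)); first exact: cpos_cst.
  by exists 1, 2; split => //; rewrite ltr1n.
elim: s => [|i s [IH1 IH2]].
  under eq_fun do rewrite big_nil.
  split=> // e e0; exists (fun=> 0); split.
    split; first exact: spos_cst.
    by exists 1, 2; split => //; rewrite ltr1n.
  rewrite (eq_nsq (g := fun=> 0)); last by move=> x _; rewrite subr0.
  by rewrite /nsq; under eq_Rintegral do rewrite expr0n; rewrite Rintegral_cst ?mul0r.
under eq_fun do rewrite big_cons.
by split; [exact: sqintD|exact: approximableD].
Qed.

(** * Smooth steps, mollified indicators and cut-offs *)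

Section SmoothStep.
Context (P : R -> R).
Hypotheses (sP : smooth P) (P1 : forall x : R, `|x| < 1 -> P x = 1)
  (P0 : forall x : R, 2 < `|x| -> P x = 0).

(** The shift by 3 moves the support of [P] into [1, 5], inside [Rpos]; the square makes the bump
    nonnegative, so that its integral [Z] is positive even if [P] changes sign. *)
Let q (x : R) : R := P (1 * x + (-3)) ^+ 2.

Let q0 (x : R) : x < 1 \/ 5 < x -> q x = 0.
Proof.
move=> H; rewrite /q P0 ?expr0n // mul1r ltr_normr.
by case: H => h; apply/orP; [right|left]; lra.
Qed.

Let q1 (x : R) : 2 < x < 4 -> q x = 1.
Proof. by move=> H; rewrite /q P1 ?expr1n // mul1r ltr_norml; lra. Qed.

Let sq : smooth_on setT q.
Proof.
have oT : open [set: R] by exact: openT.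
have h : smooth_on setT (fun x => P (1 * x + (-3))).
  apply: (@smooth_on_affine _ _ setT) => //; exact/smooth_onT.
rewrite /q; under eq_fun do rewrite expr2.
exact: smooth_onM.
Qed.

Let tq : testpos q.
Proof.
split; first exact: smooth_onS sq.
by exists 1, 5; split; [| |move=> x _; exact: q0]; lra.
Qed.

Let Z : R := \int[mu]_(t in Rpos) q t.

Let Z0 : 0 < Z.
Proof.
apply: (@lt_le_trans _ _ (\int[mu]_(t in Rpos) \1_(`]2, 4[%classic) t)).
  rewrite /Rintegral integral_indic //.
  rewrite (_ : _ `&` _ = `]2, 4[%classic).
    by rewrite /= lebesgue_measure_itv /= ifT /= ?lte_fin; lra.
  by apply/seteqP; split => [x []//|x /=]; rewrite in_itv /= => /[dup] /andP[? ?]; split => //; rewrite /Rpos /=; lra.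
apply: le_Rintegral => //.
- apply: (@integrableS _ _ _ _ setT) => //; exact: integrable_indic_itv.
- by apply: cptpos_integrable; [exact: testpos_cpos tq|case: tq].
- move=> x _; rewrite indicE; have [|_] := boolP (x \in _); last by rewrite sqr_ge0.
  by rewrite inE /= in_itv /= => /q1 ->.
Qed.

Definition smooth_step (x : R) : R := (\int[mu]_(t in `]0%R, x[) q t) / Z.

Lemma smooth_step0 x : x <= 1 -> smooth_step x = 0.
Proof.
move=> x1; rewrite /smooth_step (@eq_Rintegral _ _ _ _ _ (fun=> 0)).
  by rewrite Rintegral_cst ?mul0r //; exact: measurable_itv.
by move=> t; rewrite inE /= in_itv /= => /andP[_ tx]; apply: q0; left; lra.
Qed.

Lemma smooth_step1 x : 5 < x -> smooth_step x = 1.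
Proof.
move=> x5; rewrite /smooth_step -(@Rintegral_Rpos_itv _ q x); last 2 first.
- by lra.
- by move=> y xy; apply: q0; right; lra.
by rewrite divff // gt_eqF.
Qed.

Lemma smooth_step_smooth : smooth_on setT smooth_step.
Proof.
have sp : smooth_on Rpos smooth_step.
  apply: (@smooth_on_primitive _ _ (fun x => q x * Z^-1)).
  - exact: open_Rpos.
  - exact: (sposM (proj1 tq) (spos_cst _)).
  - move=> x x0; rewrite /smooth_step.
    have h : is_derive x 1 (fun y => \int[mu]_(t in `]0%R, y[) q t) (q x).
      apply: (is_derive_integral0 ltr01 (testpos_cpos tq)) => //.
      by move=> y /andP[_ y1]; apply: q0; left.
    by apply: is_derive_eq; rewrite -![_ *: _]/(_ * _); ring.
have oU := @open_lt R 1.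
have -> : setT = (@Rpos R) `|` [set x : R | x < 1].
  apply/seteqP; split=> // x _ /=; have [x0|x0] := ltP 0 x; [by left|right].
  exact: le_lt_trans ltr01.
apply: (smooth_onU sp); apply: (smooth_on_eq oU _ (@smooth_on_cst _ _ 0 oU)).
by move=> x x1; rewrite smooth_step0 // ltW.
Qed.

Lemma smooth_step_bounded : exists M, forall x, `|smooth_step x| <= M.
Proof.
have cs : cpos smooth_step.
  by apply: cpos_smooth; exact: smooth_onS smooth_step_smooth.
have [|M HM] := continuous_Rpos_bounded ltr01 (_ : 1 <= 6) cs.
  by lra.
exists (`|M| + 1) => x; have [x1|x1] := leP x 1.
  by rewrite smooth_step0 // normr0 addr_ge0.
have [x6|x6] := leP x 6.
  by apply: le_trans (HM x _) _; [lra|rewrite (le_trans (ler_norm _)) // lerDl].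
by rewrite smooth_step1 ?normr1 ?lerDr //; lra.
Qed.

Lemma approximable_itv (p r : R) : 0 < p -> approximable (\1_(`]p, r[%classic)).
Proof.
move=> p0; have [pr|rp] := ltP p r; last first.
  rewrite set_itv_ge ?bnd_simp -?leNgt // indic0 => e e0; exists (fun=> 0); split.
    split; first exact: spos_cst.
    by exists 1, 2; split => //; rewrite ltr1n.
  rewrite (eq_nsq (g := fun=> 0)); last by move=> x _; rewrite subr0.
  by rewrite /nsq; under eq_Rintegral do rewrite expr0n; rewrite Rintegral_cst ?mul0r.
have [M HM] := smooth_step_bounded.
have M0 : 0 <= M by apply: le_trans (HM 0); exact: normr_ge0.
(* A step up at p times a step down at r, both steepened by n: zero outside ]p, r[ for every n, and
   equal to 1 at x as soon as n min(x - p, r - x) > 5. *)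
pose v (n : nat) x := smooth_step (n%:R * x + (- n%:R * p)) * smooth_step ((- n%:R) * x + n%:R * r).
have v0 n x : x <= p \/ r <= x -> v n x = 0.
  have n0 : 0 <= n%:R :> R by exact: ler0n.
  case=> h; rewrite /v.
    by rewrite smooth_step0 ?mul0r //; nra.
  by rewrite (@smooth_step0 (_ + n%:R * r)) ?mulr0 //; nra.
have sv n : smooth_on setT (v n).
  have oT : open [set: R] by exact: openT.
  apply: (smooth_onM oT).
    by apply: (@smooth_on_affine _ _ setT) => //; exact: smooth_step_smooth.
  by apply: (@smooth_on_affine _ _ setT) => //; exact: smooth_step_smooth.
have tv n : testpos (v n).
  split; first exact: smooth_onS (sv n).
  exists p, r; split => // x _ H; apply: v0.
  by case: H => h; [left|right]; exact: ltW.
have indi : sqint Rpos (fun x => M ^+ 2 * \1_(`]p, r[%classic) x).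
  apply: sqintZ => //; apply: integrable_sqint => //.
  have : mu.-integrable Rpos (EFin \o (\1_(`]p, r[%classic) : R -> R)).
    by apply: (@integrableS _ _ _ _ setT) => //; exact: integrable_indic_itv.
  apply: eq_integrable => // x _ /=; rewrite indicE.
  by case: (_ \in _); rewrite ?expr1n ?expr0n.
have ind1 : sqint Rpos (\1_(`]p, r[%classic) : R -> R).
  apply: integrable_sqint => //.
  have : mu.-integrable Rpos (EFin \o (\1_(`]p, r[%classic) : R -> R)).
    by apply: (@integrableS _ _ _ _ setT) => //; exact: integrable_indic_itv.
  apply: eq_integrable => // x _ /=; rewrite indicE.
  by case: (_ \in _); rewrite ?expr1n ?expr0n.
apply: (@approximable_cvg v) => //.
- by move=> n; exact: testpos_sqint.
- move=> n e e0; exists (v n); split=> //.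
  rewrite (eq_nsq (g := fun=> 0)); last by move=> x _; rewrite subrr.
  by rewrite /nsq; under eq_Rintegral do rewrite expr0n; rewrite Rintegral_cst ?mul0r.
apply: (nsq_dominated (g := fun x => M ^+ 2 * \1_(`]p, r[%classic) x)) => //.
- by move=> n; have [] := testpos_sqint (tv n).
- move=> x _; rewrite indicE; have [xi|xi] := boolP (x \in _).
    move: xi; rewrite inE /= in_itv /= => /andP[px xr].
    apply: cvg_near_cst.
    have a0 : 0 < Num.min (x - p) (r - x) by rewrite lt_min !subr_gt0 px xr.
    near=> n.
    have hn : 5 / Num.min (x - p) (r - x) < n%:R by near: n; exact: nbhs_infty_gtr.
    rewrite ltr_pdivrMr // in hn.
    have h1 : n%:R * Num.min (x - p) (r - x) <= n%:R * (x - p).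
      by rewrite ler_wpM2l // ge_min lexx.
    have h2 : n%:R * Num.min (x - p) (r - x) <= n%:R * (r - x).
      by rewrite ler_wpM2l // ge_min lexx orbT.
    by rewrite /v !smooth_step1 ?mulr1 //; lra.
  apply: cvg_near_cst; apply: nearW => n; apply: v0.
  move: xi; rewrite notin_setE /= in_itv /= => /negP.
  by rewrite negb_and -!leNgt => /orP.
- move=> n x _; rewrite indicE; have [xi|xi] := boolP (x \in _).
    by rewrite mulr1 /v normrM expr2 ler_pM.
  rewrite mulr0 v0 ?normr0 //.
  move: xi; rewrite notin_setE /= in_itv /= => /negP.
  by rewrite negb_and -!leNgt => /orP.
Unshelve. all: by end_near. Qed.


Lemma sqint_indic (A : set R) (p r : R) :
  measurable (A : set (measurableTypeR R)) -> sqint Rpos (\1_(A `&` `]p, r[%classic) : R -> R).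
Proof.
move=> mA; have mI : measurable (A `&` `]p, r[%classic : set (measurableTypeR R)).
  by apply: measurableI => //; exact: measurable_itv.
apply: integrable_sqint => //.
have : mu.-integrable Rpos (EFin \o (\1_(A `&` `]p, r[%classic) : R -> R)).
  apply: (@integrable_le _ _ _ (\1_(`]p, r[%classic) : R -> R)) => //.
  - by apply: (@integrableS _ _ _ _ setT) => //; exact: integrable_indic_itv.
  - move=> x _; rewrite !indicE in_setI.
    by case: (x \in A); case: (x \in _); rewrite /= ?normr0 ?normr1.
apply: eq_integrable => // x _ /=; rewrite indicE.
by case: (_ \in _); rewrite ?expr1n ?expr0n.
Qed.

Lemma approximable0 : approximable (fun=> 0).
Proof.
move=> e e0; exists (fun=> 0); split.
  split; first exact: spos_cst.
  by exists 1, 2; split => //; rewrite ltr1n.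
rewrite (eq_nsq (g := fun=> 0)); last by move=> x _; rewrite subr0.
by rewrite /nsq; under eq_Rintegral do rewrite expr0n; rewrite Rintegral_cst ?mul0r.
Qed.

(** Dynkin's theorem: the good sets [A] form a lambda-system containing the open intervals, which
    are stable under intersection and generate the Borel sets. The window ]p, r[ keeps measures
    finite and supports away from 0. *)
Lemma approximable_indic (A : set R) (p r : R) : 0 < p ->
  measurable (A : set (measurableTypeR R)) ->
  approximable (\1_(A `&` `]p, r[%classic)).
Proof.
move=> p0.
pose Q (A : set R) := approximable (\1_(A `&` `]p, r[%classic)).
have mE : @measurable _ (measurableTypeR R) = <<s @RGenOpens.G R >>.
  exact: RGenOpens.measurableE.
rewrite mE; apply: (@dynkin_induction _ (measurableTypeR R) _ Q) => //.
- move=> _ _ [x [y ->]] [x' [y' ->]]; exists (Num.max x x'), (Num.min y y').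
  exact: itvooI.
- by rewrite /Q setTI; exact: approximable_itv.
- move=> _ [x [y ->]]; rewrite /Q.
  have -> : `]x, y[%classic `&` `]p, r[%classic = `](Num.max x p), (Num.min y r)[%classic.
    exact: itvooI.
  by apply: approximable_itv; rewrite lt_max p0 orbT.
- move=> S mS QS; rewrite /Q.
  have -> : (\1_(~` S `&` `]p, r[%classic) : R -> R) =
      (fun x => \1_(setT `&` `]p, r[%classic) x + (-1) * \1_(S `&` `]p, r[%classic) x).
    apply/funext => x; rewrite !indicE !in_setI in_setC in_setT.
    by case: (x \in S); case: (x \in _); rewrite /= ?mulr0 ?mulr1 ?addr0 ?subrr.
  apply: approximableD.
  - exact: sqint_indic.
  - by apply: sqintZ => //; exact: sqint_indic.
  - by rewrite setTI; exact: approximable_itv.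
  - by apply: approximableZ => //; exact: sqint_indic.
- move=> F mF tF QF; rewrite /Q.
  (* For a disjoint union, the partial unions have finite sums as indicators, and the indicator of
     the window dominates the sequence. *)
  pose U n : set R := \big[setU/set0]_(k < n) F k.
  have mU n : measurable (U n : set (measurableTypeR R)).
    by apply: bigsetU_measurable => k _; exact: mF.
  have mUF : measurable (\bigcup_k F k : set (measurableTypeR R)).
    exact: bigcup_measurable.
  apply: (@approximable_cvg (fun n => \1_(U n `&` `]p, r[%classic))).
  - exact: sqint_indic.
  - by move=> n; exact: sqint_indic.
  - elim=> [|n IH].
      rewrite /U big_ord0 set0I indic0; exact: approximable0.
    have -> : (\1_(U n.+1 `&` `]p, r[%classic) : R -> R) =
        (fun x => \1_(U n `&` `]p, r[%classic) x + \1_(F n `&` `]p, r[%classic) x).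
      apply/funext => x; rewrite !indicE !in_setI {1}/U big_ord_recr /= -/(U n) in_setU.
      have [xU|] := boolP (x \in U n); last by rewrite /= add0r.
      have xF : (x \in F n) = false.
        apply/negP; rewrite inE => Fx; move: xU; rewrite inE /U -bigcup_mkord => -[k /= kn Fk].
        move/trivIsetP : tF => /(_ k n I I); rewrite (ltn_eqF kn) => /(_ isT).
        by apply/eqP/set0P; exists x.
      by rewrite xF /= addr0.
    apply: approximableD => //; [exact: sqint_indic|exact: sqint_indic|exact: QF].
  - apply: (nsq_dominated (g := \1_(setT `&` `]p, r[%classic))) => //.
    + by move=> n; have [] := sqint_indic p r (mU n).
    + by have [] := sqint_indic p r mUF.
    + move=> x _; have [xF|xF] := boolP (x \in \bigcup_k F k).
        apply: cvg_near_cst; have [m _ Fm] := set_mem xF.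
        exists m.+1 => // n /= mn; rewrite !indicE !in_setI xF.
        suff -> : x \in U n by [].
        by rewrite inE /U -bigcup_mkord; exists m.
      apply: cvg_near_cst; apply: nearW => n; rewrite !indicE !in_setI (negbTE xF) /=.
      suff /negbTE -> : x \notin U n by [].
      apply: contra xF; rewrite !inE /U -bigcup_mkord => -[k _ Fk]; by exists k.
    + move=> n x _; rewrite !indicE !in_setI in_setT /=.
      by case: (x \in U n); case: (x \in _); rewrite /= ?normr0 ?normr1.
    + exact: sqint_indic.
Qed.

Lemma approximable_ge0 f : sqint Rpos f -> (forall x, 0 < x -> 0 <= f x) -> approximable f.
Proof.
move=> fi f0; have [mf _] := fi.
have mf' : measurable_fun Rpos (EFin \o f) by exact/measurable_EFinP.
have f0' x : Rpos x -> (0%:E <= (EFin \o f) x)%E by move=> x0; rewrite lee_fin f0.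
pose hs n := nnsfun_approx mR mf' n.
pose h n : R -> R := hs n.
pose J n : set R := `](n.+1%:R)^-1, n.+1%:R[%classic.
(* Increasing simple functions, cut to ]1/(n+1), n+1[ so that each level set falls under
   [approximable_indic]. *)
pose g n (x : R) := h n x * \1_(J n) x.
have mh n : measurable_fun Rpos (h n) by exact: (measurable_funTS (@measurable_funPT _ _ _ _ (hs n))).
have hf n x : 0 < x -> 0 <= h n x <= f x.
  move=> x0; apply/andP; split; first by rewrite /h.
  by rewrite /h /hs nnsfun_approxE -lee_fin; exact: (le_approx n f0').
have mg n : measurable_fun Rpos (g n).
  apply: measurable_funM => //.
  exact: (@measurable_indic _ (measurableTypeR R) R Rpos _ (measurable_itv _)).
have gf n x : 0 < x -> `|g n x| <= f x.
  move=> /(hf n) /andP[h0 hx]; rewrite /g indicE ger0_norm ?mulr_ge0 //.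
  by case: (_ \in _); rewrite ?mulr1 ?mulr0 // (le_trans h0).
have gi n : sqint Rpos (g n).
  apply: (sqint_le mR (mg n) fi) => x x0; apply: le_trans (gf n x x0) _; exact: ler_norm.
apply: (@approximable_cvg g) => //.
- move=> n.
  have [m [r [A [mA hE]]]] : exists m (r : 'I_m -> R) (A : 'I_m -> set R),
      (forall i, measurable (A i : set (measurableTypeR R))) /\
      forall x, h n x = \sum_(i < m) r i * \1_(A i) x.
    refine (ex_intro _ _ (ex_intro _ _ (ex_intro _ _ (conj _ (fun x => fimfunEord (hs n) x))))).
    by move=> i; exact: (measurable_sfunP (hs n) (measurable_set1 _)).
  have -> : g n = fun x => \sum_(i <- index_enum 'I_m) (r i * \1_(A i `&` J n) x).
    apply/funext => x; rewrite /g hE big_distrl /=.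
    by apply: eq_bigr => i _; rewrite -mulrA !indicE in_setI -natrM mulnb.
  have [] // := @approximable_sum _ (index_enum 'I_m) (fun i x => r i * \1_(A i `&` J n) x).
    by move=> i; apply: sqintZ => //; exact: sqint_indic.
  move=> i; apply: approximableZ; first exact: sqint_indic.
  by apply: approximable_indic; rewrite ?invr_gt0.
- apply: (nsq_dominated (g := f)) => //.
  move=> x x0; apply: (@cvg_trans _ (h n x @[n --> \oo])).
    apply: near_eq_cvg; near=> n; rewrite /g indicE mem_set ?mulr1 //.
    rewrite /J /= in_itv /=; apply/andP; split.
      rewrite -[x]invrK ltf_pV2 ?posrE ?invr_gt0 //.
      near: n; apply: (filterS _ (nbhs_infty_gtr x^-1)) => m /= h1.
      by rewrite (lt_trans h1) // ltr_nat.
    near: n; apply: (filterS _ (nbhs_infty_gtr x)) => m /= h1.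
    by rewrite (lt_trans h1) // ltr_nat.
  by have /fine_cvg := cvg_nnsfun_approx mR mf' f0' (x0 : Rpos x).
Unshelve. all: by end_near. Qed.

Lemma approximable_sqint f : sqint Rpos f -> approximable f.
Proof.
move=> fi; have [mf _] := fi.
pose fp x := Num.max (f x) 0; pose fm x := Num.max (- f x) 0.
have fpi : sqint Rpos fp.
  apply: (sqint_le mR _ fi); first by apply: measurable_maxr.
  move=> x _; rewrite /fp ger0_norm ?le_max ?lexx ?orbT // ge_max ler_norm /=; exact: normr_ge0.
have fmi : sqint Rpos fm.
  apply: (sqint_le mR _ fi); first by apply: measurable_maxr => //; exact: measurableT_comp.
  move=> x _; rewrite /fm ger0_norm ?le_max ?lexx ?orbT // ge_max normr_ge0 andbT.
  by rewrite -normrN ler_norm.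
have -> : f = fun x => fp x + (-1) * fm x.
  apply/funext => x; rewrite /fp /fm mulN1r.
  have [h|h] := leP 0 (f x).
    by rewrite max_r ?subr0 // oppr_le0.
  by rewrite max_l ?opprK ?add0r // oppr_ge0 ltW.
apply: approximableD => //; first exact: sqintZ.
  by apply: approximable_ge0 => // x _; rewrite /fp le_max lexx orbT.
apply: approximableZ => //; apply: approximable_ge0 => // x _.
by rewrite /fm le_max lexx orbT.
Qed.


Lemma cutoff (n : R) : 0 < n -> exists chi : R -> R,
  [/\ smooth_on setT chi, forall x, 0 < x < n -> chi x = 1,
      forall x, 2 * n < x -> chi x = 0 & exists M : R, forall x : R, 0 < x -> `|chi x| <= M].
Proof.
move=> n0; pose chi (x : R) := P (n^-1 * x + 0).
have chi1 x : 0 < x < n -> chi x = 1.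
  move=> /andP[x0 xn]; rewrite /chi addr0 P1 // ger0_norm; last first.
    by rewrite mulr_ge0 ?invr_ge0 // ltW.
  by rewrite mulrC ltr_pdivrMr // mul1r.
have chi0 x : 2 * n < x -> chi x = 0.
  move=> nx; rewrite /chi addr0 P0 // ltr_normr; apply/orP; left.
  by rewrite mulrC ltr_pdivlMr.
have schi : smooth_on setT chi.
  exact: (@smooth_on_affine R setT setT n^-1 0 P openT (fun _ _ => I) (proj1 (smooth_onT P) sP)).
exists chi; split => //.
have cc : cpos chi by apply: cpos_smooth; exact: smooth_onS schi.
have n2 : 0 < n / 2 by rewrite divr_gt0.
have n23 : n / 2 <= 3 * n by lra.
have [M HM] := continuous_Rpos_bounded n2 n23 cc.
exists (`|M| + 1) => x x0; have [x1|x1] := ltP x (n / 2).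
  by rewrite chi1 ?normr1 ?lerDr // x0 /=; lra.
have [x6|x6] := leP x (3 * n).
  by apply: le_trans (HM x _) _; [lra|rewrite (le_trans (ler_norm _)) // lerDl].
by rewrite chi0 ?normr0 ?addr_ge0 //; lra.
Qed.

Lemma sqint_bounded (D : set (measurableTypeR R)) (f g : R -> R) (M : R) : measurable D ->
  measurable_fun D g -> (forall x, D x -> `|g x| <= M) -> sqint D f ->
  sqint D (fun x => g x * f x).
Proof.
move=> mD mg gM fi; apply: (sqint_le mD _ (sqintZ M mD fi)).
  by apply: measurable_funM => //; case: fi.
move=> x Dx; rewrite !normrM ler_wpM2r // (le_trans (gM x Dx)) //; exact: ler_norm.
Qed.

(** As [w] is only locally square integrable, it is tested against chi^2 v, where v is close in L^2
    to a truncation f of w past the support of chi. Since chi w = chi f, orthogonality gives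
    [nsq Rpos] of chi f as the scalar product of chi^2 f with f - v, small by Cauchy-Schwarz. *)
Lemma fundamental_lemma (w : R -> R) : (forall N : R, 0 < N -> sqint `]0, N[ w) ->
  (forall v, testpos v -> \int[mu]_(x in Rpos) (w x * v x) = 0) ->
  {ae mu, forall x, Rpos x -> w x = 0}.
Proof.
move=> wl w0.
suff H (n : nat) : {ae mu, forall x, `]0%R, n.+1%:R[%classic x -> w x = 0}.
  have := ae_foralln H; apply: filterS => x Hx x0.
  have [n xn] : exists n : nat, x < n.+1%:R.
    by exists (Num.truncn x); rewrite truncnS_gt.
  by apply: (Hx n); rewrite /= in_itv /= xn andbT.
set N : R := n.+1%:R; have N0 : 0 < N by rewrite ltr0n.
have [chi [schi chi1 chi0 [M chiM]]] := cutoff N0.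
have chis : smooth_on Rpos chi by exact: smooth_onS schi.
have mchi : measurable_fun (Rpos : set (measurableTypeR R)) chi.
  by apply: continuous_Rpos_measurable; exact: cpos_smooth.
pose f := w \_ `]0, 3 * N[%classic.
have fi : sqint Rpos f.
  apply: sqint_patch => //.
  rewrite (_ : _ `&` _ = `]0, 3 * N[%classic); first by apply: wl; rewrite mulr_gt0.
  by apply: setIidr; exact: subset_itv_Rpos.
have cfi : sqint Rpos (fun x => chi x * f x) by exact: (sqint_bounded mR mchi chiM).
have ccfi : sqint Rpos (fun x => chi x * (chi x * f x)) by exact: (sqint_bounded mR mchi chiM).
have wE x : 0 < x -> chi x * w x = chi x * f x.
  move=> x0; rewrite /f patchE; case: ifPn => //.
  rewrite notin_setE /= in_itv /= x0 /= => /negP; rewrite -leNgt => Nx.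
  by rewrite chi0 ?mul0r //; apply: lt_le_trans Nx; lra.
have I0 : nsq Rpos (fun x => chi x * f x) = 0.
  apply/eqP; rewrite eq_le nsq_ge0 andbT; apply/ler_addgt0Pr => e e0; rewrite add0r.
  set K := nsq Rpos (fun x => chi x * (chi x * f x)).
  have K1 : 0 < K + 1 by rewrite ltr_wpDl // nsq_ge0.
  have [v [tv fv]] := approximable_sqint fi (divr_gt0 (exprn_gt0 2 e0) K1).
  have vi := testpos_sqint tv.
  have tcv : testpos (fun x => chi x * (chi x * v x)).
    by apply: testposMr => //; apply: testposMr.
  have := cauchy_schwarz_nsq mR ccfi (sqintB mR fi vi).
  rewrite (_ : Rintegral _ _ _ = nsq Rpos (fun x => chi x * f x)); last first.
    transitivity (\int[mu]_(x in Rpos) ((chi x * (chi x * f x)) * f x) -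
                  \int[mu]_(x in Rpos) ((chi x * (chi x * f x)) * v x)).
      rewrite -RintegralB //; last 2 first.
      - exact: sqintM.
      - exact: sqintM.
      by apply: eq_Rintegral => x _; rewrite mulrBr.
    rewrite [X in _ - X](_ : _ = 0).
      by rewrite subr0 /nsq; apply: eq_Rintegral => x _; ring.
    rewrite -[RHS](w0 _ tcv); apply: eq_Rintegral => x; rewrite inE => x0.
    by rewrite -wE //; ring.
  move=> h; have h2 : nsq Rpos (fun x => chi x * f x) ^+ 2 <= e ^+ 2.
    apply: le_trans h _; rewrite -/K.
    have K0 : 0 <= K by exact: nsq_ge0.
    apply: le_trans (ler_wpM2l K0 (ltW fv)) _.
    by rewrite mulrA ler_pdivrMr // mulrC ler_wpM2l ?sqr_ge0 // lerDl.
  by move: h2; rewrite ler_sqr ?nnegrE ?nsq_ge0 // ltW.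
have := nsq_eq0 mR cfi I0; apply: filterS => x h /=; rewrite in_itv /= => /andP[x0 xN].
have := h x0; rewrite chi1 ?x0 // mul1r /f patchE mem_set //=.
by rewrite in_itv /= x0 /= (lt_trans xN) //; lra.
Qed.

End SmoothStep.
End Density.

(** * Weak solutions *)

Section WeakRegularity.
Context {R : realType} (alpha : R) (k : int).
Hypothesis ha : 0 <= alpha < 1.
Local Notation mu := (@lebesgue_measure R).
Local Notation a := (- (alpha / 2)).
Local Notation b := (1 + alpha / 2).
Local Notation c := (alpha * (2 + alpha) / 4).
Local Notation S0 := (bessel_op alpha).
Local Notation varpar := (varpar alpha).
Local Notation open_itv N := (`]0, N[%classic : set (measurableTypeR R)).

#[local] Opaque Rintegral derive1 smooth_on.

Let a0 : 0 <= alpha. Proof. by case/andP: ha. Qed.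
Let a1 : alpha < 1. Proof. by case/andP: ha. Qed.
Let mR := @measurable_Rpos R.
Let mI (N : R) : measurable (open_itv N). Proof. exact: measurable_itv. Qed.

(** The part of the potential that is bounded on every ]0, N[; it is moved to the right-hand side of
    the equation, so that only the homogeneous singular part has to be inverted. *)
Definition power_pot (x : R) : R := k%:~R ^+ 2 * `|x| `^ (2 * alpha).
Local Notation V1 := power_pot.

Lemma SrE u x : 0 < x -> Sr alpha k u x = S0 u x + V1 x * u x.
Proof.
move=> x0; rewrite /Sr /Vpot /S0 /V1 derive1nS derive1n1.
have xn0 : x != 0 by rewrite gt_eqF.
move: (derive1 (derive1 u) x) (_ * _ `^ _) => A B.
by field.
Qed.

Lemma V1_smooth : smooth_on Rpos V1.
Proof.
apply: (smooth_on_eq open_Rpos _ (sposZ (k%:~R ^+ 2) (smooth_on_powR (2 * alpha)))).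
by move=> x x0; rewrite /V1 gtr0_norm.
Qed.

Lemma V1_ge0 x : 0 <= V1 x.
Proof. by rewrite /V1 mulr_ge0 ?sqr_ge0 ?powR_ge0. Qed.

Lemma V1_bound N x : 0 < x < N -> `|V1 x| <= V1 N.
Proof.
move=> /andP[x0 xN]; rewrite ger0_norm ?V1_ge0 // /V1 ler_wpM2l ?sqr_ge0 //.
have N0 := lt_trans x0 xN.
have r0 : 0 <= 2 * alpha by exact: mulr_ge0.
by rewrite !gtr0_norm //; apply: (ge0_ler_powR r0); rewrite ?nnegrE ltW.
Qed.

(** Square integrability up to 0 but only locally at infinity, where [V1 * g] and [varpar f] may
    grow. *)
Definition locsqint f : Prop := forall N : R, 0 < N -> sqint (open_itv N) f.

Lemma sqint_locsqint f : sqint Rpos f -> locsqint f.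
Proof. by move=> fi N N0; apply: sqintS fi => //; exact: subset_itv_Rpos. Qed.

Lemma locsqint_V1 f : locsqint f -> locsqint (fun x => V1 x * f x).
Proof.
move=> fi N N0; apply: (@sqint_bounded _ _ _ _ (V1 N)) => //.
- apply: measurable_funS (continuous_Rpos_measurable (cpos_smooth V1_smooth)) => //.
  exact: subset_itv_Rpos.
- by move=> x /=; rewrite in_itv /=; exact: V1_bound.
- exact: fi.
Qed.

Lemma sqint_cst N (r : R) : sqint (open_itv N) (fun=> r).
Proof.
apply: integrable_sqint => //; apply: measurable_bounded_integrable => //.
  by rewrite /= lebesgue_measure_itv /=; case: ifP; rewrite ?ltry.
exists `|r ^+ 2|; split; first exact: num_real.
by move=> M rM x _ /=; exact: ltW.
Qed.

Lemma nsq_cst N (r : R) : 0 < N -> nsq (open_itv N) (fun=> r) = r ^+ 2 * N.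
Proof.
move=> N0; rewrite /nsq Rintegral_cst //.
by rewrite /= lebesgue_measure_itv /= lte_fin N0 /= subr0.
Qed.

Lemma integrable_loc_test f v : locsqint f -> testpos v -> mu.-integrable Rpos (EFin \o (fun x => f x * v x)).
Proof.
move=> fi tv; have [sv [d [N [d0 dN sup]]]] := tv.
have N0 : 0 < N + 1 by lra.
have h := sqintM (mI (N + 1)) (fi _ N0) (sqint_locsqint (testpos_sqint tv) N0).
have e : (EFin \o (fun x => f x * v x)) \_ `]0, (N + 1)[ =
    (EFin \o (fun x => f x * v x)) \_ (Rpos : set R).
  apply/funext => x; rewrite !patchE /=.
  case: ifPn => [|/negP]; rewrite inE /= in_itv /=.
    by move=> /andP[x0 _]; rewrite mem_set.
  move=> /negP; rewrite negb_and => H; case: ifPn => //; rewrite inE => x0.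
  move: H; rewrite x0 /= -leNgt => Nx; rewrite sup ?mulr0 //; right; lra.
by move: h; rewrite (integrable_mkcond _ (mI _)) e -(integrable_mkcond _ mR).
Qed.

Lemma eq_Rint (D : set (measurableTypeR R)) (f g : R -> R) :
  (forall x, D x -> f x = g x) -> \int[mu]_(x in D) f x = \int[mu]_(x in D) g x.
Proof. by move=> fg; apply: eq_Rintegral => x /set_mem; exact: fg. Qed.

Section WithCutoff.
Context (P : R -> R).
Hypotheses (sP : smooth P) (P1 : forall x : R, `|x| < 1 -> P x = 1)
  (P0 : forall x : R, 2 < `|x| -> P x = 0).

Lemma approximable_loc f N e : 0 < N -> locsqint f -> 0 < e ->
  exists v, testpos v /\ nsq (open_itv N) (fun x => f x - v x) < e.
Proof.
move=> N0 fi e0.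
have fi' : sqint Rpos (f \_ `]0, N[%classic).
  apply: sqint_patch => //; rewrite (_ : _ `&` _ = `]0, N[%classic); first exact: fi.
  by apply: setIidr; exact: subset_itv_Rpos.
have [v [tv fv]] := approximable_sqint sP P1 P0 fi' e0.
exists v; split=> //; have vi := testpos_sqint tv.
rewrite (eq_nsq (g := fun x => (f \_ `]0, N[%classic) x - v x)); last first.
  by move=> x xN; rewrite patchE mem_set.
apply: le_lt_trans fv; apply: nsqS => //; first exact: subset_itv_Rpos.
exact: sqintB.
Qed.

Lemma varpar_close f v N x : locsqint f -> testpos v -> 0 < x -> x < N ->
  (varpar f x - varpar v x) ^+ 2 <=
  4 / (1 - alpha) * N ^+ 3 * nsq (open_itv N) (fun t => f t - v t).
Proof.
move=> fi tv x0 xN; have vi := sqint_locsqint (testpos_sqint tv).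
have N0 := lt_trans x0 xN.
rewrite -varparB //; [|exact: fi|exact: vi].
apply: le_trans (varpar_bound ha x0 (sqintB (mI x) (fi _ x0) (vi _ x0))) _.
apply: ler_pM.
- by rewrite mulr_ge0 ?divr_ge0 ?exprn_ge0 ?subr_ge0 // ltW.
- exact: nsq_ge0.
- rewrite ler_wpM2l ?divr_ge0 ?subr_ge0 // ?(ltW a1) //.
  by rewrite lerXn2r ?nnegrE // ltW.
- apply: nsqS => //; last exact: (sqintB (mI N) (fi _ N0) (vi _ N0)).
  by apply: subset_itvl; rewrite bnd_simp ltW.
Qed.

Lemma smooth_varpar v : testpos v -> smooth_on Rpos (varpar v).
Proof.
move=> tv; have [sv [d [N [d0 dN sup]]]] := tv.
apply: (smooth_on_varpar d0); [exact: testpos_cpos| |exact: sv].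
by move=> y /andP[y0 yd]; apply: sup => //; left.
Qed.

(** By [varpar_close], L^2 approximation of [f] on ]0, N[ gives pointwise approximation of
    [varpar f], which is thus a pointwise limit of smooth functions. *)
Lemma varpar_measurable f N : 0 < N -> locsqint f -> measurable_fun (open_itv N) (varpar f).
Proof.
move=> N0 fi.
have /choice [v Hv] : forall n, exists v, testpos v /\
    nsq (open_itv N) (fun x => f x - v x) < (n.+1%:R)^-1.
  by move=> n; apply: approximable_loc.
apply: (@measurable_fun_cvg _ _ _ _ (fun n => varpar (v n))).
  move=> n; have [tv _] := Hv n.
  apply: measurable_funS (continuous_Rpos_measurable (cpos_smooth (smooth_varpar tv))) => //.
  exact: subset_itv_Rpos.
move=> x /=; rewrite in_itv /= => /andP[x0 xN].
set K := 4 / (1 - alpha) * N ^+ 3.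
have K0 : 0 <= K by rewrite mulr_ge0 ?divr_ge0 ?exprn_ge0 ?subr_ge0 // ltW.
apply/cvgrPdist_lt => e e0.
near=> n; have [tv vn] := Hv n.
have h := varpar_close fi tv x0 xN; rewrite -/K in h.
rewrite -ltr_sqr ?nnegrE // ?(ltW e0) // real_normK ?num_real //.
apply: le_lt_trans h _.
apply: le_lt_trans (ler_wpM2l K0 (ltW vn)) _.
have hn : K / e ^+ 2 < n.+1%:R.
  near: n; apply: (filterS _ (nbhs_infty_gtr (K / e ^+ 2))) => m /= h1.
  by rewrite (lt_trans h1) // ltr_nat.
rewrite ltr_pdivrMr ?exprn_gt0 // in hn.
by rewrite ltr_pdivrMr // mulrC.
Unshelve. all: by end_near. Qed.

Lemma varpar_locsqint f : locsqint f -> locsqint (varpar f).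
Proof.
move=> fi N N0; set K := 4 / (1 - alpha) * N ^+ 3 * nsq (open_itv N) f.
apply: (@sqint_le _ _ _ (fun=> K + 1)) => //; first exact: varpar_measurable.
  exact: sqint_cst.
have K0 : 0 <= K by rewrite !mulr_ge0 ?nsq_ge0 ?invr_ge0 ?exprn_ge0 ?subr_ge0 // ltW.
move=> x /=; rewrite in_itv /= => /andP[x0 xN].
rewrite [leRHS]ger0_norm ?addr_ge0 // -ler_sqr ?nnegrE ?addr_ge0 // real_normK ?num_real //.
apply: le_trans (varpar_bound ha x0 (fi _ x0)) _.
apply: le_trans (_ : K <= _); last by nra.
apply: ler_pM.
- by rewrite mulr_ge0 ?divr_ge0 ?exprn_ge0 ?subr_ge0 // ltW.
- exact: nsq_ge0.
- rewrite ler_wpM2l ?divr_ge0 ?subr_ge0 // ?(ltW a1) //.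
  by rewrite lerXn2r ?nnegrE // ltW.
- apply: nsqS => //; last exact: fi.
  by apply: subset_itvl; rewrite bnd_simp ltW.
Qed.

Lemma nsq_varpar_close f v N : 0 < N -> locsqint f -> testpos v ->
  nsq (open_itv N) (fun x => varpar f x - varpar v x) <=
  4 / (1 - alpha) * N ^+ 4 * nsq (open_itv N) (fun t => f t - v t).
Proof.
move=> N0 fi tv; have vi := sqint_locsqint (testpos_sqint tv).
set K := 4 / (1 - alpha) * N ^+ 3 * nsq (open_itv N) (fun t => f t - v t).
have K0 : 0 <= K by rewrite !mulr_ge0 ?nsq_ge0 ?invr_ge0 ?exprn_ge0 ?subr_ge0 // ltW.
(* The pointwise estimate is uniform on ]0, N[; integrating it adds one factor N. *)
apply: le_trans (_ : nsq (open_itv N) (fun=> Num.sqrt K) <= _).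
  apply: nsq_le => //.
  - by apply: measurable_funB; apply: varpar_measurable.
  - exact: sqint_cst.
  - move=> x /=; rewrite in_itv /= => /andP[x0 xN].
    rewrite [leRHS]ger0_norm ?sqrtr_ge0 // -ler_sqr ?nnegrE ?sqrtr_ge0 //.
    by rewrite real_normK ?num_real // sqr_sqrtr //; exact: varpar_close.
rewrite nsq_cst // sqr_sqrtr // /K.
move: (nsq _ _) => n; rewrite (_ : 4 / (1 - alpha) * N ^+ 3 * n * N = 4 / (1 - alpha) * N ^+ 4 * n) //.
by ring.
Qed.

(** For a test function in place of [f] this is Green's formula together with [S0_varpar]. Both
    sides are continuous in [f] for the L^2 norm on a bounded interval containing the support of
    [u], so density concludes. *)
Lemma varpar_weak f u : locsqint f -> testpos u ->
  \int[mu]_(x in Rpos) (varpar f x * S0 u x) = \int[mu]_(x in Rpos) (f x * u x).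
Proof.
move=> fi tu; have [su [d [N' [d0 dN sup]]]] := tu.
have tS := testpos_S0 alpha tu.
pose N := N' + 1; have N0 : 0 < N by rewrite /N; lra.
have u0 x : N <= x -> u x = 0.
  by move=> Nx; apply: sup; [|right]; move: Nx; rewrite /N; lra.
have S0u0 x : N <= x -> S0 u x = 0.
  move=> Nx; apply: (S0_eq0 alpha (@open_gt R N')).
    by move=> y /= Ny; apply: sup; [lra|right].
  by rewrite /=; move: Nx; rewrite /N; lra.
rewrite (@Rintegral_Rpos_itv _ _ N) //; last by move=> x /S0u0 ->; rewrite mulr0.
rewrite (@Rintegral_Rpos_itv _ (fun x => f x * u x) N) //; last by move=> x /u0 ->; rewrite mulr0.
have ui := sqint_locsqint (testpos_sqint tu) N0.
have Si := sqint_locsqint (testpos_sqint tS) N0.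
have Tfi := varpar_locsqint fi N0.
set X := Rintegral _ _ _; set Y := Rintegral _ _ _.
set K := 4 / (1 - alpha) * N ^+ 4.
have K0 : 0 <= K by rewrite mulr_ge0 ?divr_ge0 ?exprn_ge0 ?subr_ge0 // ltW.
(* The factor in (X - Y)^2 <= A |f - v|^2: X - Y is a difference p - q of two error integrals,
   bounded through 2 p^2 + 2 q^2 and Cauchy-Schwarz for each. *)
set A := 2 * (K * nsq (open_itv N) (S0 u)) + 2 * nsq (open_itv N) u.
have A0 : 0 <= A.
  by apply: addr_ge0; apply: mulr_ge0; rewrite ?nsq_ge0 //; apply: mulr_ge0; rewrite ?nsq_ge0.
suff : (X - Y) ^+ 2 <= 0.
  rewrite le_eqVlt ltNge sqr_ge0 orbF sqrf_eq0 subr_eq0 => /eqP //.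
apply/ler_addgt0Pr => e e0; rewrite add0r.
have A1 : 0 < A + 1 by rewrite ltr_wpDl.
have [v [tv fv]] := approximable_loc N0 fi (divr_gt0 e0 A1).
have vi := sqint_locsqint (testpos_sqint tv) N0.
have Tvi := varpar_locsqint (sqint_locsqint (testpos_sqint tv)) N0.
have E : \int[mu]_(x in `]0%R, N[) (varpar v x * S0 u x) = \int[mu]_(x in `]0%R, N[) (v x * u x).
  rewrite -(@Rintegral_Rpos_itv _ _ N) //; last by move=> x /S0u0 ->; rewrite mulr0.
  rewrite -(@Rintegral_Rpos_itv _ (fun x => v x * u x) N) //; last by move=> x /u0 ->; rewrite mulr0.
  rewrite -S0_symmetric //; last exact: smooth_varpar.
  apply: eq_Rintegral => x; rewrite inE => x0.
  have [sv [d' [N'' [d'0 dN'' supv]]]] := tv.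
  rewrite (S0_varpar ha d'0) //; first exact: testpos_cpos.
  by move=> y /andP[y0 yd]; apply: supv => //; left.
have -> : X - Y = \int[mu]_(x in `]0%R, N[) ((varpar f x - varpar v x) * S0 u x)
   - \int[mu]_(x in `]0%R, N[) ((f x - v x) * u x).
  have E1 : \int[mu]_(x in `]0%R, N[) ((varpar f x - varpar v x) * S0 u x) =
      X - \int[mu]_(x in `]0%R, N[) (varpar v x * S0 u x).
    rewrite /X -RintegralB //; last 2 first.
    - exact: sqintM.
    - exact: sqintM.
    by apply: eq_Rintegral => x _; rewrite mulrBl.
  have E2 : \int[mu]_(x in `]0%R, N[) ((f x - v x) * u x) =
      Y - \int[mu]_(x in `]0%R, N[) (v x * u x).
    rewrite /Y -RintegralB //; last 2 first.
    - exact: (sqintM (mI N) (fi _ N0) ui).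
    - exact: (sqintM (mI N) vi ui).
    by apply: eq_Rintegral => x _; rewrite mulrBl.
  by rewrite E1 E2 E; ring.
have c1 := cauchy_schwarz_nsq (mI N) (sqintB (mI N) Tfi Tvi) Si.
have c2 := cauchy_schwarz_nsq (mI N) (sqintB (mI N) (fi _ N0) vi) ui.
have c3 := nsq_varpar_close N0 fi tv; rewrite -/K in c3.
have nS := nsq_ge0 (open_itv N) (S0 u); have nu := nsq_ge0 (open_itv N) u.
have nf := nsq_ge0 (open_itv N) (fun x => f x - v x).
move: (Rintegral _ _ _) (Rintegral _ _ _) c1 c2 => p q c1 c2.
set nn := nsq _ (fun x => f x - v x) in fv c2 c3 nf.
rewrite ltr_pdivlMr // in fv.
have c4 := ler_wpM2r nS c3.
have c5 := sqr_ge0 (p + q).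
apply: le_trans (_ : nn * A <= _); last by nra.
rewrite /A; nra.
Qed.


Lemma S0D u v x : smooth_on Rpos u -> smooth_on Rpos v -> 0 < x ->
  S0 (fun t => u t + v t) x = S0 u x + S0 v x.
Proof.
move=> su sv x0.
have svN := sposN sv.
have E : S0 (fun t => 0 - v t) x = - S0 v x.
  rewrite (S0B _ (spos_cst 0) sv x0) (S0_eq0 alpha open_Rpos (u := fun=> 0)) ?sub0r //.
have E2 : S0 (fun t => u t - (0 - v t)) x = S0 u x - S0 (fun t => 0 - v t) x.
  exact: (S0B _ su (sposB (spos_cst 0) sv) x0).
rewrite -(opprK (S0 v x)) -E -E2; apply: (S0_eq alpha _ x0) => y _.
by rewrite sub0r opprK.
Qed.

Lemma S0Z (r : R) u x : smooth_on Rpos u -> 0 < x ->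
  S0 (fun t => r * u t) x = r * S0 u x.
Proof.
move=> su x0; rewrite /bessel_op.
have E1 (f : R -> R) y : smooth_on Rpos f -> 0 < y ->
    derive1 (fun t => r * f t) y = r * derive1 f y.
  move=> sf y0; have df := smooth_on_is_derive sf y0.
  by rewrite derive1E; have [_ ->] := is_deriveZ r df.
rewrite (@derive1_eq_on _ Rpos _ (fun t => r * derive1 u t) open_Rpos _ x x0); last first.
  by move=> y y0; exact: (E1 _ _ su y0).
rewrite (E1 _ _ (smooth_on_derive1 su) x0).
by move: (derive1 (derive1 u) x) (u x) => *; ring.
Qed.

Lemma S0_powR s x : s * (s - 1) = c -> 0 < x -> S0 (fun y : R => y `^ s) x = 0.
Proof.
move=> sc x0; rewrite /bessel_op.
have D1 y : Rpos y -> derive1 (fun y : R => y `^ s) y = s * y `^ (s - 1).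
  by move=> y0; rewrite derive1E; have [_ ->] := is_derive1_powR s y0.
have D2 y : Rpos y -> derive1 (fun y : R => s * y `^ (s - 1)) y = s * ((s - 1) * y `^ (s - 1) / y).
  move=> y0; rewrite derive1E; have h := is_derive_powR_pos (s - 1) y0.
  by have [_ ->] := is_deriveZ s h.
rewrite (@derive1_eq_on _ Rpos _ _ open_Rpos D1 x x0) D2 //.
have xn0 : x != 0 by rewrite gt_eqF.
have -> : x `^ (s - 1) = x `^ s / x.
  by rewrite -powRM_pos // powR_inv1 // ltW.
rewrite -sc; by move: (x `^ s) => X; field.
Qed.

(* [(1 - P) x^s] is a solution of the homogeneous equation outside ]1, 2[. *)
Definition cut_power s (x : R) : R := (1 - P x) * x `^ s.

Lemma smooth_P : smooth_on Rpos P.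
Proof. by apply: smooth_onS (subsetT _) _; exact/smooth_onT. Qed.

Lemma smooth_cut_power s : smooth_on Rpos (cut_power s).
Proof. exact: (sposM (sposB (spos_cst 1) smooth_P) (smooth_on_powR s)). Qed.

Lemma testpos_S0_cut s : s * (s - 1) = c -> testpos (S0 (cut_power s)).
Proof.
move=> sc; split.
  apply: (@smooth_on_eq _ _ (fun x => - derive1 (derive1 (cut_power s)) x + c * x `^ (- 2%:R) * cut_power s x)).
  - exact: open_Rpos.
  - by move=> x x0; rewrite /bessel_op powR_invn // ltW.
  - exact: (sposD (sposN (smooth_on_derive1 (smooth_on_derive1 (@smooth_cut_power s))))
                (sposM (sposZ _ (smooth_on_powR _)) (@smooth_cut_power s))).
exists 1, 3; split; [by []|by rewrite ltr1n|].
move=> x x0 [x1|x3].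
  have oU : open ([set x : R | 0 < x] `&` [set x : R | x < 1]).
    by apply: openI; [exact: open_gt|exact: open_lt].
  apply: (S0_eq0 alpha oU) => // y [/= y0 y1].
  by rewrite /cut_power P1 ?gtr0_norm // subrr mul0r.
have x2 : 2 < x by lra.
have E : S0 (cut_power s) x = S0 (fun y : R => y `^ s) x; last by rewrite E S0_powR.
have e2 y : [set x : R | 2 < x] y -> cut_power s y = y `^ s.
  move=> /= y2; rewrite /cut_power P0 ?subr0 ?mul1r // gtr0_norm //; lra.
rewrite /bessel_op (e2 x x2).
have := derive1n_eq_on 2 (@open_gt R 2) e2 x2.
by rewrite !derive1nS !derive1n0 => ->.
Qed.

(* [varpar v] is a combination of [x^a] and [x^b] beyond the support of [v]; subtracting
   that combination of cut-off powers gives a test function, so [w] minus a fixed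
   combination of powers is orthogonal to every [v]. *)
Lemma ker_S0 w : locsqint w ->
  (forall u, testpos u -> \int[mu]_(x in Rpos) (w x * S0 u x) = 0) ->
  exists g0 g1 : R, {ae mu, forall x, Rpos x -> w x = g0 * x `^ a + g1 * x `^ b}.
Proof.
move=> wi w0.
have sca : a * (a - 1) = c by field.
have scb : b * (b - 1) = c by field.
have ta := testpos_S0_cut sca; have tb := testpos_S0_cut scb.
set za := S0 (cut_power a) in ta; set zb := S0 (cut_power b) in tb.
have al : 1 + alpha != 0 by rewrite gt_eqF //; move: a0; lra.
(* Orthogonality of [w] to S0 U will read <w, v> = A <w, za> + B <w, zb>, where A and B are the
   moments of v against x^b and x^a up to sign and the factor 1 + alpha. Reading this as a pairing
   with v gives the two coefficients. *)
pose g0 := - (\int[mu]_(x in Rpos) (w x * zb x)) / (1 + alpha).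
pose g1 := (\int[mu]_(x in Rpos) (w x * za x)) / (1 + alpha).
have iw f v : locsqint f -> testpos v -> mu.-integrable Rpos (EFin \o (fun x => f x * v x)).
  exact: integrable_loc_test.
have pa : locsqint (fun x => g0 * x `^ a) by move=> N N0; apply: sqintZ => //; exact: sqint_a.
have pb : locsqint (fun x => g1 * x `^ b) by move=> N N0; apply: sqintZ => //; exact: sqint_b.
have pi : locsqint (fun x => g0 * x `^ a + g1 * x `^ b).
  by move=> N N0; exact: (sqintD (mI N) (pa _ N0) (pb _ N0)).
exists g0, g1.
have : {ae mu, forall x, Rpos x -> w x - (g0 * x `^ a + g1 * x `^ b) = 0}.
  apply: (fundamental_lemma sP P1 P0).
    by move=> N N0; exact: (sqintB (mI N) (wi _ N0) (pi _ N0)).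
  move=> v tv.
  have [sv [d [N [d0 dN sup]]]] := tv.
  pose A := (\int[mu]_(t in Rpos) (t `^ b * v t)) / (1 + alpha).
  pose B := - (\int[mu]_(t in Rpos) (t `^ a * v t)) / (1 + alpha).
  have svp := smooth_varpar tv.
  have sca' := sposZ A (@smooth_cut_power a); have scb' := sposZ B (@smooth_cut_power b).
  pose U x := varpar v x - (A * cut_power a x + B * cut_power b x).
  have v0 y : 0 < y < d -> v y = 0 by move=> /andP[y0 yd]; apply: sup => //; left.
  have tU : testpos U.
    split; first exact: (sposB svp (sposD sca' scb')).
    exists (Num.min d 1), (Num.max (N + 1) 3); split.
    - by rewrite lt_min d0 ltr01.
    - by rewrite gt_min lt_max; apply/orP; left; apply/orP; left; lra.
    move=> x x0; rewrite lt_min gt_max => -[/andP[xd x1]|/andP[Nx x3]].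
      rewrite /U (varpar_near0 _ v0) ?x0 ?ltW // /cut_power P1 ?gtr0_norm // subrr.
      by rewrite !mul0r !mulr0 addr0 subr0.
    rewrite /U (@varpar_far _ alpha v x (N + 1)) //; last 2 first.
    - by rewrite ltW // andbT; lra.
    - by move=> y Ny; apply: sup; [lra|right; lra].
    rewrite /cut_power P0; last by rewrite gtr0_norm; lra.
    by rewrite -/A /B; ring.
  have tAB := testposD (testposZ A ta) (testposZ B tb).
  have SU x : 0 < x -> S0 U x = v x - (A * za x + B * zb x).
    move=> x0; rewrite (S0B _ svp (sposD sca' scb') x0) (S0_varpar ha d0 (testpos_cpos tv) v0 x0).
    rewrite (S0D sca' scb' x0) (S0Z _ (@smooth_cut_power a) x0).
    by rewrite (S0Z _ (@smooth_cut_power b) x0).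
  have := w0 _ tU.
  rewrite (eq_Rint (g := fun x => w x * v x - (A * (w x * za x) + B * (w x * zb x)))); last first.
    by move=> x x0; rewrite SU //; ring.
  have ia := iw _ _ wi ta; have ib := iw _ _ wi tb; have iv := iw _ _ wi tv.
  have iA : mu.-integrable Rpos (EFin \o (fun x => A * (w x * za x))) by exact: (integrableZl mR A ia).
  have iB : mu.-integrable Rpos (EFin \o (fun x => B * (w x * zb x))) by exact: (integrableZl mR B ib).
  have iAB : mu.-integrable Rpos (EFin \o (fun x => A * (w x * za x) + B * (w x * zb x))).
    exact: (integrableD mR iA iB).
  rewrite (RintegralB mR iv iAB) (RintegralD mR iA iB) (RintegralZl A mR ia) (RintegralZl B mR ib) => /eqP; rewrite subr_eq0 => /eqP E.
  rewrite (eq_Rint (g := fun x => w x * v x - (g0 * (x `^ a * v x) + g1 * (x `^ b * v x)))); last first.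
    by move=> x _; ring.
  have ja := iw _ _ (fun N N0 => sqint_a ha N0) tv.
  have jb := iw _ _ (fun N N0 => sqint_b ha N0) tv.
  have jA : mu.-integrable Rpos (EFin \o (fun x => g0 * (x `^ a * v x))) by exact: (integrableZl mR g0 ja).
  have jB : mu.-integrable Rpos (EFin \o (fun x => g1 * (x `^ b * v x))) by exact: (integrableZl mR g1 jb).
  have jAB : mu.-integrable Rpos (EFin \o (fun x => g0 * (x `^ a * v x) + g1 * (x `^ b * v x))).
    exact: (integrableD mR jA jB).
  rewrite (RintegralB mR iv jAB) (RintegralD mR jA jB) (RintegralZl g0 mR ja) (RintegralZl g1 mR jb) E /A /B /g0 /g1.
  move: (Rintegral _ _ _) (Rintegral _ _ _) (Rintegral _ _ _) (Rintegral _ _ _) => p q r s.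
  by ring.
by apply: (@filterS _ _ (ae_filter_ringOfSetsType mu)) => x H x0; have /eqP := H x0; rewrite subr_eq0 => /eqP.
Qed.

(** [varpar] of the right-hand side h - V1 g is one weak solution, by [varpar_weak]; the difference
    to [g] is a weak solution of the homogeneous equation, classified by [ker_S0]. *)
Lemma weak_regularity g h : sqint Rpos g -> sqint Rpos h ->
  (forall u, testpos u -> \int[mu]_(x in Rpos) (g x * Sr alpha k u x) =
                          \int[mu]_(x in Rpos) (h x * u x)) ->
  exists g0 g1 : R, {ae mu, forall x, Rpos x ->
    g x = varpar (fun t => h t - V1 t * g t) x + (g0 * x `^ a + g1 * x `^ b)}.
Proof.
move=> gi hi gh; have gl := sqint_locsqint gi.
pose f t := h t - V1 t * g t.
have fl : locsqint f.
  by move=> N N0; exact: (sqintB (mI N) (sqint_locsqint hi N0) (locsqint_V1 gl N0)).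
have Tl := varpar_locsqint fl.
have wl : locsqint (fun x => g x - varpar f x).
  by move=> N N0; exact: (sqintB (mI N) (gl _ N0) (Tl _ N0)).
have iw p v : locsqint p -> testpos v -> mu.-integrable Rpos (EFin \o (fun x => p x * v x)).
  exact: integrable_loc_test.
have [g0 [g1 H]] : exists g0 g1 : R, {ae mu, forall x, Rpos x ->
    g x - varpar f x = g0 * x `^ a + g1 * x `^ b}.
  apply: (ker_S0 wl) => u tu.
  have tS := testpos_S0 alpha tu.
  have tV : testpos (fun x => V1 x * u x) by exact: (testposMr tu V1_smooth).
  rewrite (eq_Rint (g := fun x => g x * S0 u x - varpar f x * S0 u x)); last first.
    by move=> x _; rewrite mulrBl.
  rewrite (RintegralB mR (iw _ _ gl tS) (iw _ _ Tl tS)) varpar_weak //.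
  have := gh _ tu.
  rewrite (eq_Rint (g := fun x => g x * S0 u x + g x * (V1 x * u x))); last first.
    by move=> x x0; rewrite SrE // mulrDr.
  rewrite (RintegralD mR (iw _ _ gl tS) (iw _ _ gl tV)) => E.
  rewrite (eq_Rint (f := fun x => f x * u x) (g := fun x => h x * u x - g x * (V1 x * u x))); last first.
    by move=> x _; rewrite /f; ring.
  rewrite (RintegralB mR (iw _ _ (sqint_locsqint hi) tu) (iw _ _ gl tV)) -E.
  by move: (Rintegral _ _ _) (Rintegral _ _ _) => p q; ring.
exists g0, g1; move: H; apply: (@filterS _ _ (ae_filter_ringOfSetsType mu)) => x H x0.
by rewrite -(H x0) addrCA subrr addr0.
Qed.

End WithCutoff.
End WeakRegularity.

(** * The closure of the minimal operator *)

Lemma error_scale_le (R : realType) (x y z : R) :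
  x <= y -> 80 * y < z -> 20 * x <= z / 4.
Proof. by lra. Qed.

(** Error budget of [cut_closr]. [Z] collects the local error [T1] and the tail [T2]; [Y] is the
    commutator, with [C] the term chi' u' and [X2], [X0], [X3] the Caccioppoli terms chi'' u, chi'
    u, chi' S u. These carry the small factor [m], the square of M / n. *)
Lemma cutoff_error_lt (R : realType) (W e Z Y T1 T2 C X2 X0 X3 nu ns m mp mh : R) :
  4 * W <= e / 4 -> 0 < e ->
  Z <= 2 * T1 + 2 * T2 -> Y <= 2 * (2 ^+ 2 * C) + 2 * X2 ->
  T1 <= W -> T2 <= W -> C <= 4 * X2 + X0 + X3 ->
  X2 <= nu -> X0 <= nu -> X3 <= ns ->
  nu <= m * 2 + 2 * mp -> ns <= m * 2 + 2 * mh -> 0 <= mp -> 0 <= mh -> 0 <= m ->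
  20 * (m * 12 + 10 * mp + 2 * mh) <= e / 4 ->
  2 * Z + 2 * Y < e.
Proof. by lra. Qed.

Section Closure.
Context {R : realType} (alpha : R) (k : int).
Hypothesis ha : 0 <= alpha < 1.
Local Notation mu := (@lebesgue_measure R).
Local Notation c := (alpha * (2 + alpha) / 4).
Local Notation S0 := (bessel_op alpha).
Local Notation V1 := (power_pot alpha k).
Local Notation varpar := (varpar alpha).
Local Notation open_itv N := (`]0, N[%classic : set (measurableTypeR R)).

#[local] Opaque Rintegral derive1 smooth_on.

Let a0 : 0 <= alpha. Proof. by case/andP: ha. Qed.
Let a1 : alpha < 1. Proof. by case/andP: ha. Qed.
Let mR := @measurable_Rpos R.
Let mI (N : R) : measurable (open_itv N). Proof. exact: measurable_itv. Qed.

Definition full_op (u : R -> R) (x : R) : R := S0 u x + V1 x * u x.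
Local Notation SS := full_op.

Lemma testpos_SS u : testpos u -> testpos (SS u).
Proof.
move=> tu; exact: (testposD (testpos_S0 alpha tu) (testposMr tu (@V1_smooth R alpha k))).
Qed.

(** The pair (phi, h) lies in the closure of the graph of the operator on real test functions. *)
Definition closr (phi h : R -> R) : Prop :=
  [/\ sqint Rpos phi, sqint Rpos h & forall e : R, 0 < e -> exists u,
   [/\ testpos u, nsq Rpos (fun x => u x - phi x) < e & nsq Rpos (fun x => SS u x - h x) < e]].

Lemma nsqC (D : set (measurableTypeR R)) f g :
  nsq D (fun x => f x - g x) = nsq D (fun x => g x - f x).
Proof. by rewrite -nsqN; apply: eq_nsq => x _; rewrite opprB. Qed.

Lemma nsq_bounded (D : set (measurableTypeR R)) (f g : R -> R) (M : R) : measurable D ->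
  measurable_fun D g -> (forall x, D x -> `|g x| <= M) -> sqint D f ->
  nsq D (fun x => g x * f x) <= M ^+ 2 * nsq D f.
Proof.
move=> mD mg gM fi; rewrite -(nsqZ M mD fi).
apply: nsq_le => //; first by apply: measurable_funM => //; case: fi.
  exact: sqintZ.
move=> x Dx; rewrite !normrM ler_wpM2r // (le_trans (gM x Dx)) //; exact: ler_norm.
Qed.

Lemma V1_measurable N : measurable_fun (open_itv N) V1.
Proof.
apply: measurable_funS (continuous_Rpos_measurable (cpos_smooth (@V1_smooth R alpha k))) => //.
exact: subset_itv_Rpos.
Qed.

Lemma nsq_V1 N f : locsqint f -> 0 < N ->
  nsq (open_itv N) (fun x => V1 x * f x) <= V1 N ^+ 2 * nsq (open_itv N) f.
Proof.
move=> fi N0; apply: nsq_bounded => //; [exact: V1_measurable| |exact: fi].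
by move=> x /=; rewrite in_itv /=; exact: V1_bound.
Qed.

Lemma nsq_itv_le N f : sqint Rpos f -> nsq (open_itv N) f <= nsq Rpos f.
Proof. by move=> fi; apply: nsqS => //; exact: subset_itv_Rpos. Qed.

Section WithCutoff.
Context (P : R -> R).
Hypotheses (sP : smooth P) (P1 : forall x : R, `|x| < 1 -> P x = 1)
  (P0 : forall x : R, 2 < `|x| -> P x = 0).

(** A test function satisfies u = varpar (S0 u) with S0 u = S u - V1 u. On each ]0, N[ both [varpar]
    and multiplication by [V1] are L^2 bounded, so the identity passes to the limit there; N then
    runs through the integers. *)
Lemma closr_varpar phi h : closr phi h ->
  {ae mu, forall x, Rpos x -> phi x = varpar (fun t => h t - V1 t * phi t) x}.
Proof.
move=> [pi hi H]; pose f t := h t - V1 t * phi t.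
have pl := sqint_locsqint pi; have hl := sqint_locsqint hi.
have fl : locsqint f.
  by move=> N N0; exact: (sqintB (mI N) (hl _ N0) (locsqint_V1 k ha pl N0)).
have Tl := varpar_locsqint ha sP P1 P0 fl.
have wl : locsqint (fun x => phi x - varpar f x).
  by move=> N N0; exact: (sqintB (mI N) (pl _ N0) (Tl _ N0)).
suff Hn (n : nat) : {ae mu, forall x, `]0%R, n.+1%:R[%classic x -> phi x - varpar f x = 0}.
  have := ae_foralln Hn; apply: (@filterS _ _ (ae_filter_ringOfSetsType mu)) => x Hx x0.
  have [n xn] : exists n : nat, x < n.+1%:R.
    by exists (Num.truncn x); rewrite truncnS_gt.
  by apply/eqP; rewrite -subr_eq0; apply/eqP; apply: (Hx n); rewrite /= in_itv /= x0 xn.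
set N : R := n.+1%:R; have N0 : 0 < N by rewrite ltr0n.
apply: (nsq_eq0 (mI N) (wl _ N0)).
set K := 4 / (1 - alpha) * N ^+ 4.
have K0 : 0 <= K by rewrite mulr_ge0 ?divr_ge0 ?exprn_ge0 ?subr_ge0 // ltW.
(* The 2 pays for phi - u; the rest pays for the difference of the [varpar] terms, as f - S0 u = (h
   - S u) - V1 (phi - u). *)
set A := 2 + 2 * (K * (2 + 2 * V1 N ^+ 2)).
have A0 : 0 <= A.
  by rewrite addr_ge0 // mulr_ge0 // mulr_ge0 // addr_ge0 // mulr_ge0 // sqr_ge0.
have A1 : 0 < A + 1 by rewrite ltr_wpDl.
apply/eqP; rewrite eq_le nsq_ge0 andbT; apply/ler_addgt0Pr => e e0; rewrite add0r.
have [u [tu up uh]] := H _ (divr_gt0 e0 A1).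
have ui := testpos_sqint tu; have ul := sqint_locsqint ui.
have tS := testpos_S0 alpha tu; have tSS := testpos_SS tu.
have Sl := sqint_locsqint (testpos_sqint tS).
have Tul := varpar_locsqint ha sP P1 P0 Sl.
have E x : `]0, N[%classic x -> phi x - varpar f x = (phi x - u x) - (varpar f x - varpar (S0 u) x).
  rewrite /= in_itv /= => /andP[x0 _].
  have [su [d [N' [d0 dN sup]]]] := tu.
  rewrite (varpar_S0 ha su d0) //; first by ring.
  by move=> y /andP[y0 yd]; apply: sup => //; left.
rewrite (eq_nsq E).
apply: le_trans (nsqB (mI N) (sqintB (mI N) (pl _ N0) (ul _ N0)) (sqintB (mI N) (Tl _ N0) (Tul _ N0))) _.
have c1 : nsq (open_itv N) (fun x => phi x - u x) <= e / (A + 1).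
  rewrite nsqC; apply: le_trans (nsq_itv_le N (sqintB mR ui pi)) _; exact: ltW.
have c2 := nsq_varpar_close ha sP P1 P0 N0 fl tS; rewrite -/K in c2.
have c3 : nsq (open_itv N) (fun x => f x - S0 u x) <= (2 + 2 * V1 N ^+ 2) * (e / (A + 1)).
  have E3 x : `]0, N[%classic x -> f x - S0 u x = (h x - SS u x) - V1 x * (phi x - u x).
    by move=> _; rewrite /f /SS; ring.
  rewrite (eq_nsq E3).
  have i1 : sqint (open_itv N) (fun x => h x - SS u x).
    exact: (sqintB (mI N) (hl _ N0) (sqint_locsqint (testpos_sqint tSS) N0)).
  have l2 : locsqint (fun x => phi x - u x).
    by move=> m m0; exact: (sqintB (mI m) (pl _ m0) (ul _ m0)).
  apply: le_trans (nsqB (mI N) i1 (locsqint_V1 k ha l2 N0)) _.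
  have d1 : nsq (open_itv N) (fun x => h x - SS u x) <= e / (A + 1).
    rewrite nsqC; apply: le_trans (nsq_itv_le N (sqintB mR (testpos_sqint tSS) hi)) _; exact: ltW.
  have d2 := nsq_V1 l2 N0.
  have d3 := ler_wpM2l (sqr_ge0 (V1 N)) c1.
  move: (nsq _ _) (nsq _ _) (nsq _ _) d1 d2 d3 => p q r d1 d2 d3.
  by move: (e / _) d1 d2 d3 => w d1 d2 d3; nra.
have c4 := ler_wpM2l K0 c3.
have -> : e = (A + 1) * (e / (A + 1)) by rewrite mulrC divfK // gt_eqF.
have w0 : 0 <= e / (A + 1) by rewrite divr_ge0 // ltW.
move: (nsq _ _) (nsq _ _) (nsq _ _) c1 c2 c3 c4 => p q r c1 c2 c3 c4.
rewrite {1}/A; move: (e / _) w0 c1 c2 c3 c4 => w w0 c1 c2 c3 c4; nra.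
Qed.

Lemma nsq_tail f : sqint Rpos f ->
  nsq Rpos (f \_ [set x : R | n%:R <= x]) @[n --> \oo] --> (0 : R).
Proof.
move=> fi; have [mf _] := fi.
have mS (n : nat) : measurable ([set x : R | n%:R <= x] : set (measurableTypeR R)).
  rewrite (_ : [set x : R | n%:R <= x] = `[n%:R, +oo[%classic); first exact: measurable_itv.
  by apply/seteqP; split => x /=; rewrite in_itv /= andbT.
have fni (n : nat) : sqint Rpos (f \_ [set x : R | n%:R <= x]).
  by apply: sqint_patch => //; apply: sqintS fi => //; exact: measurableI.
have h := @nsq_dominated R Rpos (fun n => f \_ [set x : R | n%:R <= x]) (fun=> 0) (fun x => `|f x|) mR
  (fun n => proj1 (fni n)) (measurable_cst _).
rewrite (_ : (fun n => nsq Rpos (f \_ [set x : R | n%:R <= x])) =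
   (fun n => nsq Rpos (fun x => (f \_ [set x : R | n%:R <= x]) x - 0))); last first.
  by apply/funext => n; apply: eq_nsq => x _; rewrite subr0.
apply: h.
- move=> x x0; apply: cvg_near_cst; near=> n; rewrite patchE.
  case: ifPn => //; rewrite inE /= leNgt => /negP nx; exfalso; apply: nx.
  by near: n; exact: nbhs_infty_gtr.
- by move=> n x x0; rewrite patchE; case: ifPn => _; rewrite ?normr0.
- apply: (sqint_le mR _ fi); first exact: measurableT_comp.
  by move=> x _; rewrite normr_id.
Unshelve. all: by end_near. Qed.

(** The derivative of eta^2 u u' integrates to 0, and adding twice it to the right-hand integrand
    makes the inequality pointwise, since the total potential is nonnegative. Only [eta] is
    compactly supported; it will be the derivative of a cutoff. *)
Lemma caccioppoli eta u : testpos eta -> smooth_on Rpos u ->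
  nsq Rpos (fun x => eta x * derive1 u x) <=
  4 * nsq Rpos (fun x => derive1 eta x * u x) + nsq Rpos (fun x => eta x * u x) +
  nsq Rpos (fun x => eta x * SS u x).
Proof.
move=> te su; have [se ce] := te.
have su1 := smooth_on_derive1 su; have su2 := smooth_on_derive1 su1.
have te1 := testpos_derive1 te.
have sSS : smooth_on Rpos (SS u).
  apply: (@smooth_on_eq _ _ (fun x => (- derive1 (derive1 u) x + c * x `^ (- 2%:R) * u x) + V1 x * u x)).
  - exact: open_Rpos.
  - by move=> x x0; rewrite /SS /bessel_op powR_invn // ltW.
  - exact: (sposD (sposD (sposN su2) (sposM (sposZ _ (smooth_on_powR _)) su))
       (sposM (@V1_smooth R alpha k) su)).
have t1 := testposMl te su1; have t2 := testposMl te1 su; have t3 := testposMl te su.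
have t4 := testposMl te sSS.
pose G x := (eta x * eta x) * (u x * derive1 u x).
pose g x := (eta x * derive1 eta x + eta x * derive1 eta x) * (u x * derive1 u x) +
   (eta x * eta x) * (u x * derive1 (derive1 u) x + derive1 u x * derive1 u x).
have tG : testpos G by exact: (testposMl (testposMl te se) (sposM su su1)).
have sg : smooth_on Rpos g.
  have sed := sposM se (smooth_on_derive1 se).
  exact: (sposD (sposM (sposD sed sed) (sposM su su1))
                (sposM (sposM se se) (sposD (sposM su su2) (sposM su1 su1)))).
have dG (y : R) : 0 < y -> is_derive y 1 G (g y).
  move=> y0; have de := smooth_on_is_derive se y0; have du := smooth_on_is_derive su y0.
  have du1 := smooth_on_is_derive su1 y0.
  apply: is_derive_eq; rewrite -![_ *: _]/(_ * _) /g.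
  move: (derive1 (derive1 u) y) (derive1 u y) (derive1 eta y) (u y) (eta y) => *; ring.
have I0 := Rintegral_derive_eq0 dG (cpos_smooth sg) (proj2 tG).
have cg : cptpos g.
  by apply: cptpos_imp ce _ => x x0 H; rewrite /g H !mul0r !addr0 mul0r.
have ig := cptpos_integrable (cpos_smooth sg) cg.
have i1 := sqint_integrable mR (testpos_sqint t1).
have i2 := sqint_integrable mR (testpos_sqint t2).
have i3 := sqint_integrable mR (testpos_sqint t3).
have i4 := sqint_integrable mR (testpos_sqint t4).
have j1 : mu.-integrable Rpos (EFin \o (fun x => 2 * g x)) by exact: (integrableZl mR 2 ig).
have j2 : mu.-integrable Rpos (EFin \o (fun x => 4 * (derive1 eta x * u x) ^+ 2)).
  exact: (integrableZl mR 4 i2).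
have j3 : mu.-integrable Rpos (EFin \o (fun x => 2 * g x + 4 * (derive1 eta x * u x) ^+ 2)).
  exact: (integrableD mR j1 j2).
have j4 : mu.-integrable Rpos (EFin \o (fun x => 2 * g x + 4 * (derive1 eta x * u x) ^+ 2
    + (eta x * u x) ^+ 2)).
  exact: (integrableD mR j3 i3).
have j5 : mu.-integrable Rpos (EFin \o (fun x => 2 * g x + 4 * (derive1 eta x * u x) ^+ 2
    + (eta x * u x) ^+ 2 + (eta x * SS u x) ^+ 2)).
  exact: (integrableD mR j4 i4).
rewrite [leRHS](_ : _ = \int[mu]_(x in Rpos) (2 * g x + 4 * (derive1 eta x * u x) ^+ 2
    + (eta x * u x) ^+ 2 + (eta x * SS u x) ^+ 2)); last first.
  rewrite (RintegralD mR j4 i4) (RintegralD mR j3 i3) (RintegralD mR j1 j2).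
  by rewrite (RintegralZl 2 mR ig) (RintegralZl 4 mR i2) I0 mulr0 add0r.
apply: (le_Rintegral mR i1 j5) => x x0.
rewrite /g /SS /bessel_op.
have W0 : 0 <= c / x ^+ 2 + V1 x.
  by rewrite addr_ge0 ?V1_ge0 // divr_ge0 ?sqr_ge0 // divr_ge0 // mulr_ge0 // addr_ge0.
move: (derive1 (derive1 u) x) (derive1 u x) (derive1 eta x) (u x) (eta x) => u2 u1 e1 y e.
rewrite (_ : - u2 + c / x ^+ 2 * y + V1 x * y = - u2 + (c / x ^+ 2 + V1 x) * y); last by ring.
move: (c / x ^+ 2 + V1 x) W0 => W W0.
have h1 := sqr_ge0 (e * u1 + 2 * e1 * y).
have h2 := sqr_ge0 (e * y - e * (- u2 + W * y)).
have h3 : 0 <= W * (e * y) ^+ 2 by rewrite mulr_ge0 // sqr_ge0.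
rewrite -subr_ge0.
(* Here [W] is the total potential: the difference of the two integrands is a sum of squares plus 2
   W (eta u)^2. *)
rewrite (_ : _ - _ = (e * u1 + 2 * e1 * y) ^+ 2 + (e * y - e * (- u2 + W * y)) ^+ 2
  + 2 * (W * (e * y) ^+ 2)); last by ring.
by rewrite addr_ge0 // ?addr_ge0 // mulr_ge0.
Qed.

(* The cutoff is [P (x / n)]. *)
Lemma scaled_cutoff : exists2 M : R, 0 <= M & forall n : R, 1 <= n ->
  exists chi : R -> R, [/\ smooth_on Rpos chi, testpos (derive1 chi),
    (forall x : R, 0 < x < n -> chi x = 1) & (forall x : R, 2 * n < x -> chi x = 0)] /\
    forall x : R, 0 < x -> [/\ `|chi x| <= M, `|derive1 chi x| <= M / n &
                               `|derive1 (derive1 chi) x| <= M / n].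
Proof.
have sPT : smooth_on setT P by exact/smooth_onT.
have sP' := smooth_P sP; have sP1 := smooth_on_derive1 sP'; have sP2 := smooth_on_derive1 sP1.
have cP1 : cptpos (derive1 P).
  exists 1, 2; split; [exact: ltr01|by rewrite ltr1n|move=> x x0 [xl|xg]].
    have oU : open ([set x : R | 0 < x] `&` [set x : R | x < 1]).
      by apply: openI; [exact: open_gt|exact: open_lt].
    rewrite (@derive1_eq_on _ _ P (cst 1) oU _ x) //.
      by rewrite derive1E; exact: derive_cst.
    by move=> y [y0 y1]; rewrite P1 // gtr0_norm.
  rewrite (@derive1_eq_on _ _ P (cst 0) (@open_gt _ 2) _ x) //.
    by rewrite derive1E; exact: derive_cst.
  by move=> y /= y2; rewrite P0 // gtr0_norm // (lt_trans _ y2).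
have cP2 := cptpos_derive1 cP1.
have h3 : 2^-1 <= 3 :> R by lra.
have h2 : 0 < 2^-1 :> R by rewrite invr_gt0.
have [M0 hM0] : exists M, forall x : R, 0 < x -> `|P x| <= M.
  have [M HM] := continuous_Rpos_bounded h2 h3 (cpos_smooth sP').
  exists (`|M| + 1) => x x0; have [x1|x1] := ltP x 2^-1.
    by rewrite P1 ?normr1 ?lerDr // gtr0_norm //; lra.
  have [x6|x6] := leP x 3.
    by apply: le_trans (HM x _) _; [lra|rewrite (le_trans (ler_norm _)) // lerDl].
  by rewrite P0 ?normr0 ?addr_ge0 // gtr0_norm //; lra.
have bnd (f : R -> R) : smooth_on Rpos f -> cptpos f -> exists M, forall x : R, 0 < x -> `|f x| <= M.
  move=> sf cf; have [d [N [M [d0 dN fM]]]] := cptpos_bound (cpos_smooth sf) cf.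
  exists `|M| => x x0; apply: le_trans (fM x x0) _; rewrite indicE.
  by case: (_ \in _); rewrite ?mulr1 ?mulr0 // ler_norm.
have [M1 hM1] := bnd _ sP1 cP1; have [M2 hM2] := bnd _ sP2 cP2.
pose M := `|M0| + `|M1| + `|M2|.
have MM : 0 <= M by rewrite !addr_ge0.
exists M => // n n1; have n0 : 0 < n by exact: lt_le_trans n1.
have ni0 : 0 < n^-1 by rewrite invr_gt0.
have ni1 : n^-1 <= 1 by rewrite invf_le1.
pose chi (x : R) := P (n^-1 * x + 0).
have pos (x : R) : 0 < x -> Rpos (n^-1 * x + 0) by move=> x0; rewrite /Rpos /= addr0 mulr_gt0.
have schi : smooth_on Rpos chi.
  exact: (@smooth_on_affine R Rpos Rpos n^-1 0 P open_Rpos pos sP').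
have d1 x : 0 < x -> derive1 chi x = n^-1 * derive1 P (n^-1 * x + 0).
  by move=> x0; rewrite derive1E; have [_ ->] := is_derive_affine sP' (pos x x0).
have d2 x : 0 < x -> derive1 (derive1 chi) x = n^-1 * (n^-1 * derive1 (derive1 P) (n^-1 * x + 0)).
  move=> x0; rewrite (@derive1_eq_on _ Rpos _ _ open_Rpos d1 x x0) derive1E.
  have h := is_derive_affine sP1 (pos x x0).
  by have [_ ->] := is_deriveZ n^-1 h.
have chi1 x : 0 < x < n -> chi x = 1.
  move=> /andP[x0 xn]; rewrite /chi P1 // addr0 ger0_norm; last by rewrite mulr_ge0 // ltW.
  by rewrite mulrC ltr_pdivrMr // mul1r.
have chi0 x : 2 * n < x -> chi x = 0.
  move=> nx; rewrite /chi P0 // addr0 ltr_normr; apply/orP; left.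
  by rewrite mulrC ltr_pdivlMr.
exists chi; split.
  split; [exact: schi| |exact: chi1|exact: chi0].
  split; first exact: (smooth_on_derive1 schi).
  exists n, (2 * n); split; [exact: n0|by lra|].
  move=> x x0 [xn|nx].
    have oU : open ([set x : R | 0 < x] `&` [set x : R | x < n]).
      by apply: openI; [exact: open_gt|exact: open_lt].
    rewrite (@derive1_eq_on _ _ chi (cst 1) oU _ x) //.
      by rewrite derive1E; exact: derive_cst.
    by move=> y [y0 y1]; rewrite chi1 // y0.
  rewrite (@derive1_eq_on _ _ chi (cst 0) (@open_gt _ (2 * n)) _ x) //.
  by rewrite derive1E; exact: derive_cst.
move=> x x0; split.
- apply: le_trans (hM0 _ (pos _ x0)) _; apply: le_trans (ler_norm _) _.
  by rewrite /M -addrA lerDl addr_ge0.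
- rewrite d1 // normrM (gtr0_norm ni0) mulrC ler_wpM2r ?(ltW ni0) //.
  apply: le_trans (hM1 _ (pos _ x0)) _; apply: le_trans (ler_norm _) _.
  by have := normr_ge0 M0; have := normr_ge0 M2; rewrite /M; lra.
- rewrite d2 // !normrM (gtr0_norm ni0) mulrC ler_wpM2r ?(ltW ni0) //.
  (* The second factor 1/n is given away, so that the one rate M / n serves both derivatives. *)
  apply: (@le_trans _ _ (1 * M)); last by rewrite mul1r.
  apply: ler_pM => //; first exact: ltW.
  apply: le_trans (hM2 _ (pos _ x0)) _; apply: le_trans (ler_norm _) _.
  by rewrite /M lerDr addr_ge0.
Qed.


Lemma nsq_supp N f : 0 < N -> (forall x, N <= x -> f x = 0) ->
  nsq Rpos f = nsq (open_itv N) f.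
Proof.
by move=> N0 f0; apply: Rintegral_Rpos_itv => // x /f0 ->; rewrite expr0n.
Qed.

Lemma SS_mul chi u x : smooth_on Rpos chi -> smooth_on Rpos u -> 0 < x ->
  SS (fun t => chi t * u t) x = chi x * SS u x
    - (2 * (derive1 chi x * derive1 u x) + derive1 (derive1 chi) x * u x).
Proof.
move=> sc su x0.
have E1 (f g : R -> R) y : smooth_on Rpos f -> smooth_on Rpos g -> 0 < y ->
    derive1 (fun t => f t * g t) y = f y * derive1 g y + g y * derive1 f y.
  move=> sf sg y0; have df := smooth_on_is_derive sf y0.
  have dg := smooth_on_is_derive sg y0.
  by rewrite derive1E; have [_ ->] := is_deriveM df dg.
have sc1 := smooth_on_derive1 sc; have su1 := smooth_on_derive1 su.
have E2 : derive1 (derive1 (fun t => chi t * u t)) x =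
    (chi x * derive1 (derive1 u) x + derive1 u x * derive1 chi x) +
    (u x * derive1 (derive1 chi) x + derive1 chi x * derive1 u x).
  rewrite (@derive1_eq_on _ Rpos _ (fun t => chi t * derive1 u t + u t * derive1 chi t) open_Rpos _ x x0); last first.
    by move=> y y0; exact: (E1 _ _ _ sc su y0).
  have d1 := is_deriveM (smooth_on_is_derive sc x0) (smooth_on_is_derive su1 x0).
  have d2 := is_deriveM (smooth_on_is_derive su x0) (smooth_on_is_derive sc1 x0).
  by rewrite derive1E; have [_ E] := is_deriveD d1 d2; exact: E.
rewrite /SS /bessel_op E2.
move: (derive1 (derive1 u) x) (derive1 u x) (derive1 (derive1 chi) x) (derive1 chi x).
by move: (u x) (chi x) (V1 x) => *; ring.
Qed.

(** Reduces membership in the closure to approximation on bounded intervals. Multiplying by chi(x /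
    n) creates the commutator 2 chi' u' + chi'' u; nothing is assumed on u', so the Caccioppoli
    inequality with eta = chi' bounds it by u and S u on ]0, N[. *)
Lemma cut_closr phi h : sqint Rpos phi -> sqint Rpos h ->
  (forall N e : R, 0 < N -> 0 < e -> exists u (d : R), [/\ 0 < d, smooth_on Rpos u,
     (forall x, 0 < x < d -> u x = 0), nsq (open_itv N) (fun x => u x - phi x) < e &
     nsq (open_itv N) (fun x => SS u x - h x) < e]) ->
  closr phi h.
Proof.
move=> pi hi H; split=> // e e0.
have [M M0 HM] := scaled_cutoff.
set Bp := nsq Rpos phi; set Bh := nsq Rpos h.
have Bp0 : 0 <= Bp by exact: nsq_ge0.
have Bh0 : 0 <= Bh by exact: nsq_ge0.
(* The commutator contributes at most 84 (2 + 2 Bp) + 16 (2 + 2 Bh) times (M / n)^2 to the error,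
   where 2 + 2 Bp and 2 + 2 Bh bound [u] and [SS u]; 20 Q dominates this. *)
pose Q := 12 + 10 * Bp + 2 * Bh.
have Q0 : 0 < Q by rewrite /Q; lra.
(* Local and tail errors carry at most (1 + M)^2 each, since |chi| <= M and |1 - chi| <= 1 + M; with
   2 p^2 + 2 q^2 this makes 4 (1 + M)^2. *)
pose L := 4 * (1 + M) ^+ 2.
have L0 : 0 <= L by rewrite mulr_ge0 // sqr_ge0.
pose w := e / (4 * (L + 1)).
have w0 : 0 < w by rewrite divr_gt0 // mulr_gt0 //; lra.
have wE : (L + 1) * w = e / 4 by rewrite /w; field; rewrite gt_eqF //; lra.
have Lw : L * w <= e / 4 by lra.
have [n [n1 [tp [th nQ]]]] : exists n : nat, 1 <= n%:R :> R /\
    (nsq Rpos (phi \_ [set x : R | n%:R <= x]) < w /\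
    (nsq Rpos (h \_ [set x : R | n%:R <= x]) < w /\ 80 * M ^+ 2 * Q / e < n%:R)).
  have /cvgrPdist_lt /(_ w w0) c1 := nsq_tail pi.
  have /cvgrPdist_lt /(_ w w0) c2 := nsq_tail hi.
  have c3 : \forall n \near \oo, 80 * M ^+ 2 * Q / e < n%:R by exact: nbhs_infty_gtr.
  have c4 : \forall n \near \oo, 1 < n%:R :> R by exact: nbhs_infty_gtr.
  have [n [[h1 h2] [h3 h4]]] := filter_ex (filterI (filterI c1 c2) (filterI c3 c4)).
  exists n; split; first exact: ltW.
  by move: h1 h2; rewrite !sub0r !normrN !ger0_norm ?nsq_ge0.
have n0 : 0 < n%:R :> R by lra.
(* Past 2 n, so that chi and its derivatives vanish from N on and all norms live on ]0, N[. *)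
pose N : R := 3 * n%:R; have N0 : 0 < N by rewrite mulr_gt0.
(* The bound 1 controls the norms of [u] and [SS u] by those of [phi] and [h]; the bound [w] is for
   the error itself. *)
pose e1 := Num.min 1 w; have e10 : 0 < e1 by rewrite lt_min ltr01.
have [u [d [d0 su ud up uh]]] := H _ _ N0 e10.
have [chi [[schi tchi1 chi1 chi0] chiM]] := HM _ n1.
have tv : testpos (fun x => chi x * u x).
  split; first exact: sposM.
  exists (Num.min d n%:R), N; split.
  - by rewrite lt_min d0.
  - by rewrite gt_min; apply/orP; right; rewrite /N; lra.
  move=> x x0 [|Nx]; first by rewrite lt_min => /andP[xd _]; rewrite ud ?mulr0 // x0.
  by rewrite chi0 ?mul0r //; move: Nx; rewrite /N; lra.
have chis := cpos_smooth schi.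
have mchi : measurable_fun (Rpos : set (measurableTypeR R)) chi by exact: continuous_Rpos_measurable.
have chiM0 x : Rpos x -> `|chi x| <= M by move=> /chiM[].
have sSS : smooth_on Rpos (SS u).
  apply: (@smooth_on_eq _ _ (fun x => (- derive1 (derive1 u) x + c * x `^ (- 2%:R) * u x) + V1 x * u x)).
  - exact: open_Rpos.
  - by move=> x x0; rewrite /SS /bessel_op powR_invn // ltW.
  - exact: (sposD (sposD (sposN (smooth_on_derive1 (smooth_on_derive1 su)))
       (sposM (sposZ _ (smooth_on_powR _)) su)) (sposM (@V1_smooth R alpha k) su)).
have bddN f : cpos f -> (forall x, 0 < x < d -> f x = 0) -> sqint (open_itv N) f.
  move=> cf fd; have dN : d <= Num.max d N by rewrite le_max lexx.
  have [M' HM'] := continuous_Rpos_bounded d0 dN cf.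
  apply: (sqint_le (mI N) _ (sqint_cst N M')).
    apply: measurable_funS mR (@subset_itv_Rpos R N) _.
    exact: continuous_Rpos_measurable.
  move=> x /=; rewrite in_itv /= => /andP[x0 xN].
  have [xd|dx] := ltP x d; first by rewrite fd ?x0 // normr0.
  by apply: le_trans (HM' x _) (ler_norm _); rewrite dx le_max (ltW xN) orbT.
have ui : sqint (open_itv N) u by apply: bddN => //; exact: cpos_smooth.
have SSd x : 0 < x < d -> SS u x = 0.
  move=> /andP[x0 xd].
  have oU : open ([set x : R | 0 < x] `&` [set x : R | x < d]).
    by apply: openI; [exact: open_gt|exact: open_lt].
  rewrite /SS ud ?x0 // mulr0 addr0; apply: (S0_eq0 alpha oU) => // y [y0 yd].
  by rewrite ud // y0.
have SSi : sqint (open_itv N) (SS u) by apply: bddN => //; exact: cpos_smooth.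
have pl := sqint_locsqint pi N0; have hl := sqint_locsqint hi N0.
have e1w : e1 <= w by rewrite ge_min lexx orbT.
have e11 : e1 <= 1 by rewrite ge_min lexx.
have nu : nsq (open_itv N) u <= 2 + 2 * Bp.
  rewrite (eq_nsq (g := fun x => (u x - phi x) + phi x)); last by move=> x _; rewrite subrK.
  apply: le_trans (nsqD (mI N) (sqintB (mI N) ui pl) pl) _.
  by have := nsq_itv_le N pi; rewrite -/Bp; lra.
have nSS : nsq (open_itv N) (SS u) <= 2 + 2 * Bh.
  rewrite (eq_nsq (g := fun x => (SS u x - h x) + h x)); last by move=> x _; rewrite subrK.
  apply: le_trans (nsqD (mI N) (sqintB (mI N) SSi hl) hl) _.
  by have := nsq_itv_le N hi; rewrite -/Bh; lra.
have cN x : N <= x -> chi x = 0.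
  by move=> Nx; apply: chi0; apply: lt_le_trans Nx; rewrite /N; lra.
have oN2 : open [set x : R | 2 * n%:R < x] by exact: open_gt.
have dcN x : N <= x -> derive1 chi x = 0.
  move=> Nx; rewrite (@derive1_eq_on _ _ chi (cst 0) oN2 _ x) //.
    by rewrite derive1E; exact: derive_cst.
  by apply: lt_le_trans Nx; rewrite /N; lra.
have ddcN x : N <= x -> derive1 (derive1 chi) x = 0.
  move=> Nx; rewrite (@derive1_eq_on _ _ (derive1 chi) (cst 0) oN2 _ x) //.
  - by rewrite derive1E; exact: derive_cst.
  - move=> y /= y2; rewrite (@derive1_eq_on _ _ chi (cst 0) oN2 _ y) //.
    by rewrite derive1E; exact: derive_cst.
  - by apply: lt_le_trans Nx; rewrite /N; lra.
have IR := @subset_itv_Rpos R N.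
have Mn0 : 0 <= M / n%:R by rewrite divr_ge0 // ltW.
have mulN f g m : smooth_on Rpos g -> (forall x, Rpos x -> `|g x| <= m) ->
    (forall x, N <= x -> g x = 0) -> sqint (open_itv N) f ->
    nsq Rpos (fun x => g x * f x) <= m ^+ 2 * nsq (open_itv N) f.
  move=> sg gm gN fi; rewrite (@nsq_supp N) //; last by move=> x /gN ->; rewrite mul0r.
  apply: nsq_bounded => //.
    apply: measurable_funS mR IR _.
    exact: continuous_Rpos_measurable (cpos_smooth sg).
  by move=> x /IR; exact: gm.
have schi1 := smooth_on_derive1 schi; have schi2 := smooth_on_derive1 schi1.
have b1 x : Rpos x -> `|derive1 chi x| <= M / n%:R by move=> /chiM[].
have b2 x : Rpos x -> `|derive1 (derive1 chi) x| <= M / n%:R by move=> /chiM[].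
have tail f : sqint Rpos f -> sqint Rpos (fun x => (1 - chi x) * f x) /\
    nsq Rpos (fun x => (1 - chi x) * f x) <= (1 + M) ^+ 2 * nsq Rpos (f \_ [set x : R | n%:R <= x]).
  move=> fi.
  have m1 : measurable_fun (Rpos : set (measurableTypeR R)) (fun x => 1 - chi x).
    by apply: measurable_funB.
  have bm x : Rpos x -> `|1 - chi x| <= 1 + M.
    by move=> x0; apply: le_trans (ler_normB _ _) _; rewrite normr1 lerD2l chiM0.
  split; first exact: (sqint_bounded mR m1 bm).
  have mS : measurable ([set x : R | n%:R <= x] : set (measurableTypeR R)).
    rewrite (_ : [set x : R | n%:R <= x] = `[n%:R, +oo[%classic); first exact: measurable_itv.
    by apply/seteqP; split => x /=; rewrite in_itv /= andbT.
  have fni : sqint Rpos (f \_ [set x : R | n%:R <= x]).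
    by apply: sqint_patch => //; apply: sqintS fi => //; exact: measurableI.
  rewrite (eq_nsq (g := fun x => (1 - chi x) * (f \_ [set x : R | n%:R <= x]) x)).
    exact: (nsq_bounded mR m1 bm).
  move=> x x0; rewrite patchE; case: ifPn => //; rewrite notin_setE /= => /negP.
  by rewrite -ltNge => xn; rewrite chi1 ?subrr ?mul0r // x0.
have [tpi tpn] := tail _ pi; have [thi thn] := tail _ hi.
have cphi : sqint Rpos (fun x => chi x * phi x) by exact: (sqint_bounded mR mchi chiM0).
have ch : sqint Rpos (fun x => chi x * h x) by exact: (sqint_bounded mR mchi chiM0).
have cui := testpos_sqint tv.
have L4 : L = 4 * (1 + M) ^+ 2 by [].
have M1 : M ^+ 2 <= (1 + M) ^+ 2 by nra.
pose W := (1 + M) ^+ 2 * w.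
have W4 : L * w = 4 * W by rewrite /L /W mulrA.
have W0 : 0 <= W by rewrite mulr_ge0 ?sqr_ge0 // ltW.
have MW s : 0 <= s -> s <= e1 -> M ^+ 2 * s <= W.
  move=> s0 s1; apply: ler_pM => //; first exact: sqr_ge0.
  exact: le_trans s1 e1w.
exists (fun x => chi x * u x); split; first exact: tv.
  have i1 : sqint Rpos (fun x => chi x * (u x - phi x)).
    by apply: (eq_sqint mR _ (sqintB mR cui cphi)) => x _; rewrite mulrBr.
  rewrite (eq_nsq (g := fun x => chi x * (u x - phi x) - (1 - chi x) * phi x)); last by move=> x _; ring.
  apply: le_lt_trans (nsqB mR i1 tpi) _.
  have k1 := le_trans (mulN _ _ _ schi chiM0 cN (sqintB (mI N) ui pl)) (MW _ (nsq_ge0 _ _) (ltW up)).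
  have k2 := le_trans tpn (ler_wpM2l (sqr_ge0 (1 + M)) (ltW tp)).
  rewrite -/W in k2; lra.
have i1 : sqint Rpos (fun x => chi x * (SS u x - h x)).
  have tcS : testpos (fun x => chi x * SS u x).
    split; first exact: (sposM schi sSS).
    exists (Num.min d n%:R), N; split.
    - by rewrite lt_min d0.
    - by rewrite gt_min; apply/orP; right; rewrite /N; lra.
    move=> x x0 [|Nx]; first by rewrite lt_min => /andP[xd _]; rewrite SSd ?mulr0 // x0.
    by rewrite chi0 ?mul0r //; move: Nx; rewrite /N; lra.
  by apply: (eq_sqint mR _ (sqintB mR (testpos_sqint tcS) ch)) => x _; rewrite mulrBr.
have tu1 : testpos (fun x => derive1 chi x * derive1 u x).
  exact: (testposMl tchi1 (smooth_on_derive1 su)).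
have tu2 : testpos (fun x => derive1 (derive1 chi) x * u x).
  exact: (testposMl (testpos_derive1 tchi1) su).
have j1 := testpos_sqint tu1; have j2 := testpos_sqint tu2.
have j12 : sqint Rpos (fun x => 2 * (derive1 chi x * derive1 u x) + derive1 (derive1 chi) x * u x).
  exact: (sqintD mR (sqintZ 2 mR j1) j2).
rewrite (eq_nsq (g := fun x => (chi x * (SS u x - h x) - (1 - chi x) * h x) -
   (2 * (derive1 chi x * derive1 u x) + derive1 (derive1 chi) x * u x))); last first.
  move=> x x0; rewrite (SS_mul schi su x0).
  by move: (derive1 chi x * _) (derive1 (derive1 chi) x * _) (SS u x) => *; ring.
apply: le_lt_trans (nsqB mR (sqintB mR i1 thi) j12) _.
have A1 := nsqB mR i1 thi.
have A2 := nsqD mR (sqintZ 2 mR j1) j2.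
rewrite (nsqZ 2 mR j1) in A2.
have k1 := le_trans (mulN _ _ _ schi chiM0 cN (sqintB (mI N) SSi hl)) (MW _ (nsq_ge0 _ _) (ltW uh)).
have k2 := le_trans thn (ler_wpM2l (sqr_ge0 (1 + M)) (ltW th)); rewrite -/W in k2.
have C := caccioppoli tchi1 su.
have m1 := mulN _ _ _ schi2 b2 ddcN ui.
have m2 := mulN _ _ _ schi1 b1 dcN ui.
have m3 := mulN _ _ _ schi1 b1 dcN SSi.
pose m := (M / n%:R) ^+ 2; rewrite -/m in m1 m2 m3.
have mp : 0 <= m by exact: sqr_ge0.
have mQ : 20 * (m * Q) <= e / 4.
  have mn : m <= M ^+ 2 / n%:R.
    rewrite /m expr_div_n ler_wpM2l ?sqr_ge0 // lef_pV2 ?posrE ?exprn_gt0 //.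
    by rewrite ler_eXnr.
  rewrite ler_pdivlMr // in mn; rewrite ltr_pdivrMr // in nQ.
  have hQ := ler_wpM2r (ltW Q0) mn.
  have hQ2 : 80 * (M ^+ 2 * Q) < n%:R * e by rewrite mulrA.
  rewrite -(ler_pM2l n0) (_ : n%:R * (20 * (m * Q)) = 20 * (m * n%:R * Q)); last by ring.
  rewrite (_ : n%:R * (e / 4) = n%:R * e / 4); last by rewrite mulrA.
  exact: error_scale_le hQ hQ2.
have q1 := ler_wpM2l mp nu; have q2 := ler_wpM2l mp nSS.
have qQ : m * Q = m * 12 + 10 * (m * Bp) + 2 * (m * Bh) by rewrite /Q; ring.
have mB : 0 <= m * Bp by rewrite mulr_ge0.
have mB' : 0 <= m * Bh by rewrite mulr_ge0.
rewrite mulrDr (mulrCA m 2 Bp) in q1; rewrite mulrDr (mulrCA m 2 Bh) in q2.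
rewrite qQ in mQ; rewrite W4 in Lw.
exact: cutoff_error_lt Lw e0 A1 A2 k1 k2 C m1 m2 m3 q1 q2 mB mB' mp mQ.
Qed.

End WithCutoff.
End Closure.

(** * The real decomposition on the half-line *)

Section HalfLine.
Context {R : realType} (alpha : R) (k : int).
Hypothesis ha : 0 <= alpha < 1.
Local Notation mu := (@lebesgue_measure R).
Local Notation a := (- (alpha / 2)).
Local Notation b := (1 + alpha / 2).
Local Notation c := (alpha * (2 + alpha) / 4).
Local Notation S0 := (bessel_op alpha).
Local Notation V1 := (power_pot alpha k).
Local Notation SS := (full_op alpha k).
Local Notation closr := (closr alpha k).
Local Notation varpar := (varpar alpha).
Local Notation open_itv N := (`]0, N[%classic : set (measurableTypeR R)).
Let a0 : 0 <= alpha. Proof. by case/andP: ha. Qed.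
Let a1 : alpha < 1. Proof. by case/andP: ha. Qed.
Let mR := @measurable_Rpos R.
Let mI (N : R) : measurable (open_itv N). Proof. exact: measurable_itv. Qed.
Lemma ae_imp (A B : R -> Prop) : (forall x, A x -> B x) ->
  {ae mu, forall x, A x} -> {ae mu, forall x, B x}.
Proof. by move=> AB; apply: (@filterS _ _ (ae_filter_ringOfSetsType mu)). Qed.

Lemma ae_and (A B : R -> Prop) :
  {ae mu, forall x, A x} -> {ae mu, forall x, B x} -> {ae mu, forall x, A x /\ B x}.
Proof. exact: (@filterI _ _ (ae_filter_ringOfSetsType mu)). Qed.

Lemma nsq_ae (D : set (measurableTypeR R)) f g : measurable D ->
  measurable_fun D f -> measurable_fun D g ->
  {ae mu, forall x, D x -> f x = g x} -> nsq D f = nsq D g.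
Proof.
move=> mD mf mg fg; rewrite /nsq /Rintegral; congr fine.
apply: ge0_ae_eq_integral => //.
- by apply/measurable_EFinP; exact: measurable_funX.
- by apply/measurable_EFinP; exact: measurable_funX.
- by move=> x _; rewrite lee_fin sqr_ge0.
- by move=> x _; rewrite lee_fin sqr_ge0.
by apply: ae_imp fg => x E Dx; rewrite E.
Qed.

#[local] Opaque Rintegral derive1 smooth_on.

Section WithCutoff.
Context (P : R -> R).
Hypotheses (sP : smooth P) (P1 : forall x : R, `|x| < 1 -> P x = 1)
  (P0 : forall x : R, 2 < `|x| -> P x = 0).

(** The converse of [closr_varpar]. For a test function v, S (varpar v) - h = (v - f) + V1 (varpar v
    - phi) with f = h - V1 phi, so on ]0, N[ both errors are controlled by the distance of v to
    f. *)
Lemma varpar_closr phi h : sqint Rpos phi -> sqint Rpos h ->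
  {ae mu, forall x, Rpos x -> phi x = varpar (fun t => h t - V1 t * phi t) x} ->
  closr phi h.
Proof.
move=> pi hi E; apply: (cut_closr ha sP P1 P0) => // N e N0 e0.
pose f t := h t - V1 t * phi t.
have pl := sqint_locsqint pi; have hl := sqint_locsqint hi.
have fl : locsqint f by move=> m m0; exact: (sqintB (mI m) (hl _ m0) (locsqint_V1 k ha pl m0)).
pose K := 4 / (1 - alpha) * N ^+ 4.
have K0 : 0 <= K by rewrite mulr_ge0 ?exprn_ge0 ?ltW // divr_gt0 // subr_gt0.
(* [K] serves the distance of [varpar v] to [phi], the other two terms that of its image to [h]; the
   sum serves both requirements. *)
pose A := K + 2 + 2 * (V1 N ^+ 2 * K).
have VK0 : 0 <= V1 N ^+ 2 * K by rewrite mulr_ge0 ?sqr_ge0.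
have A0 : 0 < A by rewrite /A; lra.
have d0 : 0 < e / A by rewrite divr_gt0.
have [v [tv vf]] := approximable_loc sP P1 P0 N0 fl d0.
have [sv [d [N' [dd0 dN sup]]]] := tv.
have v0 y : 0 < y < d -> v y = 0 by move=> /andP[y0 yd]; apply: sup => //; left.
have vl := sqint_locsqint (testpos_sqint tv).
have Tf := varpar_locsqint ha sP P1 P0 fl.
have Tv := varpar_locsqint ha sP P1 P0 vl.
have c2 := nsq_varpar_close ha sP P1 P0 N0 fl tv; rewrite -/K in c2.
have pE : nsq (open_itv N) (fun x => phi x - varpar v x) =
          nsq (open_itv N) (fun x => varpar f x - varpar v x).
  apply: nsq_ae => //.
  - by apply: measurable_funB; [case: (pl _ N0)|case: (Tv _ N0)].
  - by apply: measurable_funB; [case: (Tf _ N0)|case: (Tv _ N0)].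
  by apply: ae_imp E => x E /subset_itv_Rpos x0; rewrite E.
have eA : e = A * (e / A) by rewrite mulrC divfK // gt_eqF.
exists (varpar v), d; split; first exact: dd0.
- exact: (smooth_varpar tv).
- by move=> x /andP[x0 xd]; apply: (varpar_near0 alpha v0); rewrite x0 ltW.
- rewrite nsqC pE; apply: le_lt_trans c2 _.
  have := ler_wpM2l K0 (ltW vf).
  move: (nsq _ _) => p k1; apply: le_lt_trans k1 _; rewrite {2}eA ltr_pM2r // /A; lra.
rewrite (eq_nsq (g := fun x => (v x - f x) + V1 x * (varpar v x - phi x))); last first.
  move=> x /subset_itv_Rpos x0; rewrite /SS (S0_varpar ha dd0 (testpos_cpos tv) v0 x0) /f.
  by move: (varpar v x) => w; ring.
have l2 : locsqint (fun x => varpar v x - phi x).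
  by move=> m m0; exact: (sqintB (mI m) (Tv _ m0) (pl _ m0)).
apply: le_lt_trans (nsqD (mI N) (sqintB (mI N) (vl _ N0) (fl _ N0)) (locsqint_V1 k ha l2 N0)) _.
have d1 := nsq_V1 k ha l2 N0; rewrite (nsqC _ _ phi) pE in d1.
rewrite nsqC.
have d2 := ler_wpM2l (sqr_ge0 (V1 N)) c2.
have d3 := ler_wpM2l VK0 (ltW vf).
have d4 : 0 <= K * (e / A) by rewrite mulr_ge0 // ltW.
rewrite mulrA in d2.
have eE : e = K * (e / A) + 2 * (e / A) + 2 * (V1 N ^+ 2 * K * (e / A)).
  by rewrite {1}eA; move: (e / A) => w; rewrite /A; ring.
move: (e / A) vf d3 d4 eE => w vf d3 d4 eE.
move: (V1 N ^+ 2 * K) (V1 N ^+ 2 * nsq _ _) d1 d2 d3 eE => VK Vr d1 d2 d3 eE.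
lra.
Qed.

Lemma sqint_mulP f : locsqint f -> sqint Rpos (fun x => P x * f x).
Proof.
move=> fl.
have cP : cpos P by exact: (cpos_smooth (smooth_P sP)).
have [M HM] := continuous_Rpos_bounded (ltr01) (ler1n _ 3) cP.
have i3 : sqint (open_itv 3) (fun x => P x * f x).
  apply: (@sqint_bounded _ _ _ _ (Num.max 1 M)) => //; last exact: fl.
    apply: measurable_funS mR (@subset_itv_Rpos R 3) _.
    exact: continuous_Rpos_measurable.
  move=> x /=; rewrite in_itv /= => /andP[x0 x3]; rewrite le_max.
  have [x1|x1] := ltP x 1; first by rewrite P1 ?normr1 ?lexx // gtr0_norm.
  by rewrite HM ?orbT // x1 ltW.
apply: (eq_sqint mR (f := (fun x => P x * f x) \_ `]0, 3[%classic)).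
  move=> x x0; rewrite patchE; case: ifPn => //; rewrite notin_setE /= in_itv /= => /negP.
  rewrite negb_and -!leNgt => /orP[|x3]; first by rewrite leNgt x0.
  by rewrite P0 ?mul0r // gtr0_norm //; lra.
apply: sqint_patch => //.
have mRI : measurable (Rpos `&` `]0, 3[%classic : set (measurableTypeR R)) by exact: measurableI.
by apply: sqintS (mI 3) mRI _ i3 => x [].
Qed.

(* [phi = g - P E], with [E] in the kernel of [S0], solves the integral equation of
   [varpar_closr] because [varpar] inverts [S0] on [(1 - P) E], which vanishes near 0. *)
Lemma half_line g h : sqint Rpos g -> sqint Rpos h ->
  (forall u, testpos u -> \int[mu]_(x in Rpos) (g x * Sr alpha k u x) =
                          \int[mu]_(x in Rpos) (h x * u x)) ->
  exists (phi h' : R -> R) (g0 g1 : R), closr phi h' /\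
    forall x, Rpos x -> g x = phi x + (x `^ a * P x) * g0 + (x `^ b * P x) * g1.
Proof.
move=> gi hi gh.
have [g0 [g1 H]] := weak_regularity ha sP P1 P0 gi hi gh.
pose E x := g0 * x `^ a + g1 * x `^ b.
have la : locsqint (fun x : R => x `^ a) by move=> N N0; exact: sqint_a.
have lb : locsqint (fun x : R => x `^ b) by move=> N N0; exact: sqint_b.
have El : locsqint E.
  by move=> N N0; exact: (sqintD (mI N) (sqintZ g0 (mI N) (la _ N0)) (sqintZ g1 (mI N) (lb _ N0))).
have EP := sqint_mulP El.
have VEP := sqint_mulP (locsqint_V1 k ha El).
have ca : a * (a - 1) = c by field.
have cb : b * (b - 1) = c by field.
have sa : smooth_on Rpos (cut_power P a) by exact: smooth_cut_power.
have sb : smooth_on Rpos (cut_power P b) by exact: smooth_cut_power.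
have sUa := sposZ (- g0) sa; have sUb := sposZ (- g1) sb.
(* U = -(1 - P) E, so that phi = varpar f + (1 - P) E = varpar f - U for the right-hand side f of
   the equation for g. *)
pose U x := - g0 * cut_power P a x + - g1 * cut_power P b x.
have sU : smooth_on Rpos U by exact: (sposD sUa sUb).
have tSU : testpos (S0 U).
  apply: (testpos_eq (f := fun x => - g0 * S0 (cut_power P a) x + - g1 * S0 (cut_power P b) x)).
    by move=> x x0; rewrite -(S0Z alpha (- g0) sa x0) -(S0Z alpha (- g1) sb x0) (S0D alpha sUa sUb x0).
  by apply: testposD; apply: testposZ; exact: testpos_S0_cut.
pose phi x := g x - P x * E x.
(* The value of S phi: since S0 E = 0, S0 (P E) = -S0 ((1 - P) E) = S0 U. *)
pose h' x := h x - S0 U x - P x * (V1 x * E x).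
have pi : sqint Rpos phi by exact: (sqintB mR gi EP).
have hi' : sqint Rpos h' by exact: (sqintB mR (sqintB mR hi (testpos_sqint tSU)) VEP).
exists phi, h', g0, g1; split; last by move=> x x0; rewrite /phi /E; ring.
apply: varpar_closr => //; apply: ae_imp H => x Hx x0.
have gl := sqint_locsqint gi.
rewrite (@varpar_eq _ alpha _ (fun t => (h t - V1 t * g t) - S0 U t)); last first.
  by move=> t _; rewrite /h' /phi; move: (S0 U t) => w; ring.
rewrite varparB //; last 2 first.
- by apply: sqintB => //; [exact: sqint_locsqint|exact: locsqint_V1].
- exact: (sqint_locsqint (testpos_sqint tSU)).
rewrite (varpar_S0 ha sU ltr01) //; last first.
  by move=> y /andP[y0 y1]; rewrite /U /cut_power P1 ?gtr0_norm //; ring.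
by rewrite /phi {1}(Hx x0) /U /cut_power /E; ring.
Qed.

End WithCutoff.
End HalfLine.

(** * Boundary values *)

Section BoundaryValues.
Context {R : realType} (alpha : R) (k : int).
Hypothesis ha : 0 <= alpha < 1.
Local Notation mu := (@lebesgue_measure R).
Local Notation a := (- (alpha / 2)).
Local Notation b := (1 + alpha / 2).
Local Notation V1 := (power_pot alpha k).
Local Notation closr := (closr alpha k).
Local Notation open_itv N := (`]0, N[%classic : set (measurableTypeR R)).
Let a0 : 0 <= alpha. Proof. by case/andP: ha. Qed.
Let a1 : alpha < 1. Proof. by case/andP: ha. Qed.
Let mI (N : R) : measurable (open_itv N). Proof. exact: measurable_itv. Qed.

Definition rlim0 (D : set R) (f : R -> R) (l : R) : Prop :=
  forall e : R, 0 < e -> exists d : R, 0 < d /\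
    {ae mu, forall x, D x -> `|x| < d -> (f x - l) ^+ 2 < e}.

Lemma rlim0_powR (f : R -> R) (l K s : R) : 0 <= K -> 0 < s ->
  {ae mu, forall x, Rpos x -> x < 1 -> (f x - l) ^+ 2 <= K * x `^ s} -> rlim0 Rpos f l.
Proof.
move=> K0 s0 H e e0.
have K1 : 0 < K + 1 by lra.
have w0 : 0 < e / (K + 1) by rewrite divr_gt0.
exists (Num.min 1 ((e / (K + 1)) `^ s^-1)); split.
  by rewrite lt_min ltr01 powR_gt0.
apply: ae_imp H => x H x0; rewrite lt_min gtr0_norm // => /andP[x1 xd].
apply: le_lt_trans (H x0 x1) _.
have xs : x `^ s < e / (K + 1).
  have := gt0_ltr_powR s0 _ _ xd; rewrite !nnegrE -powRrM mulVf ?gt_eqF // powRr1; last exact: ltW.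
  by apply; rewrite ?powR_ge0 // ltW.
have eE : e = (K + 1) * (e / (K + 1)) by rewrite mulrC divfK // gt_eqF.
have k1 := ler_wpM2l K0 (ltW xs).
move: (e / (K + 1)) w0 eE k1 => w w0 -> k1; rewrite mulrDl mul1r; move: (K * _) (K * _) k1 => p q; lra.
Qed.

(** An interval ]0, d[ has positive measure, so it is not contained in the exceptional null set;
    this makes essential limits at 0 unique. *)
Lemma ae_exists (A : R -> Prop) (d : R) : 0 < d -> {ae mu, forall x, A x} ->
  exists x : R, 0 < x < d /\ A x.
Proof.
move=> d0 [N [mN N0 sub]]; apply: contrapT => H.
have : (mu `]0%R, d[%classic <= mu N)%E.
  apply: (le_measure mu); rewrite ?inE; [exact: measurable_itv|exact: mN|].
  move=> x /=; rewrite in_itv /= => xd; apply: sub => /= Ax; apply: H; by exists x.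
by rewrite N0 lebesgue_measure_itv /= lte_fin d0 sube0 lee_fin leNgt d0.
Qed.

Lemma rlim0_unique f l l' : rlim0 Rpos f l -> rlim0 Rpos f l' -> l = l'.
Proof.
move=> H H'; apply/eqP; apply: contrapT => /negP ll'.
(* With p = f - l and q = f - l' both below this tolerance in square, (l - l')^2 <= 2 p^2 + 2 q^2 <
   (l - l')^2. *)
have e0 : 0 < (l - l') ^+ 2 / 4 by rewrite divr_gt0 // exprn_even_gt0 //= subr_eq0.
have [d [d0 Hd]] := H _ e0; have [d' [d'0 Hd']] := H' _ e0.
have dd : 0 < Num.min d d' by rewrite lt_min d0.
have [x [/andP[x0 xd] [h1 h2]]] := ae_exists dd (ae_and Hd Hd').
move: xd; rewrite lt_min => /andP[xd xd'].
have k1 : (f x - l) ^+ 2 < (l - l') ^+ 2 / 4 by apply: h1 => //; rewrite gtr0_norm.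
have k2 : (f x - l') ^+ 2 < (l - l') ^+ 2 / 4 by apply: h2 => //; rewrite gtr0_norm.
have k3 : 0 <= ((f x - l) + (f x - l')) ^+ 2 by exact: sqr_ge0.
by clear -k1 k2 k3; nra.
Qed.

Section WithCutoff.
Context (P : R -> R).
Hypotheses (sP : smooth P) (P1 : forall x : R, `|x| < 1 -> P x = 1)
  (P0 : forall x : R, 2 < `|x| -> P x = 0).

Lemma closr_bound phi h : closr phi h -> exists2 C : R, 0 <= C &
  {ae mu, forall x, Rpos x -> x < 1 -> phi x ^+ 2 <= C * x ^+ 3}.
Proof.
move=> H; have [pi hi _] := H.
have pl := sqint_locsqint pi; have hl := sqint_locsqint hi.
have fl : locsqint (fun t => h t - V1 t * phi t).
  by move=> m m0; exact: (sqintB (mI m) (hl _ m0) (locsqint_V1 k ha pl m0)).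
have A0 : 0 <= 4 / (1 - alpha) by rewrite divr_ge0 // subr_ge0 ltW.
exists (4 / (1 - alpha) * nsq (open_itv 1) (fun t => h t - V1 t * phi t)).
  by rewrite mulr_ge0 ?nsq_ge0.
apply: ae_imp (closr_varpar ha sP P1 P0 H) => x E x0 x1; rewrite E //.
apply: le_trans (varpar_bound ha x0 (fl _ x0)) _.
rewrite mulrAC; apply: ler_wpM2r; first by rewrite exprn_ge0 // ltW.
apply: ler_wpM2l => //.
apply: (nsqS (mI 1) (mI x)) (fl _ ltr01) => y /=; rewrite !in_itv /= => /andP[-> yx] /=.
exact: lt_trans yx x1.
Qed.

(** Near 0, P = 1 and phi^2 <= C x^3. After multiplication by x^(alpha/2) both phi and the g1 term
    tend to 0; after multiplication by x^(-b) the square of the remainder is at most C x^(3 -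
    2b). *)
Lemma closr_lim phi h g (g0 g1 : R) : closr phi h ->
  {ae mu, forall x, Rpos x ->
     g x = phi x + (`|x| `^ a * P x) * g0 + (`|x| `^ b * P x) * g1} ->
  rlim0 Rpos (fun x => `|x| `^ (alpha / 2) * g x) g0 /\
  rlim0 Rpos (fun x => `|x| `^ (- b) * (g x - `|x| `^ a * g0)) g1.
Proof.
move=> H gE; have [C C0 HC] := closr_bound H.
have HH := ae_and gE HC.
have simp x : Rpos x -> x < 1 -> `|x| = x /\ P x = 1.
  by move=> x0 x1; rewrite P1 gtr0_norm.
split.
- apply: (@rlim0_powR _ _ (2 * C + 2 * g1 ^+ 2) 2) => //.
    by rewrite addr_ge0 // mulr_ge0 // sqr_ge0.
  apply: ae_imp HH => x [gx px] x0 x1; rewrite gx //.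
  have [-> ->] := simp _ x0 x1.
  have -> : x `^ (alpha / 2) * (phi x + x `^ a * 1 * g0 + x `^ b * 1 * g1) - g0 =
     x `^ (alpha / 2) * phi x + (x `^ (alpha / 2) * x `^ b) * g1.
    have e1 : x `^ (alpha / 2) * x `^ a = 1 by rewrite powRM_pos // subrr powRr0.
    by rewrite !mulr1 !mulrDr !mulrA e1; ring.
  have u0 : 0 <= x `^ (alpha / 2) by exact: powR_ge0.
  have u1 : x `^ (alpha / 2) <= 1.
    apply: le_trans (_ : 1 `^ (alpha / 2) <= _); last by rewrite powR1.
    by apply: ge0_ler_powR; rewrite ?nnegrE ?divr_ge0 // ltW.
  have eb : x `^ b = x * x `^ (alpha / 2) by rewrite -powRM_pos // powRr1 // ltW.
  have x00 : 0 < x by [].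
  rewrite eb (powR_mulrn 2); last exact: ltW.
  have pc := px x0 x1.
  move: (x `^ (alpha / 2)) u0 u1 pc => u u0 u1 pc.
  have u2 : u ^+ 2 <= 1 by rewrite expr_le1.
  have k1 : (u * phi x) ^+ 2 <= C * x ^+ 2.
    rewrite exprMn; apply: le_trans (ler_piMl (sqr_ge0 _) u2) _; apply: le_trans pc _.
    by rewrite ler_wpM2l // exprS ler_piMl ?sqr_ge0 // ltW.
  have k2 : ((u * (x * u)) * g1) ^+ 2 <= x ^+ 2 * g1 ^+ 2.
    rewrite exprMn ler_wpM2r ?sqr_ge0 // (_ : u * (x * u) = u ^+ 2 * x); last by ring.
    by rewrite exprMn ler_piMl ?sqr_ge0 // expr_le1 ?sqr_ge0.
  have k3 : (u * phi x + u * (x * u) * g1) ^+ 2 <= 2 * (u * phi x) ^+ 2 + 2 * (u * (x * u) * g1) ^+ 2.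
    have := sqr_ge0 (u * phi x - u * (x * u) * g1); move: (u * phi x) (u * (x * u) * g1) => p q; nra.
  by apply: le_trans k3 _; rewrite mulrDl; lra.
(* The exponent is 3 - 2 b = 1 - alpha, positive because alpha < 1. *)
- apply: (@rlim0_powR _ _ C (1 - alpha)) => //; first by rewrite subr_gt0.
  apply: ae_imp HH => x [gx px] x0 x1; rewrite gx //.
  have [-> ->] := simp _ x0 x1.
  have -> : x `^ (- b) * (phi x + x `^ a * 1 * g0 + x `^ b * 1 * g1 - x `^ a * g0) - g1 =
     x `^ (- b) * phi x.
    have e1 : x `^ (- b) * x `^ b = 1 by rewrite powRM_pos // addNr powRr0.
    rewrite (_ : phi x + _ + _ - _ = phi x + x `^ b * g1); last by ring.
    by rewrite mulrDr mulrA e1; ring.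
  rewrite exprMn.
  have -> : x `^ (1 - alpha) = (x `^ (- b)) ^+ 2 * x ^+ 3.
    rewrite -(powR_mulrn 3 (ltW x0)) -powR_mulrn ?powR_ge0 // -powRrM powRM_pos //.
    by congr (_ `^ _); field.
  by rewrite [leRHS]mulrCA; apply: ler_wpM2l; [exact: sqr_ge0|exact: px].
Qed.

(** By [closr_lim] the coefficients of either decomposition are the same limits of [g]; once they
    agree, so do the remainders. *)
Lemma decomposition_unique phi h phi' h' g (g0 g1 g0' g1' : R) : closr phi h -> closr phi' h' ->
  {ae mu, forall x, Rpos x ->
     g x = phi x + (`|x| `^ a * P x) * g0 + (`|x| `^ b * P x) * g1} ->
  {ae mu, forall x, Rpos x ->
     g x = phi' x + (`|x| `^ a * P x) * g0' + (`|x| `^ b * P x) * g1'} ->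
  [/\ {ae mu, forall x, Rpos x -> phi' x = phi x}, g0' = g0 & g1' = g1].
Proof.
move=> H H' E E'.
have [l0 l1] := closr_lim H E; have [l0' l1'] := closr_lim H' E'.
have e0 := rlim0_unique l0' l0; subst g0'.
have e1 := rlim0_unique l1' l1; subst g1'.
split => //; apply: ae_imp (ae_and E E') => x [Ex Ex'] x0.
by have := Ex' x0; rewrite Ex // => /addIr /addIr.
Qed.

End WithCutoff.
End BoundaryValues.

(** * A Rellich inequality *)

Section Rellich.
Context {R : realType} (alpha : R) (k : int).
Hypothesis ha : 0 <= alpha < 1.
Local Notation mu := (@lebesgue_measure R).
Local Notation c := (alpha * (2 + alpha) / 4).
Local Notation V1 := (power_pot alpha k).
Local Notation SS := (full_op alpha k).
Let a0 : 0 <= alpha. Proof. by case/andP: ha. Qed.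
Let a1 : alpha < 1. Proof. by case/andP: ha. Qed.
Let mR := @measurable_Rpos R.
#[local] Opaque Rintegral derive1 smooth_on.

(* With [y = 1/x], the bracket on the left is the derivative of
   [2 u'^2 y - (9/2 + 2c) u u' y^2 + (15/4 + c) u^2 y^3 - 2 V u u'] when [V = k^2 x^(2 s)]. *)
Lemma rellich_pointwise (C s V y u u1 u2 : R) : 0 <= C -> 0 <= V ->
  (3 / 4 - C) ^+ 2 * (y ^+ 2 * u) ^+ 2 + (V * u) ^+ 2 - 2 * s ^+ 2 * V * y ^+ 2 * u ^+ 2 +
  (2 * (2 * u1 * u2 * y - u1 ^+ 2 * y ^+ 2)
   - (9 / 2 + 2 * C) * (u1 ^+ 2 * y ^+ 2 + u * u2 * y ^+ 2 - 2 * u * u1 * y ^+ 3)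
   + (15 / 4 + C) * (2 * u * u1 * y ^+ 3 - 3 * u ^+ 2 * y ^+ 4)
   - 2 * (2 * s * V * y * u * u1 + V * u1 ^+ 2 + V * u * u2))
  <= (- u2 + C * y ^+ 2 * u + V * u) ^+ 2.
Proof.
move=> C0 V0; rewrite -subr_ge0.
(* The first two squares vanish for u = x^(3/2), the borderline power of the Rellich inequality, on
   which S0 acts as multiplication by (C - 3/4) x^(-2). *)
rewrite (_ : _ - _ = (u2 - 2 * u1 * y + 9 / 4 * u * y ^+ 2) ^+ 2
  + (5 / 2 + 2 * C) * (u1 * y - 3 / 2 * u * y ^+ 2) ^+ 2
  + 2 * V * (u1 + s * u * y) ^+ 2 + 2 * C * V * (y * u) ^+ 2); last by field.
have w0 : 0 <= 5 / 2 + 2 * C by rewrite addr_ge0 ?mulr_ge0.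
have p0 (D z : R) : 0 <= D -> 0 <= D * z ^+ 2 by move=> D0; exact: mulr_ge0 D0 (sqr_ge0 z).
by rewrite addr_ge0 ?p0 ?mulr_ge0 // addr_ge0 ?p0 ?mulr_ge0 // addr_ge0 ?p0 // sqr_ge0.
Qed.

Lemma is_derive_V1 (x : R) : 0 < x -> is_derive x 1 V1 (2 * alpha * V1 x * x `^ (-1)).
Proof.
move=> x0; apply: (@is_derive_eq_on _ Rpos (fun t => k%:~R ^+ 2 * t `^ (2 * alpha)) _ _ _ open_Rpos _ x0).
  by move=> t t0; rewrite /power_pot gtr0_norm.
have d := is_derive_powR_pos (2 * alpha) x0.
apply: is_derive_eq; rewrite -![_ *: _]/(_ * _) /power_pot gtr0_norm // powR_inv1 ?ltW //.
by ring.
Qed.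

(** The Rellich constant is the square of [kap]; c reaches 3/4 only at alpha = 1. *)
Let kap : R := 3 / 4 - c.
Let kap0 : 0 < kap.
Proof. rewrite /kap; have := a0; have := a1; nra. Qed.

Let q (t : R) : R := t `^ (-1).
Let sq : smooth_on Rpos q. Proof. exact: smooth_on_powR. Qed.

(** Integrate [rellich_pointwise], whose bracket is an exact derivative. The term 2 alpha^2 V1 u^2 /
    x^2 has the wrong sign; it is absorbed by half of the x^(-4) term and a multiple of u^2, which
    is why only half of kap^2 survives. *)
Lemma rellich : exists2 C : R, 0 <= C & forall u, testpos u ->
  nsq Rpos (fun x => V1 x * u x) + kap ^+ 2 / 2 * nsq Rpos (fun x => q x * q x * u x) <=
  nsq Rpos (SS u) + C * nsq Rpos u.
Proof.
pose M : R := 2 * alpha ^+ 2 * k%:~R ^+ 2.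
have M0 : 0 <= M by apply: mulr_ge0 (sqr_ge0 _); apply: mulr_ge0 (sqr_ge0 _).
have k20 : 0 < kap ^+ 2 by rewrite exprn_gt0.
(* From x^(2 alpha) <= 1 + x^2, the bad coefficient is at most M x^(-2) + M; then M y <= kap^2 y^2 /
   2 + M^2 / (2 kap^2) with y = x^(-2). *)
pose C : R := M + M ^+ 2 / (2 * kap ^+ 2).
have C0 : 0 <= C by rewrite addr_ge0 // divr_ge0 ?sqr_ge0 // mulr_ge0 // ltW.
exists C => // u tu; have [su _] := tu.
have tu1 := testpos_derive1 tu; have tu2 := testpos_derive1 tu1.
pose u1 : R -> R := derive1 u; pose u2 : R -> R := derive1 u1.
have tS := testpos_SS alpha k tu.
have sV := @V1_smooth R alpha k.
have tV : testpos (fun x => V1 x * u x) := testposMr tu sV.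
have tq : testpos (fun x => q x * q x * u x) := testposMr tu (sposM sq sq).
pose G (t : R) : R := 2 * (q t * (u1 t * u1 t)) - (9 / 2 + 2 * c) * ((q t * q t) * (u t * u1 t))
  + (15 / 4 + c) * ((q t * (q t * q t)) * (u t * u t)) - 2 * (V1 t * (u t * u1 t)).
pose g (t : R) : R := 2 * (2 * u1 t * u2 t * q t - u1 t ^+ 2 * q t ^+ 2)
   - (9 / 2 + 2 * c) * (u1 t ^+ 2 * q t ^+ 2 + u t * u2 t * q t ^+ 2 - 2 * u t * u1 t * q t ^+ 3)
   + (15 / 4 + c) * (2 * u t * u1 t * q t ^+ 3 - 3 * u t ^+ 2 * q t ^+ 4)
   - 2 * (2 * alpha * V1 t * q t * u t * u1 t + V1 t * u1 t ^+ 2 + V1 t * u t * u2 t).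
have GD (t : R) : 0 < t -> is_derive t 1 G (g t).
  move=> t0; have du := testpos_is_derive tu t0; have du1 := testpos_is_derive tu1 t0.
  have dV := is_derive_V1 t0.
  have dq : is_derive t 1 q (- (q t * q t)).
    have := is_derive_powR_pos (-1) t0; rewrite -/(q t) mulN1r mulNr /q.
    by have -> : t^-1 = t `^ (-1) by rewrite powR_inv1 // ltW.
  rewrite -/u1 in du du1; rewrite -/u2 in du1; rewrite -/(q t) in dV.
  apply: is_derive_eq; rewrite -![_ *: _]/(_ * _) /g.
  by move: (u t) (u1 t) (u2 t) (q t) (V1 t) => *; ring.
have tuu : testpos (fun t => u t * u1 t) := testposMl tu (smooth_on_derive1 su).
have tG : testpos G.
  apply: testposB; last by apply: testposZ; exact: (testposMr tuu sV).
  apply: testposD; last first.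
    by apply: testposZ; apply: (testposMr _ (sposM sq (sposM sq sq))); exact: (testposMl tu su).
  apply: testposB; apply: testposZ; last exact: (testposMr tuu (sposM sq sq)).
  by apply: (testposMr _ sq); exact: (testposMl tu1 (smooth_on_derive1 su)).
have tg : testpos g.
  apply: (testpos_eq (f := derive1 G)); last exact: testpos_derive1.
  by move=> x x0; have [] := GD x x0; rewrite derive1E.
have I0 := Rintegral_derive_eq0 GD (testpos_cpos tg) (proj2 tG).
have ig : mu.-integrable Rpos (EFin \o g).
  by apply: cptpos_integrable; [exact: testpos_cpos|case: tg].
have iV := sqint_integrable mR (testpos_sqint tV).
have iq := sqint_integrable mR (testpos_sqint tq).
have iS := sqint_integrable mR (testpos_sqint tS).
have iu := sqint_integrable mR (testpos_sqint tu).
have iq' : mu.-integrable Rpos (EFin \o (fun x => kap ^+ 2 / 2 * (q x * q x * u x) ^+ 2)).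
  exact: (integrableZl mR (kap ^+ 2 / 2) iq).
have iu' : mu.-integrable Rpos (EFin \o (fun x => C * u x ^+ 2)) by exact: (integrableZl mR C iu).
have j1 : mu.-integrable Rpos (EFin \o (fun x => (V1 x * u x) ^+ 2 + kap ^+ 2 / 2 * (q x * q x * u x) ^+ 2)).
  exact: (integrableD mR iV iq').
have j2 : mu.-integrable Rpos (EFin \o (fun x => (V1 x * u x) ^+ 2 + kap ^+ 2 / 2 * (q x * q x * u x) ^+ 2 + g x)).
  exact: (integrableD mR j1 ig).
have j3 : mu.-integrable Rpos (EFin \o (fun x => SS u x ^+ 2 + C * u x ^+ 2)).
  exact: (integrableD mR iS iu').
have := le_Rintegral mR j2 j3.
rewrite (RintegralD mR j1 ig) (RintegralD mR iV iq') (RintegralD mR iS iu').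
rewrite (RintegralZl (kap ^+ 2 / 2) mR iq) (RintegralZl C mR iu) I0 addr0; apply => x x0.
have x00 : 0 < x by [].
have := @rellich_pointwise c alpha (V1 x) (q x) (u x) (u1 x) (u2 x).
have qx : q x * x = 1 by rewrite /q powR_inv1 ?ltW // mulVf // gt_eqF.
have c0 : 0 <= c by rewrite divr_ge0 // mulr_ge0 // addr_ge0.
move=> /(_ c0 (@V1_ge0 R alpha k x)).
rewrite -/(g x) -/kap.
have -> : - u2 x + c * q x ^+ 2 * u x + V1 x * u x = SS u x.
  rewrite /full_op /bessel_op -/u1 -/u2; congr (_ + _ * _ + _).
  by rewrite /q powR_inv1 ?ltW // exprVn.
have Vq : 2 * alpha ^+ 2 * V1 x * q x ^+ 2 <= kap ^+ 2 / 2 * q x ^+ 4 + C.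
  have x2 : x `^ (2 * alpha) <= 1 + x ^+ 2.
    have [x1|x1] := leP x 1.
      apply: (@le_trans _ _ (1 `^ (2 * alpha))); last by rewrite powR1 lerDl sqr_ge0.
      by apply: ge0_ler_powR; rewrite ?nnegrE ?mulr_ge0 // ltW.
    apply: (@le_trans _ _ (x `^ 2)); last by rewrite (powR_mulrn 2) ?lerDr // ltW.
    by apply: ler_powR; [exact: ltW|have := a1; lra].
  have h1 := ler_wpM2l (mulr_ge0 M0 (sqr_ge0 (q x))) x2.
  have -> : 2 * alpha ^+ 2 * V1 x * q x ^+ 2 = M * q x ^+ 2 * x `^ (2 * alpha).
    by rewrite /power_pot gtr0_norm // /M; ring.
  have e1 : M * q x ^+ 2 * (1 + x ^+ 2) = M * q x ^+ 2 + M.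
    by rewrite mulrDr mulr1 -mulrA -exprMn qx expr1n mulr1.
  rewrite e1 in h1; apply: le_trans h1 _; rewrite /C.
  have h2 : 0 <= (kap ^+ 2 * q x ^+ 2 - M) ^+ 2 / (2 * kap ^+ 2).
    by rewrite divr_ge0 ?sqr_ge0 // mulr_ge0 // ltW.
  rewrite -subr_ge0 (_ : _ - _ = (kap ^+ 2 * q x ^+ 2 - M) ^+ 2 / (2 * kap ^+ 2)) //.
  by field; rewrite gt_eqF.
have h3 := ler_wpM2r (sqr_ge0 (u x)) Vq.
have e2 : kap ^+ 2 / 2 * (q x * q x * u x) ^+ 2 = kap ^+ 2 / 2 * q x ^+ 4 * u x ^+ 2 by ring.
have e3 : kap ^+ 2 * (q x ^+ 2 * u x) ^+ 2 = kap ^+ 2 * q x ^+ 4 * u x ^+ 2 by ring.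
rewrite e2 e3; move: h3; rewrite (mulrDl (kap ^+ 2 / 2 * q x ^+ 4) C).
have -> : kap ^+ 2 / 2 * q x ^+ 4 * u x ^+ 2 = kap ^+ 2 * q x ^+ 4 * u x ^+ 2 / 2 by field.
move: (kap ^+ 2 * q x ^+ 4 * u x ^+ 2) (2 * alpha ^+ 2 * V1 x * q x ^+ 2 * u x ^+ 2) => X Y.
move: (g x) (SS u x ^+ 2) ((V1 x * u x) ^+ 2) (C * u x ^+ 2) => X1 X2 X3 X4; lra.
Qed.

End Rellich.

(** * Completeness of L^2 for rapidly Cauchy sequences *)

Section Completeness.
Context {R : realType}.
Local Notation mu := (@lebesgue_measure R).

(* The weights [2 ^ i] replace Minkowski's inequality by Cauchy-Schwarz. *)
Definition weighted_jumps (f : nat -> R) (m : nat) : R :=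
  \sum_(i < m) 2 ^+ i * (f i.+1 - f i) ^+ 2.

(** Induction on [j] that peels off the first jump: the factor 2 in (p + q)^2 <= 2 p^2 + 2 q^2 is
    compensated by passing from 2^-n to 2^-(n+1). *)
Lemma sqr_telescope (f : nat -> R) n j : (f (n + j)%N - f n) ^+ 2 <=
  2 * 2^-1 ^+ n * (weighted_jumps f (n + j)%N - weighted_jumps f n).
Proof.
set S := weighted_jumps f; elim: j n => [|j IH] n.
  by rewrite addn0 !subrr mulr0 expr0n.
have hS : S n.+1 = S n + 2 ^+ n * (f n.+1 - f n) ^+ 2 by rewrite /S /weighted_jumps big_ord_recr.
have := IH n.+1; rewrite hS addSnnS.
have n2 : 2^-1 ^+ n * 2 ^+ n = 1 :> R by rewrite -exprMn mulVf ?expr1n.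
move: (S (n + j.+1)%N) (S n) => X Y k1.
have k2 : 2^-1 ^+ n * (2 ^+ n * (f n.+1 - f n) ^+ 2) = (f n.+1 - f n) ^+ 2.
  by rewrite mulrA n2 mul1r.
have k3 : 2 * 2^-1 ^+ n.+1 = 2^-1 ^+ n :> R by rewrite exprS mulrA mulfV ?mul1r.
rewrite k3 in k1.
have -> : X - Y = (X - (Y + 2 ^+ n * (f n.+1 - f n) ^+ 2)) + 2 ^+ n * (f n.+1 - f n) ^+ 2 by ring.
rewrite -mulrA mulrDr k2; move: (2^-1 ^+ n * _) k1 => T k1.
have k4 := sqr_ge0 ((f (n + j.+1)%N - f n.+1) - (f n.+1 - f n)).
by move: (f (n + j.+1)%N) (f n.+1) (f n) k1 k4 => x y z; nra.
Qed.

Lemma sqint_complete (D : set (measurableTypeR R)) (f_ : nat -> R -> R) : measurable D ->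
  (forall n, sqint D (f_ n)) ->
  (forall n, nsq D (fun x => f_ n.+1 x - f_ n x) <= (2^-1 ^+ n) ^+ 2) ->
  exists f, sqint D f /\ forall n, nsq D (fun x => f_ n x - f x) <= 4 * 2^-1 ^+ n.
Proof.
move=> mD fi fn.
pose t i x : R := 2 ^+ i * (f_ i.+1 x - f_ i x) ^+ 2.
have t0 i x : 0 <= t i x by rewrite mulr_ge0 ?sqr_ge0 // exprn_ge0.
(* Its integral is at most the sum of 2^i 4^-i, that is 2; where it is finite, [sqr_telescope] makes
   [f_ n x] a Cauchy sequence. *)
pose H x : \bar R := (\sum_(i <oo) (t i x)%:E)%E.
have di i : sqint D (fun x => f_ i.+1 x - f_ i x) by exact: (sqintB mD (fi _) (fi _)).
have mt i : measurable_fun D (EFin \o t i).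
  apply/measurable_EFinP; apply: measurable_funM; first exact: measurable_cst.
  by apply: measurable_funX; case: (di i).
have mH : measurable_fun D H.
  rewrite (_ : H = fun x => (\sum_(i <oo | i \in xpredT) (t i x)%:E)%E) //.
  by apply: ge0_emeasurable_sum => [i x _ _|i _]; [rewrite lee_fin|exact: mt].
have H0 x : (0 <= H x)%E by apply: nneseries_ge0 => i _ _; rewrite lee_fin.
have S_le x m : ((\sum_(i < m) t i x)%:E <= H x)%E.
  rewrite -sumEFin -(big_mkord xpredT (fun i => (t i x)%:E)).
  by apply: nneseries_lim_ge => i _ _; rewrite lee_fin.
have IH : (\int[mu]_(x in D) H x <= 2%:E)%E.
  rewrite /H integral_nneseries //; last by move=> i x _; rewrite lee_fin.
  apply: lime_le.
    by apply: is_cvg_nneseries => i _ _; apply: integral_ge0 => x _; rewrite lee_fin.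
  apply: nearW => n; rewrite big_mkord.
  have term i : (\int[mu]_(x in D) (t i x)%:E <= (2^-1 ^+ i)%:E)%E.
    rewrite /t; under eq_integral => x _ do rewrite EFinM.
    rewrite ge0_integralZl_EFin ?exprn_ge0 //; last 2 first.
    - by move=> x _; rewrite lee_fin sqr_ge0.
    - by apply/measurable_EFinP; apply: measurable_funX; case: (di i).
    rewrite (nsqE mD (di i)) lee_fin.
    apply: le_trans (ler_wpM2l _ (fn i)) _; first by rewrite exprn_ge0.
    by rewrite expr2 mulrA -exprMn mulfV // expr1n mul1r.
  apply: (@le_trans _ _ (\sum_(i < n) (2^-1 ^+ i)%:E)%E); first by apply: lee_sum => i _.
  rewrite sumEFin lee_fin.
  suff -> : \sum_(i < n) 2^-1 ^+ i = 2 - 2 * 2^-1 ^+ n :> R.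
    by rewrite lerBlDr lerDl mulr_ge0 // exprn_ge0.
  elim: n => [|n IHn]; first by rewrite big_ord0 expr0 mulr1 subrr.
  by rewrite big_ord_recr /= IHn exprS; field.
pose F := D `&` [set x | H x \is a fin_num].
have mF : measurable F by exact: emeasurable_fin_num.
have key x n j : F x -> (f_ (n + j)%N x - f_ n x) ^+ 2 <= 2 * 2^-1 ^+ n * fine (H x).
  move=> [Dx Hx]; apply: le_trans (sqr_telescope (fun i => f_ i x) n j) _.
  rewrite ler_wpM2l ?mulr_ge0 ?exprn_ge0 ?invr_ge0 //.
  apply: (@le_trans _ _ (\sum_(i < n + j) t i x)).
    by rewrite lerBlDr lerDl sumr_ge0 // => i _; exact: t0.
  by rewrite -lee_fin fineK.
have p0 : (2 * 2^-1 ^+ n : R) @[n --> \oo] --> (0 : R).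
  by apply: cvg_geometric; rewrite ger0_norm // invf_lt1 // ltr1n.
have cvF x : F x -> cvgn (f_ ^~ x).
  move=> Fx; apply: R_complete; apply: cauchy_exP => e e0.
  have r0 : 0 < fine (H x) + 1 by rewrite ltr_wpDl // fine_ge0.
  have w0 : 0 < e ^+ 2 / (fine (H x) + 1) by rewrite divr_gt0 // exprn_gt0.
  have /cvgrPdist_lt /(_ _ w0) [n _ /(_ n (leqnn n)) /=] := p0.
  rewrite sub0r normrN ger0_norm ?mulr_ge0 ?exprn_ge0 ?invr_ge0 // ltr_pdivlMr // => hn.
  exists (f_ n x); exists n => // m /= nm; rewrite /ball /= -ltr_sqr ?nnegrE ?normr_ge0 ?ltW //.
  rewrite real_normK ?num_real // -(subnKC nm) -opprB sqrrN.
  apply: le_lt_trans (key x n (m - n)%N Fx) _; apply: le_lt_trans hn.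
  by rewrite ler_wpM2l ?mulr_ge0 ?exprn_ge0 ?invr_ge0 // lerDl.
pose f := (fun x => limn (f_ ^~ x)) \_ F.
have FE x : F x -> f x = limn (f_ ^~ x) by move=> Fx; rewrite /f patchE mem_set.
have mf : measurable_fun D f.
  apply: (@measurable_fun_cvg _ _ _ D (fun n => f_ n \_ F)).
    move=> n; apply/measurable_restrict => //; apply: measurable_funS (proj1 (fi n)) => // x [//].
  move=> x Dx; have [Fx|nFx] := pselect (F x).
    rewrite FE // (_ : (fun n => _) = f_ ^~ x); first exact: cvF.
    by apply/funext => n; rewrite patchE mem_set.
  rewrite /f (_ : (fun n => _) = fun=> 0) ?patchE ?memNset //; first exact: cvg_cst.
  by apply/funext => n; rewrite patchE memNset.
have bnd x n : D x -> (((f_ n x - f x) ^+ 2)%:E <= (2 * 2^-1 ^+ n)%:E * H x)%E.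
  move=> Dx; have [Hx|] := boolP (H x \is a fin_num).
    have Fx : F x by [].
    rewrite -(fineK Hx) -EFinM lee_fin -sqrrN opprB.
    have c1 : (f_ m x - f_ n x) ^+ 2 @[m --> \oo] --> (f x - f_ n x) ^+ 2.
      rewrite FE //; apply: (@cvgM _ _ _ _ (fun m => f_ m x - f_ n x) (fun m => f_ m x - f_ n x)); apply: cvgB; [exact: cvF|exact: cvg_cst|exact: cvF|exact: cvg_cst].
    apply: (cvgr_to_le c1); exists n => // m /= nm.
    by rewrite -(subnKC nm); exact: key.
  (* Where H x = +oo the bound is trivial, so the estimate holds everywhere on [D] and no null set
     has to be removed. *)
  rewrite ge0_fin_numE // -leNgt leye_eq => /eqP ->.
  by rewrite gt0_muley ?leey // lte_fin mulr_gt0 // exprn_gt0.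
have Ile n : (\int[mu]_(x in D) ((f_ n x - f x) ^+ 2)%:E <= (4 * 2^-1 ^+ n)%:E)%E.
  have q0 : 0 <= 2 * 2^-1 ^+ n :> R by rewrite mulr_ge0 ?exprn_ge0 ?invr_ge0.
  apply: (@le_trans _ _ (\int[mu]_(x in D) ((2 * 2^-1 ^+ n)%:E * H x))%E).
    apply: ge0_le_integral => //.
    - by move=> x _; rewrite lee_fin sqr_ge0.
    - apply/measurable_EFinP; apply: measurable_funX; apply: measurable_funB => //.
      by case: (fi n).
    - exact: measurable_funeM.
    - by move=> x Dx; exact: bnd.
  rewrite ge0_integralZl_EFin //.
  apply: le_trans (lee_wpmul2l _ IH) _; first by rewrite lee_fin.
  by rewrite -EFinM lee_fin; lra.
have dfi n : sqint D (fun x => f_ n x - f x).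
  split; first by apply: measurable_funB => //; case: (fi n).
  exact: le_lt_trans (Ile n) (ltry _).
exists f; split.
  apply: (eq_sqint mD _ (sqintB mD (fi 0%N) (dfi 0%N))) => x _.
  by rewrite opprB addrCA subrr addr0.
by move=> n; rewrite -lee_fin -(nsqE mD (dfi n)); exact: Ile.
Qed.

End Completeness.

(** * Second-order regularity of the domain of the closure *)

Section SecondOrderRegularity.
Context {R : realType} (alpha : R) (k : int).
Hypothesis ha : 0 <= alpha < 1.
Local Notation mu := (@lebesgue_measure R).
Local Notation c := (alpha * (2 + alpha) / 4).
Local Notation V1 := (power_pot alpha k).
Local Notation SS := (full_op alpha k).
Local Notation closr := (closr alpha k).
Let a0 : 0 <= alpha. Proof. by case/andP: ha. Qed.
Let a1 : alpha < 1. Proof. by case/andP: ha. Qed.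
Let mR := @measurable_Rpos R.
#[local] Opaque Rintegral derive1 smooth_on.

(** Interpolation: u'^2 = (u u')' - u u'', and the total derivative integrates to 0. *)
Lemma nsq_derive1_le (u : R -> R) : testpos u ->
  nsq Rpos (derive1 u) <= nsq Rpos u + nsq Rpos (derive1 (derive1 u)).
Proof.
move=> tu; have [su _] := tu.
have tu1 := testpos_derive1 tu; have tu2 := testpos_derive1 tu1.
pose u1 : R -> R := derive1 u; pose u2 : R -> R := derive1 u1.
pose g x := u1 x * u1 x + u x * u2 x.
have GD (t : R) : 0 < t -> is_derive t 1 (fun x => u x * u1 x) (g t).
  move=> t0; have du := testpos_is_derive tu t0; have du1 := testpos_is_derive tu1 t0.
  rewrite -/u1 in du du1; rewrite -/u2 in du1.
  apply: is_derive_eq; rewrite -![_ *: _]/(_ * _) /g.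
  by move: (u t) (u1 t) (u2 t) => *; ring.
have tG : testpos (fun x => u x * u1 x) := testposMl tu (smooth_on_derive1 su).
have tg : testpos g.
  by apply: testposD; [exact: (testposMl tu1 (proj1 tu1))|exact: (testposMl tu (proj1 tu2))].
have I0 := Rintegral_derive_eq0 GD (testpos_cpos tg) (proj2 tG).
have ig : mu.-integrable Rpos (EFin \o g).
  by apply: cptpos_integrable; [exact: testpos_cpos|case: tg].
have i0 := sqint_integrable mR (testpos_sqint tu).
have i1 := sqint_integrable mR (testpos_sqint tu1).
have i2 := sqint_integrable mR (testpos_sqint tu2).
have j1 : mu.-integrable Rpos (EFin \o (fun x => u x ^+ 2 + u2 x ^+ 2)) := integrableD mR i0 i2.
have j2 : mu.-integrable Rpos (EFin \o (fun x => u x ^+ 2 + u2 x ^+ 2 + g x)) := integrableD mR j1 ig.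
have := le_Rintegral mR i1 j2.
rewrite (RintegralD mR j1 ig) (RintegralD mR i0 i2) I0 addr0; apply => x x0.
rewrite /g -/u1; move: (u x) (u1 x) (u2 x) => p q r.
have := sqr_ge0 (p + r); have := sqr_ge0 p; have := sqr_ge0 r; nra.
Qed.

(** The Rellich inequality controls V1 u and x^(-2) u separately, and u'' = V1 u + c x^(-2) u - S u;
    interpolation then gives u'. *)
Lemma elliptic_estimate : exists2 C : R, 0 < C & forall u, testpos u ->
  nsq Rpos (derive1 u) <= C * (nsq Rpos (SS u) + nsq Rpos u) /\
  nsq Rpos (derive1 (derive1 u)) <= C * (nsq Rpos (SS u) + nsq Rpos u).
Proof.
have [K K0 HK] := rellich k ha.
have kap0 : 0 < (3 / 4 - c) ^+ 2 / 2.
  by rewrite divr_gt0 // exprn_gt0 //; have := a0; have := a1; nra.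
move: ((3 / 4 - c) ^+ 2 / 2) kap0 HK => kap kap0 HK.
(* The norm of u'' is at most 4 A + 4 c^2 W + 2 S, where A and kap W are each at most S + K U, hence
   at most (1 + K) (S + U). *)
pose L : R := (4 + 4 * c ^+ 2 / kap) * (1 + K) + 2.
have c20 : 0 <= 4 * c ^+ 2 / kap.
  by apply: divr_ge0; [exact: mulr_ge0 (ler0n _ 4) (sqr_ge0 _)|exact: ltW].
have L0 : 0 < L by rewrite ltr_wpDl // mulr_ge0 // addr_ge0.
have H2 u : testpos u -> nsq Rpos (derive1 (derive1 u)) <= L * (nsq Rpos (SS u) + nsq Rpos u).
  move=> tu; have := HK u tu.
  have sV := @V1_smooth R alpha k; have sq := @smooth_on_powR R (-1).
  have tV : testpos (fun x => V1 x * u x) := testposMr tu sV.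
  have tq : testpos (fun x => x `^ (-1) * x `^ (-1) * u x) := testposMr tu (sposM sq sq).
  have sqV := testpos_sqint tV; have sqq := testpos_sqint tq.
  have sqS := testpos_sqint (testpos_SS alpha k tu).
  have cq := sqintZ c mR sqq.
  have E x : Rpos x -> derive1 (derive1 u) x =
      (V1 x * u x + c * (x `^ (-1) * x `^ (-1) * u x)) - SS u x.
    move=> x0; have xp : 0 < x by [].
    rewrite /full_op /bessel_op powR_inv1 ?(ltW xp) // expr2 invfM.
    by move: (derive1 (derive1 u) x) => *; ring.
  rewrite (eq_nsq E).
  have k1 := nsqB mR (sqintD mR sqV cq) sqS.
  have k2 := nsqD mR sqV cq.
  rewrite (nsqZ c mR sqq) in k2.
  have A0 := nsq_ge0 Rpos (fun x => V1 x * u x).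
  have W0 := nsq_ge0 Rpos (fun x => x `^ (-1) * x `^ (-1) * u x).
  have S0 := nsq_ge0 Rpos (SS u); have U0 := nsq_ge0 Rpos u.
  move: (nsq Rpos (fun x => V1 x * u x)) (nsq Rpos (fun x => _ * _ * u x)) k2 A0 W0 => A W k2 A0 W0 k3.
  apply: le_trans k1 _.
  move: (nsq Rpos (fun x => _ + _)) k2 => X k2.
  move: (nsq Rpos (SS u)) (nsq Rpos u) S0 U0 k3 => S U S0 U0 k3.
  have T0 : S + K * U <= (1 + K) * (S + U).
    have := mulr_ge0 K0 S0; have := mulr_ge0 K0 U0; rewrite mulrDl !mulrDr; lra.
  have kW : 4 * c ^+ 2 * W <= 4 * c ^+ 2 / kap * (S + K * U).
    have -> : 4 * c ^+ 2 * W = 4 * c ^+ 2 / kap * (kap * W) by field; rewrite gt_eqF.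
    by apply: ler_wpM2l => //; lra.
  have k4 := ler_wpM2l c20 T0.
  have kA : A <= S + K * U by have := mulr_ge0 (ltW kap0) W0; lra.
  have -> : L * (S + U) = 4 * ((1 + K) * (S + U)) + 4 * c ^+ 2 / kap * ((1 + K) * (S + U)) + 2 * (S + U).
    by rewrite /L; ring.
  have k5 := le_trans kW k4.
  move: (4 * c ^+ 2 / kap * ((1 + K) * (S + U))) k5 => Z k5.
  move: ((1 + K) * (S + U)) T0 => Y T0; rewrite -mulrA in k5.
  move: (c ^+ 2 * W) k2 k5 => Q k2 k5; lra.
exists (1 + L); first by rewrite ltr_wpDr // ltW.
move=> u tu; have k1 := H2 u tu; have k2 := nsq_derive1_le tu.
have S0 := nsq_ge0 Rpos (SS u); have U0 := nsq_ge0 Rpos u.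
move: (nsq _ _) (nsq _ _) (nsq _ _) (nsq _ _) k1 k2 S0 U0 => X2 X1 X3 X4 k1 k2 S0 U0.
by rewrite (mulrDl 1 L) mul1r; move: (L * _) k1 => Z k1; split; lra.
Qed.

Lemma derive1B_Rpos (u v : R -> R) x : smooth_on Rpos u -> smooth_on Rpos v -> 0 < x ->
  derive1 (fun t => u t - v t) x = derive1 u x - derive1 v x.
Proof.
move=> su sv x0.
have du := smooth_on_is_derive su x0; have dv := smooth_on_is_derive sv x0.
have [_ <-] := is_deriveB du dv; by rewrite derive1E.
Qed.

Lemma closr_H2 phi h : closr phi h -> exists h1 h2, [/\ sqint Rpos h1, sqint Rpos h2 &
  forall e : R, 0 < e -> exists u, [/\ testpos u, nsq Rpos (fun x => u x - phi x) < e,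
    nsq Rpos (fun x => derive1 u x - h1 x) < e &
    nsq Rpos (fun x => derive1 (derive1 u) x - h2 x) < e]].
Proof.
move=> [pi hi H]; have [C C0 HC] := elliptic_estimate.
(* Consecutive approximants then differ by at most 4 r n in each of the two norms, and C (4 r n + 4
   r n) = 4^-n is the rate that [sqint_complete] asks for. *)
pose r (n : nat) : R := (2^-1 ^+ n) ^+ 2 / (8 * C).
have r0 n : 0 < r n by rewrite divr_gt0 // ?mulr_gt0 // exprn_gt0 // exprn_gt0 // invr_gt0.
have /choice[u_ Hu] : forall n, exists u, [/\ testpos u, nsq Rpos (fun x => u x - phi x) < r n &
    nsq Rpos (fun x => SS u x - h x) < r n] by move=> n; exact: H.
have tu n : testpos (u_ n) by case: (Hu n).
have tu1 n := testpos_derive1 (tu n); have tu2 n := testpos_derive1 (tu1 n).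
have rS n : r n.+1 <= r n.
  apply: ler_wpM2r; first by rewrite invr_ge0 mulr_ge0 // ltW.
  rewrite ler_sqr ?nnegrE ?exprn_ge0 ?invr_ge0 //.
  by rewrite exprS ler_piMl ?exprn_ge0 ?invr_ge0 // invf_le1 // ler1n.
have step f_ f n : sqint Rpos f -> (forall n, sqint Rpos (f_ n)) ->
    (forall n, nsq Rpos (fun x => f_ n x - f x) < r n) ->
    nsq Rpos (fun x => f_ n.+1 x - f_ n x) <= 4 * r n.
  move=> fi fni fr.
  rewrite (eq_nsq (g := fun x => (f_ n.+1 x - f x) - (f_ n x - f x))); last by move=> x _; ring.
  apply: le_trans (nsqB mR (sqintB mR (fni _) fi) (sqintB mR (fni _) fi)) _.
  by have := fr n; have := fr n.+1; have := rS n; lra.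
have est n : nsq Rpos (fun x => derive1 (u_ n.+1) x - derive1 (u_ n) x) <= (2^-1 ^+ n) ^+ 2 /\
    nsq Rpos (fun x => derive1 (derive1 (u_ n.+1)) x - derive1 (derive1 (u_ n)) x) <= (2^-1 ^+ n) ^+ 2.
  have tw := testposB (tu n.+1) (tu n).
  have [e1 e2] := HC _ tw.
  have s1 : nsq Rpos (fun x => u_ n.+1 x - u_ n x) <= 4 * r n.
    by apply: (step u_ phi) => // m; [exact: testpos_sqint|case: (Hu m)].
  have s2 : nsq Rpos (SS (fun x => u_ n.+1 x - u_ n x)) <= 4 * r n.
    rewrite (eq_nsq (g := fun x => SS (u_ n.+1) x - SS (u_ n) x)).
      apply: (step (fun m => SS (u_ m)) h) => // m; last by case: (Hu m).
      exact: (testpos_sqint (testpos_SS alpha k (tu m))).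
    move=> x x0; rewrite /full_op (S0B alpha (proj1 (tu n.+1)) (proj1 (tu n)) x0).
    by move: (bessel_op _ _ _) (bessel_op _ _ _) => *; ring.
  have rE : C * (4 * r n + 4 * r n) = (2^-1 ^+ n) ^+ 2.
    by rewrite /r; move: ((2^-1 ^+ n) ^+ 2) => w; field; rewrite gt_eqF.
  have k1 : C * (nsq Rpos (SS (fun x => u_ n.+1 x - u_ n x)) + nsq Rpos (fun x => u_ n.+1 x - u_ n x))
      <= (2^-1 ^+ n) ^+ 2.
    by rewrite -rE; apply: ler_wpM2l; [exact: ltW|exact: lerD].
  split.
    rewrite (eq_nsq (g := derive1 (fun x => u_ n.+1 x - u_ n x))); first exact: le_trans e1 k1.
    by move=> x x0; rewrite derive1B_Rpos //; [case: (tu n.+1)|case: (tu n)].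
  rewrite (eq_nsq (g := derive1 (derive1 (fun x => u_ n.+1 x - u_ n x)))); first exact: le_trans e2 k1.
  move=> x x0; rewrite -derive1B_Rpos //; [|by case: (tu1 n.+1)|by case: (tu1 n)].
  apply/esym/(derive1_eq_on open_Rpos) => // y y0.
  by rewrite derive1B_Rpos //; [case: (tu n.+1)|case: (tu n)].
have [h1 [h1i c1]] := sqint_complete mR (fun n => testpos_sqint (tu1 n)) (fun n => proj1 (est n)).
have [h2 [h2i c2]] := sqint_complete mR (fun n => testpos_sqint (tu2 n)) (fun n => proj2 (est n)).
exists h1, h2; split => // e e0.
have p0 : (4 * 2^-1 ^+ n : R) @[n --> \oo] --> (0 : R).
  by apply: cvg_geometric; rewrite ger0_norm // invf_lt1 // ltr1n.
have q0 : (((4 * C)^-1 * 2^-1) * 2^-1 ^+ n : R) @[n --> \oo] --> (0 : R).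
  by apply: cvg_geometric; rewrite ger0_norm // invf_lt1 // ltr1n.
move/cvgrPdist_lt : p0 => /(_ e e0) p0; move/cvgrPdist_lt : q0 => /(_ e e0) q0.
have [n [pn qn]] := filter_ex (filterI p0 q0).
move: pn qn; rewrite !sub0r !normrN !ger0_norm; last 2 first.
- by rewrite !mulr_ge0 ?invr_ge0 ?exprn_ge0 ?mulr_ge0 ?invr_ge0 // ltW.
- by rewrite mulr_ge0 // exprn_ge0 // invr_ge0.
move=> pn qn; exists (u_ n); split => //.
- have [_ k1 _] := Hu n; apply: lt_le_trans k1 _; apply: le_trans (ltW qn); rewrite /r.
  have x0 : 0 <= 2^-1 ^+ n :> R by rewrite exprn_ge0 ?invr_ge0.
  have x1 : 2^-1 ^+ n <= 1 :> R by rewrite exprn_ile1 ?invr_ge0 // invf_le1 // ler1n.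
  have -> : (4 * C)^-1 * 2^-1 = (8 * C)^-1 by field; rewrite gt_eqF.
  rewrite [leRHS]mulrC; apply: ler_wpM2r; first by rewrite invr_ge0 mulr_ge0 // ltW.
  by rewrite expr2 ler_piMl.
- exact: le_lt_trans (c1 n) pn.
- exact: le_lt_trans (c2 n) pn.
Qed.

End SecondOrderRegularity.

(** * Complex-valued functions *)

Section ComplexL2.
Context {R : realType}.
Local Notation mu := (@lebesgue_measure R).
Local Notation re f := (fun x : R => cre (f x)).
Local Notation im f := (fun x : R => cim (f x)).
Implicit Types (D : set (measurableTypeR R)) (f g : R -> R[i]).

Lemma creD (z w : R[i]) : cre (z + w) = cre z + cre w. Proof. by case: z; case: w. Qed.
Lemma cimD (z w : R[i]) : cim (z + w) = cim z + cim w. Proof. by case: z; case: w. Qed.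
Lemma creB (z w : R[i]) : cre (z - w) = cre z - cre w. Proof. by case: z; case: w. Qed.
Lemma cimB (z w : R[i]) : cim (z - w) = cim z - cim w. Proof. by case: z; case: w. Qed.
Lemma complexP (z w : R[i]) : cre z = cre w -> cim z = cim w -> z = w.
Proof. by case: z => z1 z2; case: w => w1 w2 /= -> ->. Qed.

Lemma integral_sqmod D f : measurable D -> measurable_fun D (re f) -> measurable_fun D (im f) ->
  (\int[mu]_(x in D) (sqmod (f x))%:E =
   \int[mu]_(x in D) (cre (f x) ^+ 2)%:E + \int[mu]_(x in D) (cim (f x) ^+ 2)%:E)%E.
Proof.
move=> mD mr mi; under eq_integral do rewrite EFinD.
rewrite ge0_integralD //.
- by move=> x _; rewrite lee_fin sqr_ge0.
- by apply/measurable_EFinP; exact: measurable_funX.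
- by move=> x _; rewrite lee_fin sqr_ge0.
- by apply/measurable_EFinP; exact: measurable_funX.
Qed.

Lemma L2_sqint D f : measurable D -> L2 D f <-> sqint D (re f) /\ sqint D (im f).
Proof.
move=> mD; have nn (v : R -> R) : (0 <= \int[mu]_(x in D) (v x ^+ 2)%:E)%E.
  by apply: integral_ge0 => x _; rewrite lee_fin sqr_ge0.
split=> [[mr [mi]]|[[mr hr] [mi hi]]].
  rewrite integral_sqmod // => h; split; split=> //; apply: le_lt_trans h.
    by rewrite leeDl.
  by rewrite leeDr.
by split; [|split]; rewrite // integral_sqmod // lte_add_pinfty.
Qed.

Lemma L2B D f g : measurable D -> L2 D f -> L2 D g -> L2 D (fun x => f x - g x).
Proof.
move=> mD /(L2_sqint _ mD)[fr fi] /(L2_sqint _ mD)[gr gi]; apply/L2_sqint => //.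
by split; [apply: (eq_sqint mD _ (sqintB mD fr gr))|apply: (eq_sqint mD _ (sqintB mD fi gi))]
  => x _; rewrite ?creB ?cimB.
Qed.

Lemma integral_sqmodB D f g : measurable D -> L2 D f -> L2 D g ->
  (\int[mu]_(x in D) (sqmod (f x - g x))%:E =
  (nsq D (fun x => cre (f x) - cre (g x)) + nsq D (fun x => cim (f x) - cim (g x)))%:E)%E.
Proof.
move=> mD Lf Lg; have /(L2_sqint _ mD)[fr fi] := L2B mD Lf Lg.
rewrite integral_sqmod //; [|by case: fr|by case: fi].
rewrite (nsqE mD fr) (nsqE mD fi) -EFinD; congr (_ + _)%:E; apply: eq_nsq => x _.
  exact: creB.
exact: cimB.
Qed.

Lemma L2_cvg_near D (u : nat -> R -> R[i]) f (e : R) : measurable D ->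
  (forall n, L2 D (u n)) -> L2 D f -> L2_cvg D u f -> 0 < e ->
  \forall n \near \oo, nsq D (fun x => cre (u n x) - cre (f x)) < e /\
                       nsq D (fun x => cim (u n x) - cim (f x)) < e.
Proof.
move=> mD Lu Lf; rewrite /L2_cvg.
under eq_fun => n do rewrite (integral_sqmodB mD (Lu n) Lf).
move=> /fine_cvgP[_ /cvgrPdist_lt H] e0.
have := H e e0; apply: filterS => n /=; rewrite sub0r normrN ger0_norm; last first.
  by rewrite addr_ge0 // nsq_ge0.
have := nsq_ge0 D (fun x => cre (u n x) - cre (f x)).
have := nsq_ge0 D (fun x => cim (u n x) - cim (f x)).
by move=> h1 h2 h3; split; lra.
Qed.

Lemma L2_cvg_rate D (u : nat -> R -> R[i]) f : measurable D ->
  (forall n, L2 D (u n)) -> L2 D f ->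
  (forall n, nsq D (fun x => cre (u n x) - cre (f x)) < n.+1%:R^-1 /\
             nsq D (fun x => cim (u n x) - cim (f x)) < n.+1%:R^-1) ->
  L2_cvg D u f.
Proof.
move=> mD Lu Lf H; rewrite /L2_cvg.
under eq_fun => n do rewrite (integral_sqmodB mD (Lu n) Lf).
apply: cvg_EFin; first by apply: nearW.
apply: (@squeeze_cvgr _ _ _ _ (fun=> 0) (fun n => n.+1%:R^-1 + n.+1%:R^-1)).
- apply: nearW => n; have [h1 h2] := H n; rewrite /= addr_ge0 ?nsq_ge0 //=.
  by rewrite lerD // ltW.
- exact: cvg_cst.
by rewrite -[X in _ --> X](addr0 0); apply: cvgD; exact: cvg_harmonic.
Qed.

Lemma eq_L2 D f g : measurable D -> (forall x, D x -> f x = g x) -> L2 D f -> L2 D g.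
Proof.
move=> mD E /(L2_sqint _ mD)[h1 h2]; apply/L2_sqint => //; split.
  by apply: eq_sqint h1 => // x Dx; rewrite E.
by apply: eq_sqint h2 => // x Dx; rewrite E.
Qed.

End ComplexL2.

(** * The complex statement on the positive half-line *)

Section ComplexHalfLine.
Context {R : realType} (alpha : R) (k : int).
Hypothesis ha : 0 <= alpha < 1.
Local Notation mu := (@lebesgue_measure R).
Local Notation re f := (fun x : R => cre (f x)).
Local Notation im f := (fun x : R => cim (f x)).
Local Notation SS := (full_op alpha k).
Local Notation closr := (closr alpha k).
Let mR := @measurable_Rpos R.
#[local] Opaque Rintegral derive1 smooth_on.

Lemma ctest_testpos (f : R -> R[i]) : ctest Rpos f -> testpos (re f) /\ testpos (im f).
Proof.
move=> [sr [si [K [cK [KD Kf]]]]]; split; apply: rtest_testpos; split => //;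
  by exists K; split=> //; split=> // x /Kf ->.
Qed.

(** [ctest] requires smoothness on the whole line, so both parts are cut to zero off [Rpos]. *)
Definition cpatch (ur ui : R -> R) : R -> R[i] :=
  fun x => Complex ((ur \_ Rpos) x) ((ui \_ Rpos) x).

Lemma testpos_ctest (ur ui : R -> R) : testpos ur -> testpos ui -> ctest Rpos (cpatch ur ui).
Proof.
move=> /testpos_rtest[sr [K [cK [KD Kr]]]] /testpos_rtest[si [K' [cK' [KD' Ki]]]].
split => //; split => //; exists (K `|` K'); split; first exact: compactU.
split; first by move=> x [/KD|/KD'].
by move=> x nK; rewrite /cpatch Kr ?Ki // => Kx; apply: nK; [right|left].
Qed.

Lemma patch_Rpos (u : R -> R) x : Rpos x -> (u \_ Rpos) x = u x.
Proof. by move=> x0; rewrite patchE mem_set. Qed.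

Lemma derive1n_patch (u : R -> R) n x : Rpos x ->
  derive1n n (u \_ Rpos) x = derive1n n u x.
Proof.
by move=> x0; apply: (derive1n_eq_on n open_Rpos _ x0) => y y0; exact: patch_Rpos.
Qed.

Lemma cderive_cpatch (ur ui : R -> R) n x : Rpos x ->
  cderive n (cpatch ur ui) x = Complex (derive1n n ur x) (derive1n n ui x).
Proof.
by move=> x0; rewrite -(derive1n_patch ur n x0) -(derive1n_patch ui n x0).
Qed.

Lemma nsq_cre_cderive (ur ui : R -> R) n (p : R -> R) :
  nsq Rpos (fun x => cre (cderive n (cpatch ur ui) x) - p x) =
  nsq Rpos (fun x => derive1n n ur x - p x).
Proof. by apply: eq_nsq => x x0; rewrite cderive_cpatch. Qed.

Lemma nsq_cim_cderive (ur ui : R -> R) n (p : R -> R) :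
  nsq Rpos (fun x => cim (cderive n (cpatch ur ui) x) - p x) =
  nsq Rpos (fun x => derive1n n ui x - p x).
Proof. by apply: eq_nsq => x x0; rewrite cderive_cpatch. Qed.

Lemma Sr_SS (u : R -> R) x : Rpos x -> Sr alpha k u x = SS u x.
Proof. by move=> x0; rewrite SrE. Qed.

Lemma Sr_patch (u : R -> R) x : Rpos x -> Sr alpha k (u \_ Rpos) x = SS u x.
Proof. by move=> x0; rewrite -Sr_SS // /Sr derive1n_patch // patch_Rpos. Qed.

Lemma L2_cpatch (vr vi : R -> R) (f : R -> R[i]) : testpos vr -> testpos vi ->
  (forall x, Rpos x -> f x = Complex (vr x) (vi x)) -> L2 Rpos f.
Proof.
move=> tr ti E; apply: (eq_L2 (f := fun x => Complex (vr x) (vi x))) => //.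
  by move=> x /E ->.
by apply/L2_sqint => //; split; exact: testpos_sqint.
Qed.

Lemma clos_dom_half_closr phi : clos_dom_half alpha k Rpos phi ->
  exists hr hi, closr (re phi) hr /\ closr (im phi) hi.
Proof.
move=> [Lp [u [cu [up [h [Lh uh]]]]]].
exists (re h), (im h).
have [pr pi] := proj1 (L2_sqint phi mR) Lp; have [hr hi] := proj1 (L2_sqint h mR) Lh.
have Lu n : L2 Rpos (u n).
  have [tr ti] := ctest_testpos (cu n).
  by apply: (L2_cpatch tr ti) => x _; exact: complexP.
have LS n : L2 Rpos (Sc alpha k (u n)).
  have [tr ti] := ctest_testpos (cu n).
  apply: (L2_cpatch (testpos_SS alpha k tr) (testpos_SS alpha k ti)) => x x0.
  by rewrite /Sc !Sr_SS.
have near e : 0 < e -> exists n,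
  (nsq Rpos (fun x => cre (u n x) - cre (phi x)) < e /\ nsq Rpos (fun x => cim (u n x) - cim (phi x)) < e) /\
  (nsq Rpos (fun x => SS (re (u n)) x - cre (h x)) < e /\ nsq Rpos (fun x => SS (im (u n)) x - cim (h x)) < e).
  move=> e0; have [n [h1 [h2 h3]]] := filter_ex (filterI (L2_cvg_near mR Lu Lp up e0) (L2_cvg_near mR LS Lh uh e0)).
  exists n; split=> //; split.
    by rewrite (eq_nsq (g := fun x => cre (Sc alpha k (u n) x) - cre (h x))) // => x x0; rewrite /Sc /= Sr_SS.
  by rewrite (eq_nsq (g := fun x => cim (Sc alpha k (u n) x) - cim (h x))) // => x x0; rewrite /Sc /= Sr_SS.
split; split=> // e /near[n [[h1 h2] [h3 h4]]]; have [tr ti] := ctest_testpos (cu n).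
  by exists (re (u n)).
by exists (im (u n)).
Qed.

(** The operator has real coefficients: the two parts are approximated independently at the common
    rate 1/(n+1), and the sequences are paired index by index. *)
Lemma closr_clos_dom_half pr pi hr hi : closr pr hr -> closr pi hi ->
  clos_dom_half alpha k Rpos (fun x => Complex (pr x) (pi x)).
Proof.
move=> [pri hri Hr] [pii hii Hi].
have i0 n : 0 < n.+1%:R^-1 :> R by rewrite invr_gt0.
have /choice[ur Hur] := fun n => Hr _ (i0 n).
have /choice[ui Hui] := fun n => Hi _ (i0 n).
have tr n : testpos (ur n) by case: (Hur n).
have ti n : testpos (ui n) by case: (Hui n).
have Lp : L2 Rpos (fun x => Complex (pr x) (pi x)) by apply/L2_sqint.
have Lh : L2 Rpos (fun x => Complex (hr x) (hi x)) by apply/L2_sqint.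
split=> //; exists (fun n => cpatch (ur n) (ui n)).
split; first by move=> n; exact: testpos_ctest.
split; [|exists (fun x => Complex (hr x) (hi x)); split => //].
  apply: L2_cvg_rate => // n.
    by apply: (L2_cpatch (tr n) (ti n)) => x x0; rewrite /cpatch !patch_Rpos.
  have [_ h1 _] := Hur n; have [_ h2 _] := Hui n; split.
    by rewrite (eq_nsq (g := fun x => ur n x - pr x)) // => x x0; rewrite /= patch_Rpos.
  by rewrite (eq_nsq (g := fun x => ui n x - pi x)) // => x x0; rewrite /= patch_Rpos.
apply: L2_cvg_rate => // n.
  apply: (L2_cpatch (testpos_SS alpha k (tr n)) (testpos_SS alpha k (ti n))) => x x0.
  by rewrite /Sc !Sr_patch.
have [_ _ h1] := Hur n; have [_ _ h2] := Hui n; split.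
  by rewrite (eq_nsq (g := fun x => SS (ur n) x - hr x)) // => x x0; rewrite /= Sr_patch.
by rewrite (eq_nsq (g := fun x => SS (ui n) x - hi x)) // => x x0; rewrite /= Sr_patch.
Qed.

Lemma closr_H2_0 pr pi hr hi : closr pr hr -> closr pi hi ->
  H2_0 Rpos (fun x => Complex (pr x) (pi x)).
Proof.
move=> Cr Ci; have [pri _ _] := Cr; have [pii _ _] := Ci.
have [h1r [h2r [l1r l2r Hr]]] := closr_H2 ha Cr.
have [h1i [h2i [l1i l2i Hi]]] := closr_H2 ha Ci.
have i0 n : 0 < n.+1%:R^-1 :> R by rewrite invr_gt0.
have /choice[ur Hur] := fun n => Hr _ (i0 n).
have /choice[ui Hui] := fun n => Hi _ (i0 n).
have tr n : testpos (ur n) by case: (Hur n).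
have ti n : testpos (ui n) by case: (Hui n).
have tr1 n := testpos_derive1 (tr n); have tr2 n := testpos_derive1 (tr1 n).
have ti1 n := testpos_derive1 (ti n); have ti2 n := testpos_derive1 (ti1 n).
have Lp : L2 Rpos (fun x => Complex (pr x) (pi x)) by apply/L2_sqint.
have Lh1 : L2 Rpos (fun x => Complex (h1r x) (h1i x)) by apply/L2_sqint.
have Lh2 : L2 Rpos (fun x => Complex (h2r x) (h2i x)) by apply/L2_sqint.
split=> //; exists (fun n => cpatch (ur n) (ui n)).
split; first by move=> n; exact: testpos_ctest.
split; last split.
- apply: L2_cvg_rate => // n.
    by apply: (L2_cpatch (tr n) (ti n)) => x x0; rewrite /cpatch !patch_Rpos.
  have [_ h1 _ _] := Hur n; have [_ h2 _ _] := Hui n; split.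
    by rewrite (eq_nsq (g := fun x => ur n x - pr x)) // => x x0; rewrite /= patch_Rpos.
  by rewrite (eq_nsq (g := fun x => ui n x - pi x)) // => x x0; rewrite /= patch_Rpos.
- exists (fun x => Complex (h1r x) (h1i x)); split => //; apply: L2_cvg_rate => // n.
    by apply: (L2_cpatch (tr1 n) (ti1 n)) => x x0; rewrite cderive_cpatch.
  have [_ _ h1 _] := Hur n; have [_ _ h2 _] := Hui n; split.
    by rewrite (nsq_cre_cderive _ _ 1 h1r).
  by rewrite (nsq_cim_cderive _ _ 1 h1i).
- exists (fun x => Complex (h2r x) (h2i x)); split => //; apply: L2_cvg_rate => // n.
    by apply: (L2_cpatch (tr2 n) (ti2 n)) => x x0; rewrite cderive_cpatch.
  have [_ _ _ h1] := Hur n; have [_ _ _ h2] := Hui n; split.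
    by rewrite (nsq_cre_cderive _ _ 2 h2r).
  by rewrite (nsq_cim_cderive _ _ 2 h2i).
Qed.

Lemma ess_lim0_rlim0 (D : set R) (f : R -> R[i]) (l : R[i]) :
  rlim0 D (re f) (cre l) -> rlim0 D (im f) (cim l) -> ess_lim0 D f l.
Proof.
move=> Hr Hi e e0; have e2 : 0 < e / 2 by rewrite divr_gt0.
have [d [d0 Hd]] := Hr _ e2; have [d' [d'0 Hd']] := Hi _ e2.
exists (Num.min d d'); split; first by rewrite lt_min d0.
apply: ae_imp (ae_and Hd Hd') => x [h1 h2] Dx; rewrite lt_min => /andP[xd xd'].
by have := h1 Dx xd; have := h2 Dx xd'; rewrite /sqmod creB cimB; lra.
Qed.

(** The one-sided result as a predicate of cutoff, half-line and function, so that a single lemma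
    can transport it by reflection. *)
Definition half_line_statement (P : R -> R) (D : set R) (g : R -> R[i]) : Prop :=
  exists (phi : R -> R[i]) (g0 g1 : R[i]),
  [/\ clos_dom_half alpha k D phi, H2_0 D phi, ae_eq_on D g (decomp_rhs alpha P phi g0 g1),
      (forall phi' a0 a1, clos_dom_half alpha k D phi' ->
         ae_eq_on D g (decomp_rhs alpha P phi' a0 a1) ->
         [/\ ae_eq_on D phi' phi, a0 = g0 & a1 = g1]) &
      ess_lim0 D (fun x => rsc (`|x| `^ (alpha / 2)) (g x)) g0 /\
      ess_lim0 D (fun x => rsc (`|x| `^ (- (1 + alpha / 2)))
                               (g x - rsc (`|x| `^ (- (alpha / 2))) g0)) g1].

Lemma half_line_Rpos (P : R -> R) (g h : R -> R[i]) : smooth P ->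
  (forall x : R, `|x| < 1 -> P x = 1) -> (forall x : R, 2 < `|x| -> P x = 0) ->
  L2 Rpos g -> L2 Rpos h -> weakS alpha k Rpos g h -> half_line_statement P Rpos g.
Proof.
move=> sP P1 P0 Lg Lh W.
have [gr gi] := proj1 (L2_sqint g mR) Lg; have [hr hi] := proj1 (L2_sqint h mR) Lh.
have Wp (p q : R -> R) : (forall u, rtest Rpos u ->
    \int[mu]_(x in Rpos) (p x * Sr alpha k u x) = \int[mu]_(x in Rpos) (q x * u x)) ->
    forall u, testpos u ->
    \int[mu]_(x in Rpos) (p x * Sr alpha k u x) = \int[mu]_(x in Rpos) (q x * u x).
  move=> H u /testpos_rtest /H E.
  rewrite (eq_Rint (g := fun x => p x * Sr alpha k (u \_ Rpos) x)); last first.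
    by move=> x x0; rewrite Sr_patch // Sr_SS.
  by rewrite E; apply: eq_Rint => x x0; rewrite patch_Rpos.
have [pr [h'r [g0r [g1r [Cr Er]]]]] := half_line ha sP P1 P0 gr hr (Wp _ _ (fun u tu => proj1 (W u tu))).
have [pi [h'i [g0i [g1i [Ci Ei]]]]] := half_line ha sP P1 P0 gi hi (Wp _ _ (fun u tu => proj2 (W u tu))).
have dr x : Rpos x -> cre (g x) = pr x + (`|x| `^ (- (alpha / 2)) * P x) * g0r
    + (`|x| `^ (1 + alpha / 2) * P x) * g1r.
  by move=> x0; rewrite Er // gtr0_norm.
have di x : Rpos x -> cim (g x) = pi x + (`|x| `^ (- (alpha / 2)) * P x) * g0i
    + (`|x| `^ (1 + alpha / 2) * P x) * g1i.
  by move=> x0; rewrite Ei // gtr0_norm.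
have adr := aeW mu dr; have adi := aeW mu di.
exists (fun x => Complex (pr x) (pi x)), (Complex g0r g0i), (Complex g1r g1i); split.
- exact: closr_clos_dom_half Cr Ci.
- exact: closr_H2_0 Cr Ci.
- apply: aeW => x x0; apply: complexP.
    by rewrite /decomp_rhs !creD dr.
  by rewrite /decomp_rhs !cimD di.
- move=> phi' b0 b1 /clos_dom_half_closr[kr [ki [Cr' Ci']]] E.
  have Er' : {ae mu, forall x, Rpos x -> cre (g x) = cre (phi' x) + (`|x| `^ (- (alpha / 2)) * P x) * cre b0
    + (`|x| `^ (1 + alpha / 2) * P x) * cre b1}.
    by apply: ae_imp E => x E x0; rewrite E // /decomp_rhs !creD.
  have Ei' : {ae mu, forall x, Rpos x -> cim (g x) = cim (phi' x) + (`|x| `^ (- (alpha / 2)) * P x) * cim b0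
    + (`|x| `^ (1 + alpha / 2) * P x) * cim b1}.
    by apply: ae_imp E => x E x0; rewrite E // /decomp_rhs !cimD.
  have [u1 u2 u3] := decomposition_unique ha sP P1 P0 Cr Cr' adr Er'.
  have [v1 v2 v3] := decomposition_unique ha sP P1 P0 Ci Ci' adi Ei'.
  split; [|exact: complexP|exact: complexP].
  by apply: ae_imp (ae_and u1 v1) => x [h1 h2] x0; apply: complexP; [exact: h1|exact: h2].
have [l0 l1] := closr_lim ha sP P1 P0 Cr adr.
have [m0 m1] := closr_lim ha sP P1 P0 Ci adi.
split; first exact: ess_lim0_rlim0.
apply: ess_lim0_rlim0.
  by under eq_fun do rewrite /rsc /= creB.
by under eq_fun do rewrite /rsc /= cimB.
Qed.

End ComplexHalfLine.

(** * Reflection *)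

Section Reflection.
Context {R : realType}.
Local Notation mu := (@lebesgue_measure R).
Implicit Types (D : set (measurableTypeR R)) (f g : R -> R[i]) (u : R -> R).

(** Also applied to sets, which are predicates: [refl D] is then the mirror image of [D]. *)
Definition refl (T : Type) (f : R -> T) : R -> T := fun x => f (- x).

Lemma reflK T (f : R -> T) : refl (refl f) = f.
Proof. by apply/funext => x; rewrite /refl opprK. Qed.

Lemma refl_Rpos : refl (@Rpos R) = Rneg.
Proof. by apply/seteqP; split => x; rewrite /refl /Rpos /Rneg /= oppr_gt0. Qed.

Lemma refl_Rneg : refl (@Rneg R) = Rpos.
Proof. by rewrite -refl_Rpos reflK. Qed.

Lemma measurable_opp : measurable_fun [set: measurableTypeR R] (-%R : R -> measurableTypeR R).
Proof. exact: oppr_measurable. Qed.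

Lemma measurable_reflset D : measurable D -> measurable (refl D : set (measurableTypeR R)).
Proof. by move=> mD; have := measurable_opp measurableT mD; rewrite setTI. Qed.

Lemma measurable_refl D (F : R -> R) : measurable D -> measurable_fun D F ->
  measurable_fun (refl D : set (measurableTypeR R)) (refl F).
Proof.
move=> mD mF; apply: (measurable_comp mD (g := (-%R : R -> measurableTypeR R)) _ mF) => //.
  by move=> _ [x Dx <-].
Qed.

Lemma integral_refl D (F : R -> \bar R) : measurable D -> measurable_fun D F ->
  (forall x, D x -> (0 <= F x)%E) ->
  (\int[mu]_(x in refl D) F (- x)%R = \int[mu]_(x in D) F x)%E.
Proof.
move=> mD mF F0.
have F0' : {in D, forall y, (0 <= F y)%E} by move=> x; rewrite inE => /F0.
transitivity (\int[pushforward mu (-%R : R -> measurableTypeR R)]_(y in D) F y)%E.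
  by rewrite (ge0_integral_pushforward measurable_opp _ mD mF F0').
by apply: eq_measure_integral => A mA _; exact: lebesgue_measureN.
Qed.

(** Change of variables is available for nonnegative functions, so positive and negative parts are
    reflected separately; measurability then suffices for the weak equation. *)
Lemma Rintegral_refl D (F : R -> R) : measurable D -> measurable_fun D F ->
  Rintegral mu (refl D) (refl F) = Rintegral mu D F.
Proof.
move=> mD mF; rewrite /Rintegral; congr fine.
have mF' : measurable_fun D (EFin \o F) by exact/measurable_EFinP.
rewrite integralE [RHS]integralE.
congr (_ - _)%E.
  have p0 x : D x -> (0 <= (EFin \o F)^\+ x)%E by move=> _; exact: funepos_ge0.
  rewrite -[RHS](integral_refl mD (measurable_funepos mF') p0).
  by apply: eq_integral => x _; rewrite !funeposE.
have n0 x : D x -> (0 <= (EFin \o F)^\- x)%E by move=> _; exact: funeneg_ge0.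
rewrite -[RHS](integral_refl mD (measurable_funeneg mF') n0).
by apply: eq_integral => x _; rewrite !funenegE.
Qed.

Lemma ae_refl (A : R -> Prop) : {ae mu, forall x, A x} -> {ae mu, forall x, A (- x)}.
Proof.
move=> [N [mN N0 sub]]; exists (refl N); split; first exact: measurable_reflset.
  by have := lebesgue_measureN mN; rewrite N0.
by move=> x nA; exact: sub.
Qed.

(** Weaker than [L2], but enough to reflect integrals: test functions satisfy it on every measurable
    set. *)
Definition cmeas D f := measurable_fun D (fun x => cre (f x)) /\ measurable_fun D (fun x => cim (f x)).

Lemma measurable_sqmodB D f g : cmeas D f -> cmeas D g ->
  measurable_fun D (fun x => (sqmod (f x - g x))%:E).
Proof.
move=> [fr fi] [gr gi]; apply/measurable_EFinP.
under eq_fun do rewrite /sqmod creB cimB.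
by apply: measurable_funD; apply: measurable_funX; apply: measurable_funB.
Qed.

Lemma L2_refl D f : measurable D -> L2 D f -> L2 (refl D) (refl f).
Proof.
move=> mD [mr [mi h]]; split; first exact: (measurable_refl mD mr).
split; first exact: (measurable_refl mD mi).
rewrite (integral_refl mD (F := fun x => (sqmod (f x))%:E)) //.
  apply/measurable_EFinP; apply: measurable_funD; exact: measurable_funX.
by move=> x _; rewrite lee_fin addr_ge0 // sqr_ge0.
Qed.

Lemma L2_cvg_refl D (u : nat -> R -> R[i]) f : measurable D ->
  (forall n, cmeas D (u n)) -> cmeas D f -> L2_cvg D u f ->
  L2_cvg (refl D) (fun n => refl (u n)) (refl f).
Proof.
move=> mD mu_ mf; rewrite /L2_cvg.
under [X in _ -> X @ _ --> _]eq_fun => n.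
  rewrite (integral_refl mD (F := fun x => (sqmod (u n x - f x))%:E)).
  - over.
  - exact: measurable_sqmodB.
  - by move=> x _; rewrite lee_fin addr_ge0 // sqr_ge0.
by [].
Qed.

Lemma compact_support_refl D (V : zmodType) (f : R -> V) :
  compact_support_in D f -> compact_support_in (refl D) (refl f).
Proof.
move=> [K [cK [KD Kf]]]; exists (refl K); split; last first.
  by split=> [x /KD|x nK]; [|exact: Kf].
have -> : refl K = (-%R : R -> R) @` K.
  apply/seteqP; split=> [x Kx|_ [x Kx <-]]; first by exists (- x); rewrite ?opprK.
  by rewrite /refl opprK.
apply: continuous_compact => //; apply: continuous_subspaceT; exact: opp_continuous.
Qed.

Lemma smooth_refl u : smooth u -> smooth (refl u).
Proof.
move=> /smooth_onT su; apply/smooth_onT.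
have -> : refl u = (fun x => u (-1 * x + 0)) by apply/funext => x; rewrite /refl mulN1r addr0.
exact: (smooth_on_affine (V := setT) openT).
Qed.

Lemma derive1_refl u : smooth u -> derive1 (refl u) = fun x => - derive1 u (- x).
Proof.
move=> /smooth_onT su; apply/funext => x.
have -> : refl u = (fun x => u (-1 * x + 0)) by apply/funext => y; rewrite /refl mulN1r addr0.
have [_ h] := is_derive_affine (k := -1) (m := 0) su (x := x) I.
by rewrite derive1E h mulN1r addr0 mulN1r.
Qed.

Lemma smooth_derive1 u : smooth u -> smooth (derive1 u).
Proof. by move=> /smooth_onT su; apply/smooth_onT; exact: smooth_on_derive1. Qed.

Lemma derive1n2_refl u : smooth u -> derive1n 2 (refl u) = refl (derive1n 2 u).
Proof.
move=> su; have su1 := smooth_derive1 su.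
have E : derive1 (refl u) = (fun x => -1 * refl (derive1 u) x).
  by rewrite derive1_refl //; apply/funext => x; rewrite mulN1r.
have -> : derive1n 2 (refl u) = derive1 (derive1 (refl u)) by [].
apply/funext => x; rewrite E.
have d : is_derive x 1 (refl (derive1 u)) (- derive1 (derive1 u) (- x)).
  have /smooth_onT/smooth_on_is_derive/(_ I) := smooth_refl su1.
  by move=> /(_ x); rewrite derive1_refl.
have d' : is_derive x 1 (fun y => -1 * refl (derive1 u) y) (-1 * - derive1 (derive1 u) (- x)).
  by apply: is_derive_eq; rewrite -![_ *: _]/(_ * _) ?mulr0 ?addr0.
by have [_ h] := d'; rewrite derive1E h mulN1r opprK.
Qed.

Lemma smooth_measurable u D : smooth u -> measurable D -> measurable_fun D u.
Proof.
move=> /smooth_onT su mD; apply: (@measurable_funS _ _ _ _ setT) => //.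
apply: continuous_measurable_fun => x; exact: (smooth_on_continuous su).
Qed.

Section Operator.
Context (alpha : R) (k : int).

Lemma measurable_Vpot D : measurable D -> measurable_fun D (Vpot alpha k).
Proof.
move=> mD; apply: (@measurable_funS _ _ _ _ setT) => //.
have mn s : measurable_fun [set: measurableTypeR R] (fun x : R => `|x| `^ s).
  exact: (measurableT_comp (measurable_powR s) (@normr_measurable R setT)).
rewrite (_ : Vpot alpha k = fun x => k%:~R ^+ 2 * `|x| `^ (2 * alpha)
    + alpha * (2 + alpha) / 4 * `|x| `^ (- 2%:R)).
  by apply: measurable_funD; apply: measurable_funM => //; exact: mn.
apply/funext => x; rewrite /Vpot; congr (_ + _).
(* At 0 both sides rest on conventions: the inverse of 0 is 0, and so is 0 to a nonzero real
   power. *)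
have [->|x0] := eqVneq x 0.
  by rewrite normr0 powR0 ?oppr_eq0 // expr0n mulr0 invr0 !mulr0.
rewrite powR_invn // real_normK ?num_real // invfM; ring.
Qed.

(** The potential is even, and the two sign changes in the second derivative cancel. *)
Lemma Sr_refl u : smooth u -> Sr alpha k (refl u) = refl (Sr alpha k u).
Proof.
move=> su; apply/funext => x; rewrite /Sr derive1n2_refl // /refl /Vpot normrN sqrrN.
by [].
Qed.

Lemma smooth_derive1n u n : smooth u -> smooth (derive1n n u).
Proof. by move=> su; elim: n => [|n IH]; [exact: su|rewrite derive1nS; exact: smooth_derive1]. Qed.

Lemma measurable_Sr u D : smooth u -> measurable D -> measurable_fun D (Sr alpha k u).
Proof.
move=> su mD; apply: measurable_funD; last first.
  by apply: measurable_funM; [exact: measurable_Vpot|exact: smooth_measurable].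
have m2 : measurable_fun D (derive1n 2 u) by apply: smooth_measurable mD; exact: smooth_derive1n.
exact: measurable_funN m2.
Qed.

Lemma rtest_refl D u : rtest D u -> rtest (refl D) (refl u).
Proof. by move=> [su cu]; split; [exact: smooth_refl|exact: compact_support_refl]. Qed.

Lemma ctest_refl D f : ctest D f -> ctest (refl D) (refl f).
Proof.
move=> [sr [si cf]]; split; first exact: (smooth_refl sr).
by split; [exact: (smooth_refl si)|exact: compact_support_refl].
Qed.

Lemma weakS_refl D g h : measurable D -> L2 D g -> L2 D h ->
  weakS alpha k D g h -> weakS alpha k (refl D) (refl g) (refl h).
Proof.
move=> mD [gr [gi _]] [hr [hi _]] W u tu.
have tu' := rtest_refl tu; rewrite reflK in tu'.
have [E1 E2] := W _ tu'; have [su _] := tu; have [su' _] := tu'.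
have mS := measurable_Sr su' mD; have mu' := smooth_measurable su' mD.
have uE : refl (refl u) = u := reflK u.
have SE : refl (Sr alpha k (refl u)) = Sr alpha k u by rewrite Sr_refl // reflK.
split.
  rewrite -SE -[in RHS]uE.
  rewrite (Rintegral_refl mD (F := fun x => cre (g x) * Sr alpha k (refl u) x)); last exact: measurable_funM.
  by rewrite (Rintegral_refl mD (F := fun x => cre (h x) * refl u x)); last exact: measurable_funM.
rewrite -SE -[in RHS]uE.
rewrite (Rintegral_refl mD (F := fun x => cim (g x) * Sr alpha k (refl u) x)); last exact: measurable_funM.
by rewrite (Rintegral_refl mD (F := fun x => cim (h x) * refl u x)); last exact: measurable_funM.
Qed.

Lemma ctest_cmeas D E f : measurable E -> ctest D f -> cmeas E f.
Proof. by move=> mE [sr [si _]]; split; exact: smooth_measurable. Qed.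

Lemma L2_cmeas D f : L2 D f -> cmeas D f.
Proof. by move=> [mr [mi _]]. Qed.

Lemma clos_dom_half_refl D phi : measurable D -> clos_dom_half alpha k D phi ->
  clos_dom_half alpha k (refl D) (refl phi).
Proof.
move=> mD [Lp [u [cu [up [h [Lh uh]]]]]]; split; first exact: L2_refl.
exists (fun n => refl (u n)); split; first by move=> n; exact: ctest_refl.
split; first by apply: L2_cvg_refl => // [n|]; [exact: ctest_cmeas (cu n)|exact: L2_cmeas].
exists (refl h); split; first exact: L2_refl.
have E n : Sc alpha k (refl (u n)) = refl (Sc alpha k (u n)).
  have [sr [si _]] := cu n; apply/funext => x; rewrite /Sc {2}/refl.
  by rewrite -[fun y => cre (refl (u n) y)]/(refl (fun y => cre (u n y)))
    -[fun y => cim (refl (u n) y)]/(refl (fun y => cim (u n y))) !Sr_refl.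
under [X in L2_cvg _ X]eq_fun do rewrite E.
apply: L2_cvg_refl => // [n|]; last exact: L2_cmeas.
by have [sr [si _]] := cu n; split; exact: measurable_Sr.
Qed.

Lemma H2_0_refl D phi : measurable D -> H2_0 D phi -> H2_0 (refl D) (refl phi).
Proof.
move=> mD [Lp [u [cu [up [[h1 [Lh1 uh1]] [h2 [Lh2 uh2]]]]]]]; split; first exact: L2_refl.
exists (fun n => refl (u n)); split; first by move=> n; exact: ctest_refl.
split; first by apply: L2_cvg_refl => // [n|]; [exact: ctest_cmeas (cu n)|exact: L2_cmeas].
have mc j n : cmeas D (cderive j (u n)).
  have [sr [si _]] := cu n.
  have m1 : measurable_fun D (derive1n j (fun y => cre (u n y))).
    by apply: smooth_measurable mD; exact: smooth_derive1n.
  have m2 : measurable_fun D (derive1n j (fun y => cim (u n y))).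
    by apply: smooth_measurable mD; exact: smooth_derive1n.
  by split.
split.
  (* Reflection changes the sign of the first derivative, hence of its limit. *)
  exists (fun x => - refl h1 x); split.
    have := L2_refl mD Lh1; move=> /(L2_sqint _ (measurable_reflset mD))[hr hi].
    apply/L2_sqint; first exact: measurable_reflset.
    by split; [apply: eq_sqint (sqintN (measurable_reflset mD) hr)|apply: eq_sqint (sqintN (measurable_reflset mD) hi)];
      rewrite ?/refl; try exact: measurable_reflset; move=> x _; case: (h1 (- x)).
  have := L2_cvg_refl mD (mc 1%N) (L2_cmeas Lh1) uh1.
  rewrite /L2_cvg; under [X in _ -> X @ _ --> _]eq_fun => n.
    under eq_integral => x _.
      rewrite (_ : sqmod _ = sqmod (refl (cderive 1 (u n)) x - refl h1 x)); first over.
      have [sr [si _]] := cu n.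
      rewrite /cderive /refl /sqmod !creB !cimB.
      rewrite -[derive1n 1 _]/(derive1 (refl (fun y => cre (u n y)))) derive1_refl //.
      rewrite -[derive1n 1 (fun y => cim (u n (- y)))]/(derive1 (refl (fun y => cim (u n y)))) derive1_refl //.
      by case: (h1 (- x)) => p q /=; ring.
    over.
  by [].
exists (refl h2); split; first exact: L2_refl.
have E n : cderive 2 (refl (u n)) = refl (cderive 2 (u n)).
  have [sr [si _]] := cu n; apply/funext => x; rewrite /cderive {2}/refl.
  by rewrite -[fun y => cre (refl (u n) y)]/(refl (fun y => cre (u n y)))
    -[fun y => cim (refl (u n) y)]/(refl (fun y => cim (u n y))) !derive1n2_refl.
under [X in L2_cvg _ X]eq_fun do rewrite E.
by apply: L2_cvg_refl => //; exact: L2_cmeas.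
Qed.

Lemma ess_lim0_refl D f l : ess_lim0 D f l -> ess_lim0 (refl D) (refl f) l.
Proof.
move=> H e /H[d [d0 Hd]]; exists d; split=> //.
by apply: ae_imp (ae_refl Hd) => x E Dx; rewrite -normrN; exact: E.
Qed.

Lemma half_line_statement_refl P D g : measurable D ->
  half_line_statement alpha k P D g -> half_line_statement alpha k (refl P) (refl D) (refl g).
Proof.
move=> mD [phi [g0 [g1 [C H E U [l0 l1]]]]].
have drE Q psi b0 b1 : decomp_rhs alpha (refl Q) (refl psi) b0 b1 = refl (decomp_rhs alpha Q psi b0 b1).
  by apply/funext => x; rewrite /decomp_rhs /refl normrN.
exists (refl phi), g0, g1; split.
- exact: clos_dom_half_refl.
- exact: H2_0_refl.
- by rewrite drE; exact: (ae_refl E).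
- move=> phi' b0 b1 C' E'.
  have mD' := measurable_reflset mD.
  (* A competitor on the mirror image is reflected back to [D], where uniqueness is known. *)
  have C'' := clos_dom_half_refl mD' C'; rewrite reflK in C''.
  have [|U1 -> ->] := U _ b0 b1 C''.
    have := ae_refl E'; apply: ae_imp => x; rewrite /refl opprK => h Dx.
    by rewrite h // /decomp_rhs !normrN opprK.
  split => //; have := ae_refl U1; apply: ae_imp => x h Dx.
  by have := h Dx; rewrite /refl opprK.
split.
  rewrite (_ : (fun x => _) = refl (fun x => rsc (`|x| `^ (alpha / 2)) (g x))).
    exact: ess_lim0_refl.
  by apply/funext => x; rewrite /refl normrN.
rewrite (_ : (fun x => _) = refl (fun x => rsc (`|x| `^ (- (1 + alpha / 2)))
  (g x - rsc (`|x| `^ (- (alpha / 2))) g0))); first exact: ess_lim0_refl.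
by apply/funext => x; rewrite /refl normrN.
Qed.

End Operator.
End Reflection.

(** * Dependence on values in the half-line only *)

Section Extensionality.
Context {R : realType} (alpha : R) (k : int).
Local Notation mu := (@lebesgue_measure R).
Implicit Types (D : set (measurableTypeR R)) (phi psi : R -> R[i]).

Lemma eq_L2_cvg D (u : nat -> R -> R[i]) phi psi : (forall x, D x -> phi x = psi x) ->
  L2_cvg D u phi -> L2_cvg D u psi.
Proof.
move=> E; rewrite /L2_cvg (_ : (fun n => _) = (fun n => \int[mu]_(x in D) (sqmod (u n x - psi x))%:E)%E) //.
by apply/funext => n; apply: eq_integral => x; rewrite inE => Dx; rewrite E.
Qed.

Lemma eq_clos_dom_half D phi psi : measurable D -> (forall x, D x -> phi x = psi x) ->
  clos_dom_half alpha k D phi -> clos_dom_half alpha k D psi.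
Proof.
move=> mD E [Lp [u [cu [up H]]]]; split; first exact: eq_L2 E Lp.
by exists u; split => //; split => //; exact: eq_L2_cvg up.
Qed.

Lemma eq_H2_0 D phi psi : measurable D -> (forall x, D x -> phi x = psi x) ->
  H2_0 D phi -> H2_0 D psi.
Proof.
move=> mD E [Lp [u [cu [up H]]]]; split; first exact: eq_L2 E Lp.
by exists u; split => //; split => //; exact: eq_L2_cvg up.
Qed.

Lemma L2S D E phi : measurable D -> measurable E -> E `<=` D -> L2 D phi -> L2 E phi.
Proof.
move=> mD mE ED /(L2_sqint _ mD)[h1 h2]; apply/L2_sqint => //.
by split; [exact: sqintS h1|exact: sqintS h2].
Qed.

End Extensionality.

(** * Gluing the two half-lines *)

Theorem theorem5p5 (R : realType) (alpha : R) (k : int) (P : R -> R) :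
  0 <= alpha < 1 ->
  smooth P ->
  (forall x : R, `|x| < 1 -> P x = 1) ->
  (forall x : R, 2 < `|x| -> P x = 0) ->
  forall g : R -> R[i], max_dom alpha k g ->
  exists (phi : R -> R[i]) (g0m g1m g0p g1p : R[i]),
    [/\ clos_dom alpha k phi,
        (k != 0 -> H2_0 Rneg phi /\ H2_0 Rpos phi),
        ae_eq_on Rneg g (decomp_rhs alpha P phi g0m g1m) /\
        ae_eq_on Rpos g (decomp_rhs alpha P phi g0p g1p),
        (forall (phi' : R -> R[i]) (a0 a1 b0 b1 : R[i]),
           clos_dom alpha k phi' ->
           ae_eq_on Rneg g (decomp_rhs alpha P phi' a0 a1) ->
           ae_eq_on Rpos g (decomp_rhs alpha P phi' b0 b1) ->
           [/\ ae_eq_on setT phi' phi, a0 = g0m, a1 = g1m, b0 = g0p & b1 = g1p])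
      & [/\ ess_lim0 Rneg (fun x => rsc (`|x| `^ (alpha / 2)) (g x)) g0m,
            ess_lim0 Rpos (fun x => rsc (`|x| `^ (alpha / 2)) (g x)) g0p,
            ess_lim0 Rneg (fun x => rsc (`|x| `^ (- (1 + alpha / 2)))
                                        (g x - rsc (`|x| `^ (- (alpha / 2))) g0m)) g1m
          & ess_lim0 Rpos (fun x => rsc (`|x| `^ (- (1 + alpha / 2)))
                                        (g x - rsc (`|x| `^ (- (alpha / 2))) g0p)) g1p]].
Proof.
move=> ha sP P1 P0 g [Lg [[hm [Lhm Wm]] [hp [Lhp Wp]]]].
have mp : measurable (Rpos : set (measurableTypeR R)) := measurable_Rpos.
have mm : measurable (Rneg : set (measurableTypeR R)).
  by rewrite -refl_Rpos; exact: measurable_reflset.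
have Lgp : L2 Rpos g by apply: L2S Lg.
have Lgm : L2 Rneg g by apply: L2S Lg.
have [phip [g0p [g1p [Cp Hp Ep Up [l0p l1p]]]]] := half_line_Rpos ha sP P1 P0 Lgp Lhp Wp.
have [phim [g0m [g1m [Cm Hm Em Um [l0m l1m]]]]] : half_line_statement alpha k P Rneg g.
  (* [P] may fail to be even, so the positive half-line is treated with the reflected cutoff, which
     satisfies the same conditions because they involve |x| only. *)
  rewrite -(reflK P) -(reflK g) -refl_Rpos; apply: half_line_statement_refl => //.
  have := L2_refl mm Lgm; have := L2_refl mm Lhm; have := weakS_refl mm Lgm Lhm Wm.
  rewrite refl_Rneg => W Lh' Lg'; apply: (half_line_Rpos ha _ _ _ Lg' Lh' W).
  - exact: smooth_refl.
  - by move=> x x1; apply: P1; rewrite normrN.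
  - by move=> x x2; apply: P0; rewrite normrN.
pose phi x := if x < 0 then phim x else phip x.
have em x : Rneg x -> phim x = phi x by rewrite /Rneg /phi /= => ->.
have ep x : Rpos x -> phip x = phi x by rewrite /Rpos /phi /= => x0; rewrite ltNge ltW.
exists phi, g0m, g1m, g0p, g1p; split.
- by split; [exact: eq_clos_dom_half em Cm|exact: eq_clos_dom_half ep Cp].
- by move=> _; split; [exact: eq_H2_0 em Hm|exact: eq_H2_0 ep Hp].
- split; [move: Em|move: Ep]; apply: ae_imp => x E Dx; rewrite E // /decomp_rhs.
    by rewrite em.
  by rewrite ep.
- move=> phi' a0 a1 b0 b1 [Cm' Cp'] Em' Ep'.
  have [u1 -> ->] := Um _ _ _ Cm' Em'; have [v1 -> ->] := Up _ _ _ Cp' Ep'.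
  split => //.
  (* The two half-lines leave out the point 0, a null set. *)
  have n0 : {ae @lebesgue_measure R, forall x : R, x != 0}.
    exists [set 0]; split; [exact: measurable_set1|exact: lebesgue_measure_set1|].
    by move=> x /= /negP; rewrite negbK => /eqP.
  apply: ae_imp (ae_and n0 (ae_and u1 v1)) => x [x0 [h1 h2]] _.
  have [xm|xp] := ltP x 0; first by rewrite h1 // em.
  have xp' : Rpos x by rewrite /Rpos /= lt_neqAle eq_sym x0.
  by rewrite h2 // ep.
by split.
Qed.
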